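(* Let $X(t)=\sum_{k\ge1}\mathbf 1_{A_k(t)}$, $b(t)=\mathbb E X(t)$ and $a(t)=\operatorname{Var}X(t)$ be as in the context. Assume that all of the following conditions hold. (i) $\lim_{t\to\infty}a(t)=\infty$. (ii) There exists a nondecreasing function $a_0$ such that $a(t)\sim a_0(t)$ as $t\to\infty$. (iii) There exists $\mu^\ast\ge 1$ such that $b(t)=O((a(t))^{\mu^\ast})$ as $t\to\infty$. Put $\mu:=\inf\{\mu^\ast\ge 1: b(t)=O((a(t))^{\mu^\ast})\}$. (iv) If $\mu=1$: either $b$ is eventually continuous or $\liminf_{t\to\infty}\big(\log b(t-1)/\log b(t)\big)>0$; and there are $q\ge 0$ and a function $\mathcal L$ slowly varying at $\infty$ such that, with $f_s(t):=(\log t)^s\mathcal L(\log t)$, one has $b(t)/a(t)=O(f_q(a(t)))$ as $t\to\infty$ and, if $q>0$, $b(t)/a(t)\ne O(f_s(a(t)))$ for every $s\in(0,q)$. (v) For each $k\in\mathbb N$ and $t>s>0$, $A_k(s)\subseteq A_k(t)$. (vi) For each $\varrho\in(0,1)$ and each positive $\kappa$ sufficiently close to $0$, there is $A>1$ such that for each $n$ large enough there is a partition $t_n=t_{0,n}<t_{1,n}<\dots<t_{j,n}=t_{n+1}$, $j=j_n$, with $1\le b(t_{k,n})-b(t_{k-1,n})\le A$ for $1\le k\le j$, and such that, for all $\varepsilon>0$, the sequence $\big(j_n\exp(-\varepsilon(a(t_n))^{1/2})\big)$ is summable. Here $t_n=t_n(\kappa,\mu)$ (depending also on $\varrho$) is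 defined in the context. (vii) The function $a$ is eventually continuous, or else $\lim_{t\to\infty}(\log a(t-1)/\log a(t))=1$ if $\mu=1$ and $\lim_{t\to\infty}(a(t-1)/a(t))=1$ if $\mu>1$. (viii) At least one of the following two conditions holds, where $\tau_n(\gamma,\mu)$ is defined in the context: (viii.1) there exist $s_0>0$, $\varsigma_0>0$ and a family $(R_\varsigma(t))_{0<\varsigma<\varsigma_0,\,t>s_0}$ of sets of positive integers such that for each $\gamma>0$ close to $0$ and all $0<\varsigma<\varsigma_0$ there exists $n_0=n_0(\varsigma,\gamma)\in\mathbb N$ for which the sets $R_\varsigma(\tau_{n_0}(\gamma,\mu)),R_\varsigma(\tau_{n_0+1}(\gamma,\mu)),\dots$ are disjoint, and $$\lim_{t\to\infty}\frac{\operatorname{Var}\big(\sum_{k\in R_\varsigma(t)}\mathbf 1_{A_k(t)}\big)}{\operatorname{Var}X(t)}=1-\varsigma;$$ (viii.2) there exist $s_0>0$ and a family $(R_0(t))_{t>s_0}$ of sets of positive integers such that for each $\gamma>0$ close to $0$ there exists $n_0=n_0(\gamma)\in\mathbb N$ for which the sets $R_0(\tau_{n_0}(\gamma,\mu)),R_0(\tau_{n_0+1}(\gamma,\mu)),\dots$ are disjoint, and $$\lim_{t\to\infty}\frac{\operatorname{Var}\big(\sum_{k\in R_0(t)}\mathbf 1_{A_k(t)}\big)}{\operatorname{Var}X(t)}=1.$$ Then, if $\mu=1$, $$\limsup_{t\to\infty}\frac{X(t)-\mathbb E X(t)}{(2(q+1)\operatorname{Var}X(t)\log\log\operatorname{Var}X(t))^{1/2}}=1\quad\text{almost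 surely},$$ and, if $\mu>1$, $$\limsup_{t\to\infty}\frac{X(t)-\mathbb E X(t)}{(2(\mu-1)\operatorname{Var}X(t)\log\operatorname{Var}X(t))^{1/2}}=1\quad\text{almost surely}.$$
   Context: Let $(A_1(t))_{t\ge0},(A_2(t))_{t\ge0},\dots$ be independent families of events on a common probability space $(\Omega,\mathcal F,\mathbb P)$ (families with different indices are independent; events within one family may be dependent). Put $X(t):=\sum_{k\ge1}\mathbf 1_{A_k(t)}$ for $t\ge0$. It is assumed throughout that, for each $t\ge0$, $X(t)<\infty$ a.s. and $b(t):=\mathbb E X(t)=\sum_{k\ge1}\mathbb P(A_k(t))<\infty$. Put $a(t):=\operatorname{Var}X(t)=\sum_{k\ge1}\mathbb P(A_k(t))(1-\mathbb P(A_k(t)))\le b(t)$. $x(t)\sim y(t)$ means $x(t)/y(t)\to1$. A function on $[0,\infty)$ has a property ''eventually'' if it has it on $[T,\infty)$ for some $T\ge0$. A positive measurable function $\ell$ defined on a neighborhood of $\infty$ is slowly varying at $\infty$ if $\ell(\lambda t)/\ell(t)\to1$ as $t\to\infty$ for all $\lambda>0$. ''For each positive $\kappa$ sufficiently close to $0$'' means: there is $\kappa_0>0$ such that for all $\kappa\in(0,\kappa_0)$; similarly for ''$\gamma$ close to $0$''. Definition of $t_n$: for $\varrho\in(0,1)$ and $\kappa\in(0,1)$ put $\mu_\varrho:=\mu+\varrho$ if $\mu>1$ and $q_\varrho:=q+\varrho$ if $\mu=1$; $v_n(\kappa,1):=\exp(n^{(1-\kappa)/(q_\varrho+1)})$ if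 $\mu=1$, and $v_n(\kappa,\mu):=n^{\mu_\varrho(1-\kappa)/(\mu_\varrho-1)}$ if $\mu>1$; and $t_n=t_n(\kappa,\mu):=\inf\{t>0:b(t)>v_n(\kappa,\mu)\}$, $n\in\mathbb N$. Definition of $\tau_n$: for $\gamma>0$ put $w_n(\gamma,1):=\exp(n^{(1+\gamma)/(q+1)})$ if $\mu=1$ and $w_n(\gamma,\mu):=n^{(1+\gamma)/(\mu-1)}$ if $\mu>1$; and $\tau_n=\tau_n(\gamma,\mu):=\inf\{t>0:a(t)>w_n(\gamma,\mu)\}$ for large $n\in\mathbb N$. *)

(* Defs.v *)
From HB Require Import structures.
From mathcomp Require Import all_boot all_order all_algebra.
From mathcomp Require Import all_classical all_reals all_analysis.

Set Implicit Arguments.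
Unset Strict Implicit.
Unset Printing Implicit Defensive.

Import Order.TTheory GRing.Theory Num.Theory.
Import numFieldNormedType.Exports.

Local Open Scope classical_set_scope.
Local Open Scope ring_scope.

Section events.
Context d (T : measurableType d) (R : realType) (P : probability T R).

Definition independent_classes (C : nat -> set (set T)) : Prop :=
  forall (I : seq nat) (E : nat -> set T), uniq I ->
    (forall k, k \in I -> C k (E k)) ->
    P (\bigcap_(k in [set` I]) E k) = (\prod_(k <- I) P (E k))%E.

(* [A k] is the family A_(k+1) of the informal indexing by k >= 1; only the
   values [A k t] with 0 <= t are meaningful. *)
Implicit Types (A : nat -> R -> set T) (S : set nat).

Definition independent_families A : Prop :=
  independent_classes (fun k => [set A k t | t in `[0, +oo[]).

Definition ecount_events A (t : R) (w : T) : \bar R :=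
  (\sum_(k <oo) (\1_(A k t) w)%:E)%E.

(* Real-valued X(t); equal to 0 on the (null) event that the sum diverges. *)
Definition count_events A (t : R) (w : T) : R := fine (ecount_events A t w).

Definition count_events_in A S (t : R) (w : T) : R :=
  fine (\sum_(k <oo | k \in S) (\1_(A k t) w)%:E)%E.

Definition mean_count A (t : R) : R := fine 'E_P[count_events A t].

Definition var_count A (t : R) : R := fine 'V_P[count_events A t].

Definition var_count_in A S (t : R) : R := fine 'V_P[count_events_in A S t].

End events.

Section growth.
Context (R : realType).
Implicit Types (f g a b L : R -> R) (mu q : R).

Definition pinfty_filter : filter_on R := FilterType +oo_R _.

Definition bigO_infty f g : Prop := f =O_pinfty_filter g.

Definition eventually_continuous f : Prop :=
  exists2 T0 : R, 0 <= T0 & {within `[T0, +oo[, continuous f}.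

Definition slowly_varying (L : R -> R) : Prop :=
  (exists M : R, measurable_fun `]M, +oo[ L /\ forall t, M < t -> 0 < L t) /\
  forall lam : R, 0 < lam -> L (lam * t) / L t @[t --> +oo] --> (1 : R).

Definition growth_exponents a b : set R :=
  [set m | 1 <= m /\ bigO_infty b (fun t => a t `^ m)].

Definition growth_index a b : R := inf (growth_exponents a b).

Definition log_gauge L (s t : R) : R := (ln t) `^ s * L (ln t).

Definition v_seq (rho kappa mu q : R) (n : nat) : R :=
  if mu == 1 then expR (n%:R `^ ((1 - kappa) / ((q + rho) + 1)))
  else n%:R `^ ((mu + rho) * (1 - kappa) / ((mu + rho) - 1)).

Definition t_seq b (rho kappa mu q : R) (n : nat) : R :=
  inf [set t | 0 < t /\ v_seq rho kappa mu q n < b t].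

Definition w_seq (gamma mu q : R) (n : nat) : R :=
  if mu == 1 then expR (n%:R `^ ((1 + gamma) / (q + 1)))
  else n%:R `^ ((1 + gamma) / (mu - 1)).

Definition tau_seq a (gamma mu q : R) (n : nat) : R :=
  inf [set t | 0 < t /\ w_seq gamma mu q n < a t].

Definition partition_with_increments b (B x y : R) (j : nat) (s : nat -> R) :
    Prop :=
  [/\ (0 < j)%N, s 0%N = x, s j = y,
      (forall k, (k < j)%N -> s k < s k.+1) &
      (forall k, (k < j)%N -> 1 <= b (s k.+1) - b (s k) <= B)].

(* Here [s n k] is t_(k,n); the values of [j n] and [s n] are unconstrained for
   the finitely many n < N, which does not affect summability. *)
Definition partition_condition a b (mu q : R) : Prop :=
  forall rho : R, 0 < rho < 1 ->
  exists2 kappa0 : R, 0 < kappa0 &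
  forall kappa : R, 0 < kappa < kappa0 ->
  exists2 B : R, 1 < B &
  exists (N : nat) (j : nat -> nat) (s : nat -> nat -> R),
    (forall n, (N <= n)%N ->
      partition_with_increments b B
        (t_seq b rho kappa mu q n) (t_seq b rho kappa mu q n.+1) (j n) (s n)) /\
    (forall eps : R, 0 < eps ->
      cvgn (series (fun n => (j n)%:R *
        expR (- eps * Num.sqrt (a (t_seq b rho kappa mu q n)))))).

End growth.

Section selection.
Context d (T : measurableType d) (R : realType) (P : probability T R).
Variable A : nat -> R -> set T.

(* [S] is meaningful on ]s0, +oo[ only, hence the requirement that the points
   tau_n at which it is evaluated lie there. *)
Definition disjoint_along_tau (mu q s0 gamma : R) (S : R -> set nat) : Prop :=
  exists n0 : nat,
    (forall n, (n0 <= n)%N -> s0 < tau_seq (var_count P A) gamma mu q n) /\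
    trivIset [set n | (n0 <= n)%N]
      (fun n => S (tau_seq (var_count P A) gamma mu q n)).

Definition selection_approx (mu q : R) : Prop :=
  exists (s0 sig0 : R) (S : R -> R -> set nat),
    [/\ 0 < s0, 0 < sig0,
      (exists2 gamma0 : R, 0 < gamma0 &
        forall gamma sig : R, 0 < gamma < gamma0 -> 0 < sig < sig0 ->
          disjoint_along_tau mu q s0 gamma (S sig)) &
      (forall sig : R, 0 < sig < sig0 ->
        var_count_in P A (S sig t) t / var_count P A t @[t --> +oo] --> 1 - sig)].

Definition selection_exact (mu q : R) : Prop :=
  exists (s0 : R) (S : R -> set nat),
    [/\ 0 < s0,
      (exists2 gamma0 : R, 0 < gamma0 &
        forall gamma : R, 0 < gamma < gamma0 ->
          disjoint_along_tau mu q s0 gamma S) &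
      var_count_in P A (S t) t / var_count P A t @[t --> +oo] --> (1 : R)].

End selection.

(* Main.v *)
Require Import Defs.
From HB Require Import structures.
From mathcomp Require Import all_boot all_order all_algebra.
From mathcomp Require Import all_classical all_reals all_analysis.
From mathcomp Require Import measurable_realfun zify ring lra.

Set Implicit Arguments.
Unset Strict Implicit.
Unset Printing Implicit Defensive.

Import Order.TTheory GRing.Theory Num.Theory.
Import numFieldNormedType.Exports.

Local Open Scope classical_set_scope.
Local Open Scope ring_scope.

(** The centred count at time [t] is a sum of independent centred indicators of
    total variance [a t]. Its Laplace transform is almost Gaussian near [0]
    ([le_bernoulli_mgf], [ge_bernoulli_mgf]), so its tail at [x] is about
    [expR (- x ^+ 2 / (2 * a t))] as long as [x / a t] is small. At the scale
    [sqrt (2 * c * a t * H t)], with [c = q + 1] and [H = ln \o ln \o a] when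
    [mu = 1], and [c = mu - 1] and [H = ln \o a] when [1 < mu], the tail is about
    [expR (- c * H t)]. Both halves of the theorem are Borel-Cantelli arguments
    along sequences on which this quantity is close to [1 / n].

    Upper bound. The hypotheses on [b / a], or the growth index, bound the
    variance from below in terms of the mean. At the first passage of [b] over
    the level [v_n] they make [c * H] almost as large as [ln n], and they make the
    mean gained until the next passage smaller than the variance by a factor
    [n `^ (- kap)] ([growth_log], [growth_power]). The increments of the count are
    sums of independent indicators whose variance is at most that mean; chaining
    along the partition shows that they are negligible at the scale considered
    ([maximal_inequality], [count_oscillation]), and between partition points
    monotonicity in time loses at most a constant. This gives
    [ae_eventually_below_of_partition].

    Lower bound. At the first passage of [a] over the level [w_n], [c * H] hardly
    exceeds [ln n] ([ln_first_passage]). The selected index sets carry almost all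
    of the variance and are disjoint; cut down to finite sets they define
    independent events, whose probabilities are at least [1 / n] by a
    moderate-deviation lower bound ([bernoulli_tail_ge]), so infinitely many of
    them occur ([ae_infinitely_often]). The discarded indices carry too little
    variance to compensate. This gives [ae_frequently_above_of_blocks].

    Slow variation is used only through the estimate that a slowly varying
    function is dominated by every positive power
    ([slowly_varying_le_powR]). *)

(** * Exponential inequalities *)

Section exponential_inequalities.
Context {R : realType}.
Implicit Types x p s : R.

Lemma ge0_of_derive_ge0 (g g' : R -> R) : g 0 = 0 ->
  (forall x, is_derive x 1 g (g' x)) -> (forall x, 0 <= x -> 0 <= g' x) ->
  forall x, 0 <= x -> 0 <= g x.
Proof.
move=> g0 dg g'_ge0 x; rewrite le_eqVlt => /predU1P[<-|x_gt0]; first by rewrite g0.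
have [|c cx] := MVT x_gt0 (fun y _ => dg y).
  apply: continuous_subspaceT => y.
  by apply: differentiable_continuous; apply/derivable1_diffP; have [] := dg y.
rewrite g0 !subr0 => ->; apply: mulr_ge0; last exact: ltW.
by apply: g'_ge0; move: cx; rewrite in_itv/= => /andP[/ltW].
Qed.

Lemma ge0_expR_ge1 x : 0 <= x -> 1 <= expR x.
Proof. by move=> x0; rewrite -expR0 ler_expR. Qed.

Lemma onem_le_expRN x : 1 - x <= expR (- x).
Proof. exact: (expR_ge1Dx (- x)). Qed.

(** The quadratic Taylor bounds carry the factors [expR `|x|] and
    [expR (- `|x|)], which tend to [1] with [x]: this keeps the constant in the
    exponent of the tail bounds sharp. *)
Lemma le_expR_quad x : expR x <= 1 + x + x ^+ 2 / 2 * expR `|x|.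
Proof.
have [x0|x0] := leP 0 x.
  pose g y := expR (- y) * (1 + y) - 1 + y ^+ 2 / 2 : R.
  have /(_ x x0) gx : forall y, 0 <= y -> 0 <= g y.
    apply: (@ge0_of_derive_ge0 g (fun y => y * (1 - expR (- y)))).
    - by rewrite /g oppr0 expR0; lra.
    - by move=> y; rewrite /g; apply: is_derive_eq; rewrite /GRing.scale/=; field.
    - by move=> y y0; rewrite mulr_ge0 ?subr_ge0 ?expR_le1 ?oppr_le0.
  have : 0 <= g x * expR x by rewrite mulr_ge0// expR_ge0.
  rewrite /g ger0_norm// !mulrDl mulrAC -expRD addNr expR0; lra.
rewrite ltr0_norm//; set y := - x.
have y0 : 0 <= y by rewrite /y; lra.
have -> : x = - y by rewrite /y opprK.
pose g y := 1 - y + y ^+ 2 / 2 - expR (- y) : R.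
have /(_ y y0) gx : forall y, 0 <= y -> 0 <= g y.
  apply: (@ge0_of_derive_ge0 g (fun y => expR (- y) - (1 - y))).
  - by rewrite /g oppr0 expR0; lra.
  - by move=> z; rewrite /g; apply: is_derive_eq; rewrite /GRing.scale/=; field.
  - by move=> z z0; rewrite subr_ge0 onem_le_expRN.
have : 0 <= y ^+ 2 / 2 * (expR y - 1).
  by rewrite mulr_ge0 ?divr_ge0 ?sqr_ge0// subr_ge0 ge0_expR_ge1.
by move: gx; rewrite /g; lra.
Qed.

Lemma ge_expR_quad x : 1 + x + x ^+ 2 / 2 * expR (- `|x|) <= expR x.
Proof.
have [x0|x0] := leP 0 x.
  pose g y := expR y - 1 - y - y ^+ 2 / 2 : R.
  have /(_ x x0) gx : forall y, 0 <= y -> 0 <= g y.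
    apply: (@ge0_of_derive_ge0 g (fun y => expR y - (1 + y))).
    - by rewrite /g expR0; lra.
    - by move=> z; rewrite /g; apply: is_derive_eq; rewrite /GRing.scale/=; field.
    - by move=> z z0; rewrite subr_ge0 expR_ge1Dx.
  have : 0 <= x ^+ 2 / 2 * (1 - expR (- x)).
    by rewrite mulr_ge0 ?divr_ge0 ?sqr_ge0// subr_ge0 expR_le1; lra.
  by move: gx; rewrite /g ger0_norm//; lra.
rewrite ltr0_norm// opprK.
pose g y := 1 - (1 - y) * expR y - y ^+ 2 / 2 : R.
have /(_ (- x)) gx : forall y, 0 <= y -> 0 <= g y.
  apply: (@ge0_of_derive_ge0 g (fun y => y * (expR y - 1))).
  - by rewrite /g expR0; lra.
  - by move=> z; rewrite /g; apply: is_derive_eq; rewrite /GRing.scale/=; field.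
  - by move=> z z0; rewrite mulr_ge0// subr_ge0 ge0_expR_ge1.
have : 0 <= g (- x) * expR x by rewrite mulr_ge0 ?expR_ge0// gx; lra.
rewrite -[X in _ -> is_true X]subr_ge0 /g expRN; congr (0 <= _).
by field; rewrite gt_eqF// expR_gt0.
Qed.

(** The two-point law with values [1 - p] and [- p] has mean [0] and variance
    [p * (1 - p)]; its Laplace transform is Gaussian up to [expR `|s|]. *)
Lemma le_bernoulli_mgf p s : 0 <= p <= 1 ->
  p * expR (s * (1 - p)) + (1 - p) * expR (- (s * p)) <=
  expR (s ^+ 2 / 2 * (p * (1 - p)) * expR `|s|).
Proof.
move=> /andP[p0 p1]; apply: le_trans (expR_ge1Dx _).
have bd z : `|z| <= 1 ->
    expR (s * z) <= 1 + s * z + (s * z) ^+ 2 / 2 * expR `|s|.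
  move=> z1; apply: le_trans (le_expR_quad _) _.
  rewrite lerD2l ler_wpM2l ?divr_ge0 ?sqr_ge0// ler_expR normrM.
  by rewrite ler_piMr.
have b1 : `|1 - p| <= 1 by rewrite ger0_norm; lra.
have b2 : `|- p| <= 1 by rewrite normrN ger0_norm; lra.
have h1 : p * expR (s * (1 - p)) <= _ := ler_wpM2l p0 (bd _ b1).
have p1' : 0 <= 1 - p by lra.
have h2 : (1 - p) * expR (s * - p) <= _ := ler_wpM2l p1' (bd _ b2).
rewrite -(mulrN s p); apply: le_trans (lerD h1 h2) _.
by set e := expR `|s|; rewrite le_eqVlt; apply/orP; left; apply/eqP; field.
Qed.

(** The factor loses [`|s|] from the quadratic lower bound and [s ^+ 2] from
    [expR (w * (1 - w)) <= 1 + w]. *)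
Lemma ge_bernoulli_mgf p s : `|s| <= 1 -> 0 <= p <= 1 ->
  expR (s ^+ 2 / 2 * (p * (1 - p)) * (1 - `|s| - s ^+ 2)) <=
  p * expR (s * (1 - p)) + (1 - p) * expR (- (s * p)).
Proof.
move=> s1 /andP[p0 p1].
have bd z : `|z| <= 1 ->
    1 + s * z + (s * z) ^+ 2 / 2 * (1 - `|s|) <= expR (s * z).
  move=> z1; apply: le_trans (ge_expR_quad _).
  rewrite lerD2l ler_wpM2l ?divr_ge0 ?sqr_ge0//.
  apply: le_trans (onem_le_expRN _) _.
  by rewrite ler_expR lerN2 normrM ler_piMr.
have b1 : `|1 - p| <= 1 by rewrite ger0_norm; lra.
have b2 : `|- p| <= 1 by rewrite normrN ger0_norm; lra.
have h1 : _ <= p * expR (s * (1 - p)) := ler_wpM2l p0 (bd _ b1).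
have p1' : 0 <= 1 - p by lra.
have h2 : _ <= (1 - p) * expR (s * - p) := ler_wpM2l p1' (bd _ b2).
rewrite -(mulrN s p); apply: le_trans _ (lerD h1 h2).
set y := s ^+ 2 / 2 * (p * (1 - p)).
rewrite [leRHS](_ : _ = 1 + y * (1 - `|s|)); last by rewrite /y; field.
have y0 : 0 <= y by rewrite /y mulr_ge0 ?divr_ge0 ?sqr_ge0 ?mulr_ge0.
have ys : y <= s ^+ 2.
  by rewrite /y; have := sqr_ge0 s; nra.
have s0 : 0 <= `|s| by [].
have s2 : s ^+ 2 = `|s| ^+ 2 by rewrite real_normK ?num_real.
set w := y * (1 - `|s|).
have w0 : 0 <= w by rewrite mulr_ge0 ?subr_ge0.
have le_w : expR (w / (1 + w)) <= 1 + w.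
  have : 1 - w / (1 + w) <= expR (- (w / (1 + w))) by exact: onem_le_expRN.
  rewrite expRN (_ : 1 - _ = (1 + w)^-1); last by field; rewrite gt_eqF//; lra.
  by rewrite lef_pV2// posrE ?expR_gt0//; lra.
apply: le_trans le_w; rewrite ler_expR ler_pdivlMr; last by lra.
have wy : w <= y by rewrite /w; nra.
apply: le_trans (_ : w * (1 - w) * (1 + w) <= _); last first.
  by have := sqr_ge0 w; nra.
rewrite ler_pM2r; last by lra.
apply: le_trans (_ : w * (1 - y) <= _); last by rewrite ler_wpM2l//; lra.
by rewrite /w; have := mulr_ge0 y0 s0; nra.
Qed.

End exponential_inequalities.

(** * Finite sums of independent indicators *)

(** [bernoulli_mean p J g] is the expectation of [g] at the sum over [k] in [J]
    of independent centred indicators of probabilities [p k]. As a recursion it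
    needs no probability space, and its monotonicity, linearity and Laplace
    transform are inductions on [J]. *)
Fixpoint bernoulli_mean {R : realType} (p : nat -> R) (J : seq nat)
    (g : R -> R) : R :=
  if J is k :: J' then
    p k * bernoulli_mean p J' (fun z => g (z + (1 - p k))) +
    (1 - p k) * bernoulli_mean p J' (fun z => g (z - p k))
  else g 0.

Section bernoulli_mean.
Context {R : realType} (p : nat -> R).
Hypothesis p01 : forall k, 0 <= p k <= 1.
Implicit Types (J : seq nat) (g h : R -> R).

Lemma bernoulli_mean_le J g h : (forall z, g z <= h z) ->
  bernoulli_mean p J g <= bernoulli_mean p J h.
Proof.
elim: J g h => [|k J IH] g h gh /=; first exact: gh.
have /andP[p0 p1] := p01 k.
by rewrite lerD// ler_wpM2l ?subr_ge0// IH.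
Qed.

Lemma bernoulli_meanD J g h :
  bernoulli_mean p J (fun z => g z + h z) =
  bernoulli_mean p J g + bernoulli_mean p J h.
Proof. by elim: J g h => [//|k J IH] g h /=; rewrite !IH; ring. Qed.

Lemma bernoulli_meanZ J (c : R) g :
  bernoulli_mean p J (fun z => c * g z) = c * bernoulli_mean p J g.
Proof. by elim: J g => [//|k J IH] g /=; rewrite !IH; ring. Qed.

Lemma eq_bernoulli_mean J g h : g =1 h ->
  bernoulli_mean p J g = bernoulli_mean p J h.
Proof. by move=> /funext ->. Qed.

Lemma bernoulli_mean_expR J (s : R) :
  bernoulli_mean p J (fun z => expR (s * z)) =
  \prod_(k <- J) (p k * expR (s * (1 - p k)) + (1 - p k) * expR (- (s * p k))).
Proof.
elim: J => [|k J IH] /=; first by rewrite big_nil mulr0 expR0.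
rewrite big_cons -IH.
have shift c : bernoulli_mean p J (fun z => expR (s * (z + c))) =
    expR (s * c) * bernoulli_mean p J (fun z => expR (s * z)).
  rewrite -bernoulli_meanZ; apply: eq_bernoulli_mean => z.
  by rewrite -expRD -mulrDr addrC.
by rewrite (shift (1 - p k)) (shift (- p k)) mulrN [RHS]mulrDl !mulrA.
Qed.

Definition bernoulli_var J : R := \sum_(k <- J) p k * (1 - p k).

Lemma bernoulli_factor_ge0 (s : R) k :
  0 <= p k * expR (s * (1 - p k)) + (1 - p k) * expR (- (s * p k)).
Proof.
have /andP[p0 p1] := p01 k.
by rewrite addr_ge0 ?mulr_ge0 ?expR_ge0 ?subr_ge0.
Qed.

Lemma bernoulli_mean_expR_le J (s : R) :
  bernoulli_mean p J (fun z => expR (s * z)) <=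
  expR (s ^+ 2 / 2 * bernoulli_var J * expR `|s|).
Proof.
rewrite bernoulli_mean_expR /bernoulli_var mulr_sumr mulr_suml.
elim: J => [|k J IH]; first by rewrite !big_nil expR0.
rewrite !big_cons expRD ler_pM// ?bernoulli_factor_ge0//.
  by apply: prodr_ge0 => j _; exact: bernoulli_factor_ge0.
exact: le_bernoulli_mgf.
Qed.

Lemma bernoulli_mean_expR_ge J (s : R) : `|s| <= 1 ->
  expR (s ^+ 2 / 2 * bernoulli_var J * (1 - `|s| - s ^+ 2)) <=
  bernoulli_mean p J (fun z => expR (s * z)).
Proof.
move=> s1; rewrite bernoulli_mean_expR /bernoulli_var mulr_sumr mulr_suml.
elim: J => [|k J IH]; first by rewrite !big_nil expR0.
rewrite !big_cons expRD ler_pM// ?expR_ge0//.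
exact: ge_bernoulli_mgf.
Qed.

End bernoulli_mean.

(** The moderate-deviation lower bound. Pointwise, a value [z] is either above
    [x] and below [y], or below [x], or above [y]; weighting by [expR (s * z)]
    bounds the Laplace transform at [s] by [expR (s * y)] times the tail at [x]
    plus multiples of the transforms at the neighbours of [s]. When [s * v] lies
    between [x] and [y], the latter are negligible, and the tail is bounded from
    below by an almost optimal Gaussian term. *)
Lemma bernoulli_tail_ge {R : realType} (p : nat -> R) (J : seq nat) (eps u : R)
    (v := bernoulli_var p J) :
    (forall k, 0 <= p k <= 1) -> 0 < eps <= 1 -> 0 < v -> 0 < u ->
    u / v <= eps ^+ 2 / 40 -> 8 / eps ^+ 2 <= u ^+ 2 / v ->
  expR (- ((1 / 2 + 2 * eps) * (u ^+ 2 / v))) <=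
  bernoulli_mean p J (fun z => \1_[set z | (1 - eps) * u < z] z).
Proof.
move=> p01 /andP[e0 e1] v0 u0 th_le s_ge.
set th := u / v in th_le; set s := u ^+ 2 / v in s_ge *.
(* [lam] bounds the relative error of the Gaussian approximation of the Laplace
   transform; it is small against the gain [eps ^+ 2 / 2] in the exponent *)
set lam := eps ^+ 2 / 10.
have th0 : 0 < th by rewrite divr_gt0.
have e21 : eps ^+ 2 <= 1 by rewrite expr_le1// ltW.
have e20 : 0 < eps ^+ 2 by rewrite exprn_gt0.
have th1 : th <= 1 / 40 by lra.
have sE : th ^+ 2 * v = s by rewrite /th /s; field; rewrite gt_eqF.
have suE : th * u = s by rewrite /th /s; field; rewrite gt_eqF.
have s0 : 0 < s by rewrite divr_gt0// exprn_gt0.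
have s8 : 8 <= s * eps ^+ 2 by rewrite -ler_pdivrMr.
set M := fun r : R => bernoulli_mean p J (fun z => expR (r * z)).
set Q := bernoulli_mean p J _.
pose x := (1 - eps) * u; pose y := (1 + eps) * u; pose eta := eps * th.
(* the three terms cover the values in [x, y], below [x] and above [y] *)
have key : M th <= expR (th * y) * Q + expR (eta * x) * M (th - eta) +
                   expR (- (eta * y)) * M (th + eta).
  rewrite /M /Q -!bernoulli_meanZ -!bernoulli_meanD.
  apply: bernoulli_mean_le => // z; rewrite indicE.
  have q1 := expR_ge0 (eta * x + (th - eta) * z).
  have q2 := expR_ge0 (- (eta * y) + (th + eta) * z).
  have eta0 : 0 < eta by rewrite mulr_gt0.
  rewrite -!expRD; have [xz|xz] := ltP x z.
    rewrite mem_set//= mulr1; have [yz|yz] := leP z y.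
      have : expR (th * z) <= expR (th * y) by rewrite ler_expR ler_pM2l.
      lra.
    have := expR_ge0 (th * y).
    have : expR (th * z) <= expR (- (eta * y) + (th + eta) * z).
      rewrite ler_expR; have : 0 <= eta * (z - y); last by lra.
      by rewrite mulr_ge0//; lra.
    lra.
  rewrite memNset/=; last by apply/negP; rewrite -leNgt.
  have : expR (th * z) <= expR (eta * x + (th - eta) * z).
    rewrite ler_expR; have : 0 <= eta * (x - z); last by lra.
    by rewrite mulr_ge0//; lra.
  lra.
have M0 : expR (s / 2 * (1 - lam)) <= M th.
  apply: le_trans (bernoulli_mean_expR_ge p01 _ _); last first.
    by rewrite ger0_norm; lra.
  rewrite -/v (_ : _ * v = s / 2); last by rewrite -sE; field.
  rewrite ler_expR ler_pM2l; last by lra.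
  rewrite ger0_norm; last by lra.
  have : th ^+ 2 <= th by rewrite expr2; nra.
  by rewrite /lam; lra.
have Mup r : 0 <= r <= 2 -> M (r * th) <= expR (r ^+ 2 * (s / 2) * (1 + lam)).
  move=> /andP[r0 r2]; apply: le_trans (bernoulli_mean_expR_le p01 _ _) _.
  rewrite -/v (_ : _ * v = r ^+ 2 * (s / 2)); last by rewrite -sE; field.
  have rth0 : 0 <= r * th by rewrite mulr_ge0// ltW.
  rewrite ler_expR; apply: ler_wpM2l.
    by rewrite mulr_ge0 ?sqr_ge0//; lra.
  rewrite ger0_norm//; have rth : r * th <= lam / 2 by rewrite /lam; nra.
  have : 1 - r * th <= expR (- (r * th)) by exact: onem_le_expRN.
  rewrite expRN => h; rewrite -[leLHS]invrK invf_ple ?posrE ?invr_gt0 ?expR_gt0//.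
    apply: le_trans h; rewrite -div1r ler_pdivrMr; last by rewrite /lam; lra.
    by rewrite /lam in rth *; nra.
  by rewrite /lam; lra.
have slam0 : 0 <= s * lam by rewrite mulr_ge0 /lam; lra.
have e_half : expR (- 1) <= 1 / 2 :> R.
  rewrite expRN div1r lef_pV2 ?posrE ?expR_gt0//.
  by have := expR_ge1Dx (1 : R); lra.
have e_quarter : expR (- (s * eps ^+ 2 / 4)) <= 1 / 4.
  have : expR (- (s * eps ^+ 2 / 4)) <= expR (- 1) * expR (- 1).
    by rewrite -expRD ler_expR; lra.
  by have := expR_ge0 (- 1 : R); nra.
set M1 := expR (s / 2 * (1 - lam)) in M0.
have low : expR (eta * x) * M (th - eta) <= M1 * (1 / 4).
  apply: le_trans (_ : M1 * expR (- (s * eps ^+ 2 / 4)) <= _); last first.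
    by rewrite ler_wpM2l ?expR_ge0.
  rewrite (_ : th - eta = (1 - eps) * th); last by rewrite /eta; ring.
  have e02 : 0 <= 1 - eps <= 2 by lra.
  apply: le_trans (ler_wpM2l (expR_ge0 _) (Mup _ e02)) _.
  rewrite -!expRD ler_expR.
  rewrite (_ : eta * x = eps * (1 - eps) * s); last by rewrite -suE /eta /x; ring.
  have : 0 <= s * lam * (1 - (1 - eps) ^+ 2).
    by apply: mulr_ge0; [exact: slam0|nra].
  by rewrite /lam; lra.
have high : expR (- (eta * y)) * M (th + eta) <= M1 * (1 / 4).
  apply: le_trans (_ : M1 * expR (- (s * eps ^+ 2 / 4)) <= _); last first.
    by rewrite ler_wpM2l ?expR_ge0.
  rewrite (_ : th + eta = (1 + eps) * th); last by rewrite /eta; ring.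
  have e02 : 0 <= 1 + eps <= 2 by lra.
  apply: le_trans (ler_wpM2l (expR_ge0 _) (Mup _ e02)) _.
  rewrite -!expRD ler_expR.
  rewrite (_ : eta * y = eps * (1 + eps) * s); last by rewrite -suE /eta /y; ring.
  have : 0 <= s * lam * (4 - (1 + eps) ^+ 2).
    by apply: mulr_ge0; [exact: slam0|nra].
  by rewrite /lam; lra.
have : M1 / 2 <= expR (th * y) * Q by lra.
rewrite -ler_pdivrMl ?expR_gt0// => /(le_trans _); apply.
rewrite -expRN [leRHS]mulrC (_ : th * y = (1 + eps) * s); last by rewrite -suE /y; ring.
apply: le_trans (_ : M1 * expR (- 1) * expR (- ((1 + eps) * s)) <= _); last first.
  by rewrite ler_wpM2r ?expR_ge0// ler_wpM2l ?expR_ge0//; lra.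
rewrite -!expRD ler_expR; have : 8 <= s * eps by nra.
by rewrite /lam; nra.
Qed.

(** * Independent events and their centred counts *)

Section independent_events.
Context d (T : measurableType d) (R : realType) (P : probability T R).
Implicit Types (E : nat -> set T) (I J : seq nat) (H : set T).

Definition independent_events E : Prop :=
  (forall k, measurable (E k)) /\
  forall I, uniq I ->
    P (\bigcap_(k in [set` I]) E k) = (\prod_(k <- I) P (E k))%E.

Definition prob (H : set T) : R := fine (P H).

Definition all_of E I : set T := \bigcap_(k in [set` I]) E k.

Definition centred_count E J (w : T) : R :=
  \sum_(k <- J) (\1_(E k) w - prob (E k)).

(** [H] is arbitrary and not built from [E], because the recursion over a block
    replaces it by [H `&` E k] and [H `\` E k]. *)
Definition independent_of E J H : Prop :=
  forall I, uniq I -> {subset I <= J} ->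
    prob (H `&` all_of E I) = prob H * prob (all_of E I).

Lemma prob_fin H : measurable H -> P H = (prob H)%:E.
Proof. by move=> mH; rewrite /prob fineK// fin_num_measure. Qed.

Lemma prob_bounds H : measurable H -> 0 <= prob H <= 1.
Proof.
move=> mH; rewrite -!lee_fin -prob_fin// measure_ge0/=.
exact: probability_le1.
Qed.

Lemma probDI H1 H2 : measurable H1 -> measurable H2 ->
  prob (H1 `\` H2) = prob H1 - prob (H1 `&` H2).
Proof.
move=> m1 m2; apply/eqP; rewrite eq_sym subr_eq; apply/eqP.
have mI : measurable (H1 `&` H2) by exact: measurableI.
have mD : measurable (H1 `\` H2) by exact: measurableD.
by apply: EFin_inj; rewrite EFinD -!prob_fin//; exact: measureDI.
Qed.

Lemma probU H1 H2 : measurable H1 -> measurable H2 -> H1 `&` H2 = set0 ->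
  prob (H1 `|` H2) = prob H1 + prob H2.
Proof.
move=> m1 m2 H12; have mU : measurable (H1 `|` H2) by exact: measurableU.
by apply: EFin_inj; rewrite EFinD -!prob_fin//; exact: measureU.
Qed.

Lemma le_prob H1 H2 : measurable H1 -> measurable H2 -> H1 `<=` H2 ->
  prob H1 <= prob H2.
Proof.
move=> m1 m2 H12; rewrite -lee_fin -!prob_fin//.
by apply: le_measure; rewrite ?inE.
Qed.

Lemma prob_setT : prob setT = 1.
Proof. by rewrite /prob probability_setT. Qed.

Section law.
Variable E : nat -> set T.
Hypothesis indE : independent_events E.
Let mE k : measurable (E k). Proof. by case: indE => + _; exact. Qed.

Lemma all_of_nil : all_of E [::] = setT.
Proof. by apply/seteqP; split=> w // _ k. Qed.

Lemma all_of_cons k I : all_of E (k :: I) = E k `&` all_of E I.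
Proof.
apply/seteqP; split=> w /= h.
  by split=> [|j jI]; apply: h; rewrite /= inE ?eqxx ?jI ?orbT.
by case: h => hk hI j /=; rewrite inE => /predU1P[->//|]; exact: hI.
Qed.

Lemma all_of_cat I J : all_of E (I ++ J) = all_of E I `&` all_of E J.
Proof.
elim: I => [|k I IH]; first by rewrite all_of_nil setTI.
by rewrite cat_cons !all_of_cons IH setIA.
Qed.

Lemma measurable_all_of I : measurable (all_of E I).
Proof.
elim: I => [|k I IH]; first by rewrite all_of_nil.
by rewrite all_of_cons; exact: measurableI.
Qed.

Lemma prob_all_of I : uniq I -> prob (all_of E I) = \prod_(k <- I) prob (E k).
Proof.
move=> uI; apply: EFin_inj; rewrite -prob_fin; last exact: measurable_all_of.
case: indE => _ -> //; elim: I {uI} => [|k I IH]; first by rewrite !big_nil.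
by rewrite !big_cons prob_fin// IH.
Qed.

(** Splitting on the first event of the block turns the law of its count into
    the recursion of [bernoulli_mean]. *)
Lemma centred_count_preimage k J (B : set R) :
  centred_count E (k :: J) @^-1` B =
  (E k `&` centred_count E J @^-1` [set z | B (z + (1 - prob (E k)))]) `|`
  (~` E k `&` centred_count E J @^-1` [set z | B (z - prob (E k))]).
Proof.
apply/seteqP; split=> w /=; rewrite /centred_count big_cons indicE.
  have [wE|wE] := pselect (E k w).
    by rewrite mem_set//= => h; left; split=> //; rewrite addrC.
  by rewrite memNset//= sub0r => h; right; split=> //; rewrite addrC.
by move=> [[wE]|[wE]]; [rewrite mem_set//|rewrite memNset// sub0r];
  rewrite addrC.
Qed.

Lemma measurable_centred_count_preimage J (B : set R) :
  measurable (centred_count E J @^-1` B).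
Proof.
elim: J B => [|k J IH] B.
  have [B0|B0] := pselect (B 0).
    rewrite (_ : _ @^-1` _ = setT)//; apply/seteqP; split=> w //= _.
    by rewrite /centred_count big_nil.
  rewrite (_ : _ @^-1` _ = set0)//; apply/seteqP; split=> w //=.
  by rewrite /centred_count big_nil.
rewrite centred_count_preimage; apply: measurableU; apply: measurableI => //.
exact: measurableC.
Qed.

(** An event determined by the block [J] is independent of whatever is
    independent of the block, with probability given by [bernoulli_mean]. *)
Lemma independent_of_block J H (B : set R) : uniq J -> measurable H ->
  independent_of E J H ->
  prob (H `&` centred_count E J @^-1` B) =
  prob H * bernoulli_mean (fun k => prob (E k)) J (fun z => \1_B z).
Proof.
elim: J H B => [|k J IH] H B /=.
  move=> _ mH _; rewrite indicE; have [B0|B0] := pselect (B 0).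
    rewrite mem_set//= mulr1; congr prob; apply/seteqP; split=> w //=.
      by case.
    by rewrite /centred_count big_nil.
  rewrite memNset//= mulr0 (_ : _ `&` _ = set0) ?/prob ?measure0//.
  by apply/seteqP; split=> w //= []; rewrite /centred_count big_nil.
move=> /andP[kJ uJ] mH indH.
have mHE : measurable (H `&` E k) by exact: measurableI.
have mHD : measurable (H `\` E k) by exact: measurableD.
have prHE : prob (H `&` E k) = prob H * prob (E k).
  have := indH [:: k] isT; rewrite all_of_cons all_of_nil setIT; apply.
  by move=> j; rewrite !inE => ->.
have step I : uniq I -> {subset I <= J} ->
    prob (H `&` E k `&` all_of E I) = prob H * prob (E k) * prob (all_of E I).
  move=> uI IJ; rewrite -setIA -all_of_cons indH; last 2 first.
  - by rewrite cons_uniq uI andbT; apply: contra kJ => /IJ.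
  - by move=> j; rewrite !inE => /predU1P[->|/IJ ->]; rewrite ?eqxx ?orbT.
  rewrite !prob_all_of ?big_cons ?mulrA// cons_uniq uI andbT.
  by apply: contra kJ => /IJ.
have indHE : independent_of E J (H `&` E k).
  by move=> I uI IJ; rewrite step// prHE.
have indHD : independent_of E J (H `\` E k).
  move=> I uI IJ; rewrite setDE setIAC -setDE probDI//; last first.
    by apply: measurableI => //; exact: measurable_all_of.
  rewrite setIAC step// indH//; last by move=> j /IJ; rewrite inE orbC => ->.
  by rewrite probDI// prHE; ring.
rewrite centred_count_preimage setIUr.
rewrite probU; last 3 first.
- by apply: measurableI => //; apply: measurableI => //;
    exact: measurable_centred_count_preimage.
- by apply: measurableI => //; apply: measurableI;
    [exact: measurableC|exact: measurable_centred_count_preimage].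
- by apply/seteqP; split=> w //= [[_ [? _]] [_ []]].
rewrite !setIA -setDE !IH// probDI// prHE.
rewrite (_ : (fun z => \1_[set z | B (z + (1 - prob (E k)))] z) =
  (fun z => \1_B (z + (1 - prob (E k)))))//.
rewrite (_ : (fun z => \1_[set z | B (z - prob (E k))] z) =
  (fun z => \1_B (z - prob (E k))))//.
by ring.
Qed.

Lemma independent_of_setT J : independent_of E J setT.
Proof. by move=> I _ _; rewrite setTI prob_setT mul1r. Qed.

Lemma prob_centred_count J (B : set R) : uniq J ->
  prob (centred_count E J @^-1` B) =
  bernoulli_mean (fun k => prob (E k)) J (fun z => \1_B z).
Proof.
move=> uJ; rewrite -[X in prob X]setTI independent_of_block//.
  by rewrite prob_setT mul1r.
exact: independent_of_setT.
Qed.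

Let p01 k : 0 <= prob (E k) <= 1. Proof. exact: prob_bounds. Qed.

Definition count_var J : R := bernoulli_var (fun k => prob (E k)) J.

Lemma centred_count_upper_tail J (x s V : R) : uniq J -> 0 <= s ->
  count_var J <= V ->
  prob [set w | x < centred_count E J w] <=
  expR (- (s * x) + s ^+ 2 / 2 * V * expR s).
Proof.
move=> uJ s0 vV; rewrite (_ : [set w | _] = centred_count E J @^-1` [set z | x < z])//.
rewrite prob_centred_count//.
apply: le_trans (_ : bernoulli_mean (fun k => prob (E k)) J
  (fun z => expR (- (s * x)) * expR (s * z)) <= _).
  apply: bernoulli_mean_le => // z; rewrite indicE -expRD.
  have [xz|xz] := ltP x z.
    rewrite mem_set//= ge0_expR_ge1//.
    by rewrite addrC -mulrBr mulr_ge0// subr_ge0 ltW.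
  by rewrite memNset/= ?expR_ge0//; apply/negP; rewrite -leNgt.
rewrite bernoulli_meanZ expRD ler_wpM2l ?expR_ge0//.
apply: le_trans (bernoulli_mean_expR_le _ _ _) _ => //.
rewrite ger0_norm// ler_expR ler_wpM2r ?expR_ge0// ler_wpM2l//.
by rewrite divr_ge0 ?sqr_ge0.
Qed.

Lemma centred_count_lower_tail J (x s V : R) : uniq J -> 0 <= s ->
  count_var J <= V ->
  prob [set w | centred_count E J w < - x] <=
  expR (- (s * x) + s ^+ 2 / 2 * V * expR s).
Proof.
move=> uJ s0 vV; rewrite (_ : [set w | _] = centred_count E J @^-1` [set z | z < - x])//.
rewrite prob_centred_count//.
apply: le_trans (_ : bernoulli_mean (fun k => prob (E k)) J
  (fun z => expR (- (s * x)) * expR (- s * z)) <= _).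
  apply: bernoulli_mean_le => // z; rewrite indicE -expRD.
  have [xz|xz] := ltP z (- x).
    rewrite mem_set//= ge0_expR_ge1//.
    by rewrite mulNr -opprD -mulrDr -mulrN mulr_ge0//; lra.
  by rewrite memNset/= ?expR_ge0//; apply/negP; rewrite -leNgt.
rewrite bernoulli_meanZ expRD ler_wpM2l ?expR_ge0//.
apply: le_trans (bernoulli_mean_expR_le _ _ _) _ => //.
rewrite normrN sqrrN ger0_norm// ler_expR ler_wpM2r ?expR_ge0// ler_wpM2l//.
by rewrite divr_ge0 ?sqr_ge0.
Qed.

Lemma centred_count_tail_ge J (eps u : R) (v := count_var J) : uniq J ->
    0 < eps <= 1 -> 0 < v -> 0 < u ->
    u / v <= eps ^+ 2 / 40 -> 8 / eps ^+ 2 <= u ^+ 2 / v ->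
  expR (- ((1 / 2 + 2 * eps) * (u ^+ 2 / v))) <=
  prob [set w | (1 - eps) * u < centred_count E J w].
Proof.
move=> uJ e01 v0 u0 h1 h2.
rewrite (_ : [set w | _] = centred_count E J @^-1` [set z | (1 - eps) * u < z])//.
by rewrite prob_centred_count//; exact: bernoulli_tail_ge.
Qed.

End law.
End independent_events.

(** * The number of occurring events *)

Section nonneg_series.
Context {R : realType}.
Implicit Types (u : nat -> R) (x : R).

Lemma lt_nneseries u x : (forall k, 0 <= u k) ->
  (x%:E < \sum_(k <oo) (u k)%:E)%E -> exists n, x < \sum_(0 <= k < n) u k.
Proof.
move=> u0; apply: contraPP => h; apply/negP; rewrite -leNgt.
apply: lime_le; first by apply: is_cvg_nneseries => k _ _; rewrite lee_fin.
apply: nearW => n; rewrite sumEFin lee_fin leNgt; apply/negP => xn.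
by apply: h; exists n.
Qed.

Lemma partial_sum_le_nneseries u n : (forall k, 0 <= u k) ->
  ((\sum_(0 <= k < n) u k)%:E <= \sum_(k <oo) (u k)%:E)%E.
Proof.
by move=> u0; rewrite -sumEFin; apply: nneseries_lim_ge => k _ _; rewrite lee_fin.
Qed.

End nonneg_series.

Section event_count.
Context d (T : measurableType d) (R : realType) (P : probability T R).
Implicit Types (E : nat -> set T).

Definition ecount E (w : T) : \bar R := (\sum_(k <oo) (\1_(E k) w)%:E)%E.

Definition summable_events E : Prop :=
  (forall k, measurable (E k)) /\ (\sum_(k <oo) P (E k) < +oo)%E.

Definition count_mean E : R := fine (\sum_(k <oo) P (E k))%E.

Definition total_var E : R :=
  fine (\sum_(k <oo) (prob P (E k) * (1 - prob P (E k)))%:E)%E.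

Lemma ecount_ge0 E w : (0 <= ecount E w)%E.
Proof. by apply: nneseries_ge0 => k _ _; rewrite lee_fin. Qed.

Lemma measurable_ecount E : (forall k, measurable (E k)) ->
  measurable_fun setT (ecount E).
Proof.
move=> mE; apply: ge0_emeasurable_sum => [k x _ _|k _]; first by rewrite lee_fin.
by apply/measurable_EFinP; exact: measurable_indic.
Qed.

Lemma integral_ecount E : (forall k, measurable (E k)) ->
  (\int[P]_w ecount E w = \sum_(k <oo) P (E k))%E.
Proof.
move=> mE; rewrite integral_nneseries//; last first.
  by move=> k; apply/measurable_EFinP; exact: measurable_indic.
by apply: eq_eseriesr => k _; rewrite integral_indic// setIT.
Qed.

Lemma ae_ecount_fin E : summable_events E -> {ae P, forall w, (ecount E w < +oo)%E}.
Proof.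
move=> [mE sE]; have /(integrable_ae measurableT) : P.-integrable setT (ecount E).
  apply/integrableP; split; first exact: measurable_ecount.
  under eq_integral do rewrite gee0_abs ?ecount_ge0//.
  by rewrite integral_ecount.
apply: filterS => w /(_ I); rewrite ge0_fin_numE//; exact: ecount_ge0.
Qed.

Lemma expectation_count E : (forall k, measurable (E k)) ->
  {ae P, forall w, (ecount E w < +oo)%E} ->
  ('E_P[fun w => fine (ecount E w)] = \sum_(k <oo) P (E k))%E.
Proof.
move=> mE fE; rewrite unlock -integral_ecount//; apply: ae_eq_integral => //.
- apply/measurable_EFinP; apply: measurableT_comp; first exact: fine_measurable.
  exact: measurable_ecount.
- exact: measurable_ecount.
- apply: filterS fE => w wE _; rewrite fineK// ge0_fin_numE//.
  exact: ecount_ge0.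
Qed.

Section sums.
Variable E : nat -> set T.
Hypothesis sE : summable_events E.
Let mE k : measurable (E k). Proof. by case: sE => + _; exact. Qed.
Let p k := prob P (E k).
Let p01 k : 0 <= p k <= 1. Proof. exact: prob_bounds. Qed.
Let p_ge0 k : 0 <= p k. Proof. by have /andP[] := p01 k. Qed.
Let v_ge0 k : 0 <= p k * (1 - p k).
Proof. by have /andP[p0 p1] := p01 k; rewrite mulr_ge0// subr_ge0. Qed.

Lemma count_meanE : (\sum_(k <oo) (p k)%:E)%E = (count_mean E)%:E.
Proof.
rewrite /count_mean (eq_eseriesr (g := fun k => (p k)%:E)); last first.
  by move=> k _; rewrite prob_fin.
rewrite fineK// ge0_fin_numE; last by apply: nneseries_ge0 => k _ _; rewrite lee_fin.
case: sE => _; rewrite (eq_eseriesr (g := fun k => (p k)%:E))//.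
by move=> k _; rewrite prob_fin.
Qed.

Lemma total_varE : (\sum_(k <oo) (p k * (1 - p k))%:E)%E = (total_var E)%:E.
Proof.
rewrite /total_var fineK// ge0_fin_numE; last first.
  by apply: nneseries_ge0 => k _ _; rewrite lee_fin; exact: v_ge0.
apply: le_lt_trans (_ : \sum_(k <oo) (p k)%:E < _)%E.
  apply: lee_nneseries => k _ *; rewrite lee_fin; first exact: v_ge0.
  by have := p01 k; rewrite /p => /andP[p0 p1]; nra.
by rewrite count_meanE ltry.
Qed.

Lemma total_var_le_mean : total_var E <= count_mean E.
Proof.
rewrite -lee_fin -count_meanE -total_varE; apply: lee_nneseries => k _ *.
  by rewrite lee_fin.
by rewrite lee_fin; have := p01 k; rewrite /p => /andP[p0 p1]; nra.
Qed.

Lemma count_mean_ge0 : 0 <= count_mean E.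
Proof.
by rewrite -lee_fin -count_meanE; apply: nneseries_ge0 => k _ _; rewrite lee_fin.
Qed.

Lemma total_var_ge0 : 0 <= total_var E.
Proof.
by rewrite -lee_fin -total_varE; apply: nneseries_ge0 => k _ _; rewrite lee_fin.
Qed.

Lemma partial_mean_le n : \sum_(0 <= k < n) p k <= count_mean E.
Proof. by rewrite -lee_fin -count_meanE partial_sum_le_nneseries. Qed.

Lemma partial_mean_gt (x : R) : x < count_mean E ->
  exists n, x < \sum_(0 <= k < n) p k.
Proof. by move=> xE; apply: lt_nneseries => //; rewrite count_meanE lte_fin. Qed.

Lemma partial_var_le n : count_var P E (index_iota 0 n) <= total_var E.
Proof. by rewrite -lee_fin -total_varE partial_sum_le_nneseries. Qed.

Lemma partial_var_gt (x : R) : x < total_var E ->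
  exists n, x < count_var P E (index_iota 0 n).
Proof. by move=> xE; apply: lt_nneseries => //; rewrite total_varE lte_fin. Qed.

Lemma measurable_count : measurable_fun setT (fun w => fine (ecount E w)).
Proof.
apply: measurableT_comp; first exact: fine_measurable.
exact: measurable_ecount.
Qed.

(** The second moment is the double series of the probabilities of pairs, which
    independence makes [count_mean E ^+ 2] plus a diagonal correction. *)
Lemma integral_count_sqr : independent_events P E ->
  (\int[P]_w (fine (ecount E w) ^+ 2)%:E =
   (count_mean E ^+ 2 + total_var E)%:E)%E.
Proof.
move=> indE.
pose G w := (\sum_(k <oo) \sum_(j <oo) (\1_(E k `&` E j) w)%:E)%E : \bar R.
have mI k j : measurable (E k `&` E j) by exact: measurableI.
have mi k j : measurable_fun setT (fun w => (\1_(E k `&` E j) w)%:E : \bar R).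
  by apply/measurable_EFinP; exact: measurable_indic.
have mS k : measurable_fun setT
    (fun w => \sum_(j <oo) (\1_(E k `&` E j) w)%:E : \bar R)%E.
  by apply: ge0_emeasurable_sum => // j x _ _; rewrite lee_fin.
have S0 k w : (0 <= \sum_(j <oo) (\1_(E k `&` E j) w)%:E :> \bar R)%E.
  by apply: nneseries_ge0 => j _ _; rewrite lee_fin.
transitivity (\int[P]_w G w)%E.
  apply: ae_eq_integral => //.
  - apply/measurable_EFinP.
    by apply: measurable_funX; exact: measurable_count.
  - by apply: ge0_emeasurable_sum.
  - apply: filterS (ae_ecount_fin sE) => w wE _.
    have wf : (fine (ecount E w))%:E = ecount E w.
      by rewrite fineK// ge0_fin_numE// ecount_ge0.
    rewrite /G (eq_eseriesr (g := fun k => ((fine (ecount E w))%:E * (\1_(E k) w)%:E)%E)).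
      rewrite nneseriesZl; last by move=> k _; rewrite lee_fin.
      by rewrite -/(ecount E w) -wf -EFinM expr2.
    move=> k _; rewrite muleC wf /ecount -nneseriesZl; last first.
      by move=> j _; rewrite lee_fin.
    by apply: eq_eseriesr => j _; rewrite -EFinM indicI.
rewrite integral_nneseries//.
have PI k j : P (E k `&` E j) = (p k * p j + (j == k)%:R * (p k * (1 - p k)))%:E.
  have [->|jk] := eqVneq j k.
    by rewrite setIid prob_fin//; congr EFin; rewrite /p mul1r; ring.
  have <- : all_of E [:: k; j] = E k `&` E j.
    by rewrite !all_of_cons all_of_nil setIT.
  rewrite prob_fin; last exact: measurable_all_of indE _.
  rewrite (prob_all_of indE); last by rewrite /= inE eq_sym jk.
  by rewrite !big_cons big_nil mulr1 mul0r addr0.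
rewrite (eq_eseriesr (g := fun k => ((p k * count_mean E)%:E + (p k * (1 - p k))%:E)%E)).
  rewrite nneseriesD//; last 2 first.
  - by move=> k _ _; rewrite lee_fin mulr_ge0// count_mean_ge0.
  - by move=> k _ _; rewrite lee_fin.
  rewrite total_varE (eq_eseriesr (g := fun k => ((count_mean E)%:E * (p k)%:E)%E)).
    by rewrite nneseriesZl ?count_meanE// => k _; rewrite lee_fin.
  by move=> k _; rewrite -EFinM mulrC.
move=> k _; rewrite integral_nneseries//.
rewrite (eq_eseriesr (g := fun j => ((p k)%:E * (p j)%:E +
    ((j == k)%:R * (p k * (1 - p k)))%:E)%E)); last first.
  by move=> j _; rewrite integral_indic// setIT; exact: PI.
rewrite nneseriesD//; last 2 first.
- by move=> j _ _; rewrite -EFinM lee_fin mulr_ge0.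
- by move=> j _ _; rewrite lee_fin mulr_ge0.
rewrite nneseriesZl ?count_meanE//; last by move=> j _; rewrite lee_fin.
congr (_ + _)%E; rewrite (nneseriesD1 _ (n := k))//; last first.
  by move=> j _; rewrite lee_fin mulr_ge0.
rewrite eqxx mul1r eseries0 ?adde0// => j _ /=.
by move=> /negPf ->; rewrite mul0r.
Qed.

(** The variance is read off [(X - b) ^+ 2 + 2 * b * X = X ^+ 2 + b ^+ 2], an
    identity between nonnegative terms, which integrates term by term. *)
Lemma variance_count : independent_events P E ->
  ('V_P[fun w => fine (ecount E w)] = (total_var E)%:E)%E.
Proof.
move=> indE; set X := fun w => fine (ecount E w); set b := count_mean E.
have EX : ('E_P[X] = b%:E)%E.
  rewrite expectation_count//; last exact: ae_ecount_fin.
  by rewrite -count_meanE; apply: eq_eseriesr => k _; rewrite prob_fin.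
have mX : measurable_fun setT X by exact: measurable_count.
have b0 : 0 <= b := count_mean_ge0.
have X0 w : 0 <= X w by rewrite fine_ge0// ecount_ge0.
rewrite /variance unlock EX.
have -> : ('E_P[((X \- cst (fine b%:E)) * (X \- cst (fine b%:E)))%R] =
    \int[P]_w ((X w - b) ^+ 2)%:E)%E.
  by rewrite unlock; apply: eq_integral => w _; rewrite /= expr2.
have key : (\int[P]_w ((X w - b) ^+ 2)%:E + \int[P]_w ((2 * b)%:E * (X w)%:E) =
    \int[P]_w (X w ^+ 2)%:E + \int[P]_w (b ^+ 2)%:E)%E.
  rewrite -!ge0_integralD//=.
  - by apply: eq_integral => w _; rewrite -!EFinM -!EFinD; congr EFin; ring.
  - by move=> w _; rewrite lee_fin sqr_ge0.
  - by apply/measurable_EFinP; exact: measurable_funX.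
  - by move=> w _; rewrite lee_fin sqr_ge0.
  - by move=> w _; rewrite lee_fin sqr_ge0.
  - apply/measurable_EFinP; apply: measurable_funX.
    exact: measurable_funB.
  - by move=> w _; rewrite -EFinM lee_fin !mulr_ge0.
  - apply/measurable_EFinP; exact: measurable_funM.
have Pb : (\int[P]_w (b ^+ 2)%:E = (b ^+ 2)%:E)%E.
  rewrite integral_cst// [X in (_ * X)%E](_ : _ = 1%E) ?mule1//.
  exact: probability_setT.
move: key; rewrite integral_count_sqr// Pb.
rewrite ge0_integralZl//; last 3 first.
- exact/measurable_EFinP.
- by move=> w _; rewrite lee_fin.
- by rewrite lee_fin mulr_ge0.
have -> : (\int[P]_w (X w)%:E)%E = b%:E by rewrite -EX unlock.
rewrite -EFinM -EFinD; case: integral => [r| |]//= [] h.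
by congr EFin; move: h; rewrite -/b; lra.
Qed.

End sums.
End event_count.

(** * Tails of counts, and the Borel-Cantelli lemmas *)

Section outer_bounds.
Context d (T : measurableType d) (R : realType) (P : probability T R).
Implicit Types (E : nat -> set T) (S F : set T) (c : R).

(** An outer probability, since the oscillation over an interval of times is an
    uncountable supremum that need not be measurable. *)
Definition outer_prob_le S c : Prop :=
  exists F, [/\ measurable F, S `<=` F & prob P F <= c].

Lemma outer_prob_le_trans S c c' : outer_prob_le S c -> c <= c' ->
  outer_prob_le S c'.
Proof. by move=> [F [mF SF Fc]] cc'; exists F; split=> //; exact: le_trans cc'. Qed.

Lemma sub_outer_prob_le S S' c : S' `<=` S -> outer_prob_le S c ->
  outer_prob_le S' c.
Proof. by move=> SS [F [mF SF Fc]]; exists F; split=> //; exact: subset_trans SF. Qed.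

Lemma outer_prob_le0 c : 0 <= c -> outer_prob_le set0 c.
Proof. by move=> c0; exists set0; split=> //; rewrite /prob measure0. Qed.

Lemma outer_prob_leU S S' c c' : outer_prob_le S c -> outer_prob_le S' c' ->
  outer_prob_le (S `|` S') (c + c').
Proof.
move=> [F [mF SF Fc]] [F' [mF' SF' Fc']]; exists (F `|` F'); split.
- exact: measurableU.
- exact: setUSS.
- have mD : measurable (F' `\` F) by exact: measurableD.
  have -> : F `|` F' = F `|` (F' `\` F).
    apply/seteqP; split=> w [Fw|]; try by left.
    - by move=> F'w; have [Fw|Fw] := pselect (F w); [left|right].
    - by case=> F'w _; right.
  apply: le_trans (lerD Fc Fc').
  rewrite (probU _ mF mD); last by rewrite setIDA setIC -setIDA setDv setI0.
  by rewrite lerD2l le_prob//; exact: subDsetl.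
Qed.

Lemma outer_prob_le_bigcup (S : nat -> set T) (c : nat -> R) n :
  (forall i, (i < n)%N -> outer_prob_le (S i) (c i)) ->
  outer_prob_le (\bigcup_(i in [set i | (i < n)%N]) S i) (\sum_(i < n) c i).
Proof.
elim: n => [|n IH] Sc.
  rewrite big_ord0; apply: sub_outer_prob_le (outer_prob_le0 (lexx 0)).
  by move=> w [i].
rewrite big_ord_recr/=; apply: sub_outer_prob_le (_ : outer_prob_le
    ((\bigcup_(i in [set i | (i < n)%N]) S i) `|` S n) _).
  move=> w [i /=]; rewrite ltnS leq_eqVlt => /predU1P[->|i_n Si]; first by right.
  by left; exists i.
by apply: outer_prob_leU; [apply: IH => i i_n; apply: Sc; exact: ltnW|exact: Sc].
Qed.

Section tails.
Variable E : nat -> set T.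
Hypotheses (indE : independent_events P E) (sE : summable_events P E).

Let centred_countE n w : centred_count P E (index_iota 0 n) w =
  \sum_(0 <= k < n) \1_(E k) w - \sum_(0 <= k < n) prob P (E k).
Proof. by rewrite /centred_count big_split/= sumrN. Qed.

(** The count is the increasing limit of its partial sums, whose means are at
    most that of the count: the bound for finite sums passes to the limit. *)
Lemma count_upper_tail (x s V : R) : 0 <= s -> total_var P E <= V ->
  outer_prob_le [set w | ((count_mean P E + x)%:E < ecount R E w)%E]
    (expR (- (s * x) + s ^+ 2 / 2 * V * expR s)).
Proof.
move=> s0 VE; set c := expR _; set y := count_mean P E + x.
pose F n := centred_count P E (index_iota 0 n) @^-1`
  [set z | y - \sum_(0 <= k < n) prob P (E k) < z].
have mF n : measurable (F n) by exact: measurable_centred_count_preimage.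
have mUF : measurable (\bigcup_n F n) by exact: bigcup_measurable.
exists (\bigcup_n F n); split=> //.
- move=> w /=; rewrite /ecount => /lt_nneseries[//|n yn].
  by exists n => //; rewrite /F/= centred_countE ltrD2r.
- have Fc n : prob P (F n) <= c.
    apply: le_trans (_ : prob P [set w | x < centred_count P E (index_iota 0 n) w] <= _).
      apply: le_prob => //; first exact: (measurable_centred_count_preimage indE _ [set z | x < z]).
      move=> w; rewrite /F/=; apply: le_lt_trans.
      by rewrite /y; have := partial_mean_le sE n; lra.
    apply: centred_count_upper_tail => //; first exact: iota_uniq.
    by apply: le_trans VE; exact: partial_var_le.
  have ndF : {homo F : n m / (n <= m)%N >-> (n <= m)%O}.
    move=> n m nm; apply/subsetPset => w; rewrite /F/= !centred_countE !ltrD2r.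
    move/lt_le_trans; apply; rewrite (big_cat_nat (leq0n n) nm)//= lerDl.
    by apply: sumr_ge0 => k _; rewrite indicE.
  have PF := nondecreasing_cvg_mu mF mUF ndF (mu := P).
  rewrite -lee_fin -prob_fin// -(cvg_lim _ PF)//; apply: lime_le.
    by apply/cvg_ex; exists (P (\bigcup_n F n)).
  by apply: nearW => n; rewrite /= prob_fin// lee_fin.
Qed.

(** A partial sum whose mean falls short by less than [1] already witnesses the
    deficit of the count. *)
Lemma count_lower_tail (x s V : R) : 0 <= s -> total_var P E <= V ->
  outer_prob_le [set w | (ecount R E w < (count_mean P E - x - 1)%:E)%E]
    (expR (- (s * x) + s ^+ 2 / 2 * V * expR s)).
Proof.
move=> s0 VE.
have [|n nE] := partial_mean_gt sE (x := count_mean P E - 1); first by lra.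
exists [set w | centred_count P E (index_iota 0 n) w < - x]; split.
- exact: (measurable_centred_count_preimage indE _ [set z | z < - x]).
- move=> w /= wx; rewrite centred_countE.
  have : (\sum_(0 <= k < n) \1_(E k) w < count_mean P E - x - 1 :> R).
    rewrite -lte_fin; apply: le_lt_trans wx.
    by apply: partial_sum_le_nneseries => k; rewrite indicE.
  by lra.
- apply: centred_count_lower_tail => //; first exact: iota_uniq.
  by apply: le_trans VE; exact: partial_var_le.
Qed.

End tails.

(** [n `^ (- (1 + eta))] is dominated by the increments of
    [- n `^ (- eta) / eta], which makes its series converge by telescoping. *)
Lemma inv_powR_telescope (eta : R) n : 0 < eta ->
  expR (- ((1 + eta) * ln n.+2%:R)) <=
  eta^-1 * (expR (- (eta * ln n.+1%:R)) - expR (- (eta * ln n.+2%:R))).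
Proof.
move=> eta0; set m : R := n.+2%:R; set m' : R := n.+1%:R.
have m0 : 0 < m by rewrite ltr0n.
have m'0 : 0 < m' by rewrite ltr0n.
have mm : m' = m * (1 - m^-1).
  by rewrite mulrBr mulr1 mulfV ?gt_eqF// /m /m' -(natr1 n.+1) addrK.
have m1 : m^-1 < 1 by rewrite invf_lt1// ltr1n.
clearbody m m'.
have lnm : ln m' <= ln m - m^-1.
  have m1' : 0 < 1 - m^-1 by rewrite subr_gt0.
  rewrite mm lnM ?posrE//.
  by rewrite lerD2l le_ln1Dx// ltrN2.
rewrite ler_pdivlMl//.
have -> : expR (- ((1 + eta) * ln m)) = m^-1 * expR (- (eta * ln m)).
  rewrite mulrDl mul1r opprD expRD; congr (_ * _).
  by rewrite expRN lnK// posrE.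
have : expR (- (eta * ln m)) * expR (eta * m^-1) <= expR (- (eta * ln m')).
  rewrite -expRD ler_expR; have := ler_wpM2l (ltW eta0) lnm.
  by rewrite mulrBr; lra.
have := expR_ge1Dx (eta * m^-1); have := expR_gt0 (- (eta * ln m)).
set e := expR (- (eta * ln m)); set f := expR (eta * m^-1).
by move=> e0 f1; have := ler_wpM2l (ltW e0) f1; lra.
Qed.

(** First Borel-Cantelli lemma; the power of [n] is written as an exponential,
    the form in which the tail bounds produce it. *)
Lemma ae_eventually_not (S : nat -> set T) (eta : R) : 0 < eta ->
  (\forall n \near \oo, outer_prob_le (S n) (expR (- ((1 + eta) * ln n%:R)))) ->
  {ae P, forall w, \forall n \near \oo, ~ S n w}.
Proof.
move=> eta0 [N _ NS].
pose c n : R := expR (- ((1 + eta) * ln n.+2%:R)).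
have Sc n : outer_prob_le (S (N + n.+2)%N) (c n).
  apply: outer_prob_le_trans (NS _ _) _; first by rewrite /= leq_addr.
  rewrite ler_expR lerN2 ler_pM2l ?addr_gt0// ler_ln ?posrE ?ltr0n ?addn_gt0 ?orbT//.
  by rewrite ler_nat leq_addl.
have {}Sc n : {F | [/\ measurable F, S (N + n.+2)%N `<=` F & prob P F <= c n]}.
  by apply: cid; exact: Sc.
pose F n := projT1 (Sc n).
have mF n : measurable (F n) by rewrite /F; case: (Sc n) => ? [].
have FS n : S (N + n.+2)%N `<=` F n by rewrite /F; case: (Sc n) => ? [].
have Fc n : prob P (F n) <= c n by rewrite /F; case: (Sc n) => ? [].
have sumc m : \sum_(0 <= n < m) c n <=
    eta^-1 * (1 - expR (- (eta * ln m.+1%:R))).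
  elim: m => [|m IH]; first by rewrite big_geq// ln1 mulr0 oppr0 expR0 subrr mulr0.
  rewrite big_nat_recr//=; apply: le_trans (lerD IH (inv_powR_telescope m eta0)) _.
  by rewrite -mulrDr; apply: ler_wpM2l; [rewrite invr_ge0 ltW|lra].
have Ffin : (\sum_(0 <= n <oo) P (F n) < +oo)%E.
  apply: le_lt_trans (_ : (eta^-1)%:E < _)%E; last exact: ltry.
  apply: lime_le; first exact: is_cvg_nneseries.
  apply: nearW => m.
  rewrite (eq_bigr (fun n => (prob P (F n))%:E)); last by move=> n _; rewrite prob_fin.
  rewrite sumEFin lee_fin; apply: le_trans (_ : \sum_(0 <= n < m) c n <= _).
    exact: ler_sum.
  apply: le_trans (sumc m) _; rewrite ler_piMr ?invr_ge0 ?ltW//.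
  by have := expR_gt0 (- (eta * ln m.+1%:R)); lra.
have mlim : measurable (lim_sup_set F).
  apply: bigcap_measurable => [|n _]; first by exists 0%N.
  exact: bigcup_measurable.
exists (lim_sup_set F); split=> //; first exact: lim_sup_set_cvg0.
move=> w /= h; apply: contrapT => nlim; apply: h.
have [n nF] : exists n, forall m, (n <= m)%N -> ~ F m w.
  apply: contrapT => hn; apply: nlim => n _ /=; apply: contrapT => hF.
  by apply: hn; exists n => m nm Fm; apply: hF; exists m.
exists (N + n.+2)%N => // k /= nk.
have -> : k = (N + (k - N - 2).+2)%N by lia.
by move=> /FS; apply: nF; lia.
Qed.

Section blocks.
Variable E : nat -> set T.
Hypothesis indE : independent_events P E.
Variables (J : nat -> seq nat) (B : nat -> set R).
Hypothesis uJ : forall n, uniq (J n).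
Let G n := centred_count P E (J n) @^-1` B n.
Let mG n : measurable (G n). Proof. exact: measurable_centred_count_preimage. Qed.

Let H N m := \big[setI/setT]_(i < m) G (N + i)%N.
Let mH N m : measurable (H N m).
Proof. by apply: bigsetI_measurable => i _. Qed.

(** Independence of events determined by disjoint blocks. The extra factor
    [all_of E I] makes the induction on the number of blocks go through. *)
Lemma prob_disjoint_blocks N m I : uniq I ->
  (forall n n' k, (N <= n < n')%N -> k \in J n -> k \notin J n') ->
  (forall i k, (i < m)%N -> k \in I -> k \notin J (N + i)%N) ->
  prob P (all_of E I `&` H N m) =
  prob P (all_of E I) * \prod_(i < m) prob P (G (N + i)%N).
Proof.
move=> uI dJ; rewrite /H; elim: m I uI => [|m IH] I uI dI.
  by rewrite !big_ord0 setIT mulr1.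
have dI' i k : (i < m)%N -> k \in I -> k \notin J (N + i)%N.
  by move=> im; apply: dI; exact: ltnW.
rewrite !big_ord_recr/= setIA (independent_of_block indE)//; last 2 first.
- by apply: measurableI; [exact: measurable_all_of indE _|exact: mH].
- move=> I' uI' I'J.
  have uII' : uniq (I ++ I').
    rewrite cat_uniq uI uI' andbT/=; apply/hasPn => k /I'J kJ.
    by apply: contraL kJ => kI; exact: dI.
  rewrite setIAC -all_of_cat !IH//; last first.
    move=> i k im; rewrite mem_cat => /orP[|/I'J kJ]; first exact: dI'.
    apply: contraL kJ; apply: dJ; lia.
  rewrite [RHS]mulrAC; congr (_ * _).
  by rewrite !(prob_all_of indE)// big_cat.
- by rewrite IH// mulrA -(prob_centred_count indE).
Qed.

End blocks.

(** Second Borel-Cantelli lemma for events determined by disjoint blocks. With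
    probabilities above [1 / n] the probability that none of them occurs is at
    most a telescoping product of the factors [1 - 1 / n]. *)
Lemma ae_infinitely_often E (J : nat -> seq nat) (B : nat -> set R) N :
  independent_events P E -> (forall n, uniq (J n)) ->
  (forall n n' k, (N <= n < n')%N -> k \in J n -> k \notin J n') ->
  (\forall n \near \oo, n%:R^-1 <= prob P (centred_count P E (J n) @^-1` B n)) ->
  {ae P, forall w, forall n0, exists2 n,
    (n0 <= n)%N & B n (centred_count P E (J n) w)}.
Proof.
move=> indE uJ dJ [M _ MG].
pose G n := centred_count P E (J n) @^-1` (~` B n).
have mG n : measurable (G n) by exact: measurable_centred_count_preimage.
have GE n : prob P (G n) = 1 - prob P (centred_count P E (J n) @^-1` B n).
  have mB : measurable (centred_count P E (J n) @^-1` B n).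
    exact: measurable_centred_count_preimage.
  rewrite /G preimage_setC -setTD (probDI P measurableT mB) setTI prob_setT //.
pose K n := \bigcap_m G (n + m)%N.
have mK n : measurable (K n) by apply: bigcap_measurable => //; exists 0%N.
have K0 n : P (K n) = 0%E.
  pose n1 := (maxn (maxn N M) (maxn n 2)).
  have sub : K n `<=` K n1.
    move=> w Kw m _; have -> : (n1 + m = n + (n1 - n + m))%N by lia.
    exact: Kw.
  have n1_gt1 : (1 < n1)%N by rewrite /n1; lia.
  have prodE m : \prod_(i < m) (1 - (n1 + i)%:R^-1 : R) = n1.-1%:R / (n1.-1 + m)%:R.
    have a_gt0 : (0 < n1.-1)%N by lia.
    elim: m => [|m IH]; first by rewrite big_ord0 addn0 divff// pnatr_eq0 -lt0n.
    rewrite big_ord_recr/= IH (_ : n1 + m = n1.-1 + m.+1)%N; last by lia.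
    rewrite addnS -natr1; field.
    by rewrite -natrD natr1 !pnatr_eq0; lia.
  have bd m : prob P (K n1) <= n1.-1%:R / (n1.-1 + m)%:R.
    have mH : measurable (\big[setI/setT]_(i < m) G (n1 + i)%N).
      by apply: bigsetI_measurable.
    apply: le_trans (le_prob P _ mH _) _ => //.
      by move=> w Kw; rewrite -(bigcap_mkord m (fun i => G (n1 + i)%N)) => i _; exact: Kw.
    have := @prob_disjoint_blocks E indE J (fun n => ~` B n) uJ n1 m [::] isT.
    rewrite all_of_nil setTI prob_setT mul1r => ->//; last first.
      by move=> n' n'' k h; apply: dJ; move: h; rewrite /n1; lia.
    rewrite -prodE; apply: ler_prod => i _.
    have /andP[-> _]/= := prob_bounds P (mG (n1 + i)%N).
    by rewrite GE lerD2l lerN2; apply: MG => /=; rewrite /n1; lia.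
  have x0 : 0 <= prob P (K n) by have /andP[] := prob_bounds P (mK n).
  have : prob P (K n) <= 0.
    rewrite leNgt; apply/negP => x_gt0.
    have [m am] : exists m, n1.-1%:R / prob P (K n) < m%:R.
      by exists (Num.bound (n1.-1%:R / prob P (K n))); rewrite archi_boundP// divr_ge0.
    have := le_trans (le_prob P (mK n) (mK n1) sub) (bd m.+1).
    rewrite addnS ler_pdivlMr ?ltr0n// -(natr1 (n1.-1 + m)) natrD.
    move: am; rewrite ltr_pdivrMr// => am.
    have := mulr_ge0 x0 (ler0n R n1.-1).
    by lra.
  move=> xle0; rewrite prob_fin//; congr EFin; apply/eqP.
  by rewrite eq_le xle0.
have [Z [mZ Z0 KZ]] : P.-negligible (\bigcup_n K n).
  by apply: negligible_bigcup => n; exists (K n); split=> //; exact: K0.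
exists Z; split=> //; apply: subset_trans KZ.
move=> w /= h; apply: contrapT => hK; apply: h => n0; apply: contrapT => hn.
apply: hK; exists n0 => // m _; rewrite /G/= => Bw.
by apply: hn; exists (n0 + m)%N => //; exact: leq_addr.
Qed.

End outer_bounds.

(** * Chaining along a partition *)

Section chaining.
Context {R : realType}.

(** Levels go down by factors of four: [k] is reached from a multiple of
    [4 ^ I] by at most four steps of each length [4 ^ i], [i <= I]. *)
Lemma quaternary_chaining (u x : nat -> R) (N : nat) :
  (forall i, 0 <= x i) ->
  (forall i l, (l.+1 * 4 ^ i <= N)%N ->
    u (l.+1 * 4 ^ i)%N <= u (l * 4 ^ i)%N + x i) ->
  forall I l k, (l * 4 ^ I <= k <= l.+1 * 4 ^ I)%N -> (k <= N)%N ->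
    u k <= u (l * 4 ^ I)%N + (x 0%N + 4 * \sum_(i < I) x i).
Proof.
move=> x0 step.
have steps i l m : ((l + m) * 4 ^ i <= N)%N ->
    u ((l + m) * 4 ^ i)%N <= u (l * 4 ^ i)%N + m%:R * x i.
  elim: m => [|m IH] lN; first by rewrite addn0 mul0r addr0.
  rewrite addnS; apply: le_trans (step _ _ _) _; first by rewrite -addnS.
  have {}IH : u ((l + m) * 4 ^ i)%N <= u (l * 4 ^ i)%N + m%:R * x i.
    by apply: IH; apply: leq_trans lN; rewrite leq_mul2r addnS leqnSn orbT.
  by rewrite -natr1; lra.
elim=> [|I IH] l k /andP[lk kl] kN.
  rewrite big_ord0 mulr0 addr0; move: lk kl; rewrite !expn0 !muln1 => lk kl.
   have [->|k_l] : k = l \/ k = l.+1 by lia.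
    by rewrite lerDl.
  have := step 0%N l; rewrite !expn0 !muln1 -k_l => /(_ kN); lra.
pose c := (k %/ 4 ^ I)%N.
have p4 : (0 < 4 ^ I)%N by rewrite expn_gt0.
have ck : (c * 4 ^ I <= k)%N by exact: leq_divM.
have kc : (k < c.+1 * 4 ^ I)%N by rewrite -ltn_divLR.
have lc : (l * 4 <= c)%N by rewrite /c leq_divRL// -mulnA -expnS.
have cl : (c <= l * 4 + 4)%N.
  rewrite -ltnS -(ltn_pmul2r p4); apply: leq_ltn_trans ck _.
  apply: leq_ltn_trans kl _; rewrite expnS; lia.
rewrite big_ord_recr/=.
have h1 : u k <= u (c * 4 ^ I)%N + (x 0%N + 4 * \sum_(i < I) x i).
  by apply: IH => //; rewrite ck ltnW.
have h2 : u (c * 4 ^ I)%N <= u (l * 4 ^ I.+1)%N + (c - l * 4)%N%:R * x I.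
  have := steps I (l * 4)%N (c - l * 4)%N; rewrite subnKC// -mulnA -expnS.
  by apply; exact: leq_trans kN.
have h3 : (c - l * 4)%N%:R * x I <= 4 * x I.
  by rewrite ler_wpM2r// (ler_nat R _ 4); lia.
lra.
Qed.

End chaining.

Section maximal_inequality.
Context d (T : measurableType d) (R : realType) (P : probability T R).

Lemma expR1_le4 : expR 1 <= 4 :> R.
Proof.
have h : 1 - 1 / 2 <= expR (- (1 / 2)) :> R by exact: onem_le_expRN.
have h2 : expR (- (1 / 2)) * expR (- (1 / 2)) = (expR 1)^-1 :> R.
  by rewrite -expRD -expRN; congr expR; lra.
have : 4^-1 <= (expR 1)^-1 :> R by rewrite -h2; nra.
by rewrite lef_pV2// posrE ?expR_gt0.
Qed.

(** With ratio [4 * expR (- (z / 2))] this sums the number of blocks of each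
    level times the probability that one of them is exceptional. *)
Lemma geometric_sum_le (r : R) I : 0 <= r <= 1 / 2 ->
  \sum_(i < I.+1) r ^+ (I - i) <= 2.
Proof.
move=> /andP[r0 r1]; elim: I => [|I IH]; first by rewrite big_ord1 expr0; lra.
rewrite big_ord_recr/= subnn expr0.
rewrite (eq_bigr (fun i : 'I_I.+1 => r * r ^+ (I - i))); last first.
  by move=> i _; rewrite -exprS subSn// -ltnS.
by rewrite -mulr_sumr; nra.
Qed.

Lemma chaining_weights_le I :
  (3 / 4) ^+ I + 4 * \sum_(i < I) (3 / 4) ^+ (I - i) <= 12 :> R.
Proof.
elim: I => [|I IH]; first by rewrite big_ord0 expr0; lra.
rewrite big_ord_recr/= (_ : I.+1 - I = 1)%N; last by lia.
rewrite (eq_bigr (fun i : 'I_I => 3 / 4 * (3 / 4) ^+ (I - i))); last first.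
  by move=> i _; rewrite -exprS subSn// ltnW.
by rewrite -mulr_sumr exprS expr1; lra.
Qed.

Lemma increment_gt (e e' : \bar R) (c c' x : R) : (0 <= e)%E -> (0 <= e')%E ->
  (e + e' < +oo)%E -> fine e - c + x < fine (e + e')%E - (c + c') ->
  ((c' + x)%:E < e')%E.
Proof.
by case: e => [r| |]//; case: e' => [r'| |]//= _ _ _; rewrite lte_fin; lra.
Qed.

Lemma bernoulli_inequality m : 1 + m%:R / 2 <= (3 / 2) ^+ m :> R.
Proof.
elim: m => [|m IH]; first by rewrite expr0; lra.
rewrite exprS; have := ler0n R m; rewrite -natr1; nra.
Qed.

Section nested.
Variables (E : nat -> nat -> set T) (B : R).
Hypothesis sumE : forall m, summable_events P (E m).
Hypothesis subE : forall m n k, (m <= n)%N -> E m k `<=` E n k.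
Hypothesis indE : forall m n, (m <= n)%N ->
  independent_events P (fun k => E n k `\` E m k).
Hypothesis B1 : 1 <= B.
Hypothesis meanE : forall m, count_mean P (E m.+1) - count_mean P (E m) <= B.

Let D m n k := E n k `\` E m k.
Let mE m k : measurable (E m k). Proof. by case: (sumE m) => + _; exact. Qed.
Let mD m n k : measurable (D m n k). Proof. exact: measurableD. Qed.

Let sumD m n : summable_events P (D m n).
Proof.
split=> //; case: (sumE n) => _; apply: le_lt_trans; apply: lee_nneseries => //.
by move=> k _; apply: le_measure; rewrite ?inE//; exact: subDsetl.
Qed.

Let ecountD m n w : (m <= n)%N ->
  ecount R (E n) w = (ecount R (E m) w + ecount R (D m n) w)%E.
Proof.
move=> mn; rewrite /ecount -nneseriesD; last 2 first.
- by move=> k _ _; rewrite lee_fin.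
- by move=> k _ _; rewrite lee_fin.
apply: eq_eseriesr => k _; rewrite -EFinD !indicE; congr EFin.
have [Em|Em] := pselect (E m k w).
  have En := subE mn Em; rewrite [w \in E m k]mem_set// mem_set//.
  by rewrite memNset ?addr0//; case.
have [En|En] := pselect (E n k w).
  by rewrite mem_set// memNset// mem_set// add0r.
by rewrite !memNset ?addr0//; case.
Qed.

Let count_meanD m n : (m <= n)%N ->
  count_mean P (E n) = count_mean P (E m) + count_mean P (D m n).
Proof.
move=> mn; apply: EFin_inj; rewrite EFinD -!(count_meanE (sumE _)) -count_meanE//.
rewrite -nneseriesD; last 2 first.
- by move=> k _ _; rewrite lee_fin; have /andP[] := prob_bounds P (mE m k).
- by move=> k _ _; rewrite lee_fin; have /andP[] := prob_bounds P (mD m n k).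
apply: eq_eseriesr => k _; rewrite -EFinD; congr EFin.
have -> : D m n k = E n k `\` E m k by [].
have EI : E n k `&` E m k = E m k by apply/setIidPr; exact: subE.
by rewrite (probDI P (mE n k) (mE m k)) EI addrC subrK.
Qed.

Let count_mean_steps m n : count_mean P (D m (m + n)) <= n%:R * B.
Proof.
have -> : count_mean P (D m (m + n)) = count_mean P (E (m + n)%N) - count_mean P (E m).
  by rewrite (count_meanD (leq_addr n m)) addrAC subrr add0r.
elim: n => [|n IH]; first by rewrite addn0 subrr mul0r.
by rewrite addnS -natr1; have := meanE (m + n); lra.
Qed.

Let ecount_increment_gt m n w (y : R) : (m <= n)%N ->
  (ecount R (E n) w < +oo)%E ->
  fine (ecount R (E m) w) - count_mean P (E m) + y <
    fine (ecount R (E n) w) - count_mean P (E n) ->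
  ((count_mean P (D m n) + y)%:E < ecount R (D m n) w)%E.
Proof.
move=> mn; rewrite (ecountD w mn) (count_meanD mn).
by apply: increment_gt; exact: ecount_ge0.
Qed.

(** The increment over a block of [4 ^ i] steps has variance at most
    [B ^+ 2 * 4 ^ i]; the level [x i] exceeds its standard deviation by a factor
    growing geometrically towards the short blocks, which pays for their
    number [4 ^ (I - i)]. *)
Lemma maximal_inequality I (z : R) : 4 * expR (- (z / 2)) <= 1 / 2 ->
  outer_prob_le P
    [set w | (forall m, (ecount R (E m) w < +oo)%E) /\
      exists2 k, (k <= 4 ^ I)%N &
        fine (ecount R (E 0%N) w) - count_mean P (E 0%N) + 12 * (z * B * 2 ^+ I) <
        fine (ecount R (E k) w) - count_mean P (E k)]
    (32 * expR (- z)).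
Proof.
move=> zr; have b1 := B1; have B0 : 0 < B by lra.
have z0 : 0 < z.
  rewrite ltNge; apply/negP => z0.
  have : 1 <= expR (- (z / 2)) by apply: ge0_expR_ge1; lra.
  by lra.
(* relative to the standard deviation [B * 2 ^+ i] the level is
   [z * (3 / 2) ^+ (I - i)], while the chaining bound
   [x 0 + 4 * \sum_(i < I) x i] is at most [12 * z * B * 2 ^+ I] *)
pose x i := z * B * 2 ^+ I * (3 / 4) ^+ (I - i).
have x0 i : 0 <= x i.
  by rewrite /x !mulr_ge0 ?exprn_ge0 ?(ltW z0) ?(ltW B0)//; lra.
pose S i l := [set w | ((count_mean P (D (l * 4 ^ i) (l.+1 * 4 ^ i)) + x i)%:E <
  ecount R (D (l * 4 ^ i) (l.+1 * 4 ^ i)) w)%E].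
pose c i := 16 * expR (- z) * expR (- (z / 2)) ^+ (I - i).
have Sc i l : (i <= I)%N -> outer_prob_le P (S i l) (c i).
  move=> iI; set D0 := D (l * 4 ^ i) (l.+1 * 4 ^ i).
  pose V := B ^+ 2 * (2 ^+ i) ^+ 2; pose s := (B * 2 ^+ i)^-1.
  have p2 : 1 <= 2 ^+ i :> R by rewrite exprn_ege1//; lra.
  have VD : total_var P D0 <= V.
    apply: le_trans (total_var_le_mean (sumD _ _)) _.
    rewrite /D0 mulSn addnC; apply: le_trans (count_mean_steps _ _) _.
    have -> : (4 ^ i)%:R = (2 ^+ i) ^+ 2 :> R.
      by rewrite natrX exprAC; congr (_ ^+ i); rewrite -natrX.
    by rewrite /V mulrC ler_wpM2r ?sqr_ge0//; nra.
  have s0 : 0 < s by rewrite invr_gt0 mulr_gt0//; lra.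
  have s1 : s <= 1 by rewrite invf_le1; nra.
  apply: outer_prob_le_trans (count_upper_tail _ (sumD _ _) (x i) (ltW s0) VD) _.
    by apply: indE; rewrite leq_mul2r leqnSn orbT.
  have sx : s * x i = z * (3 / 2) ^+ (I - i).
    have -> : (3 / 2 : R) = 2 * (3 / 4) by lra.
    rewrite exprMn /s /x.
    have -> : 2 ^+ I = 2 ^+ (I - i) * 2 ^+ i :> R by rewrite -exprD subnK.
    move: ((3 / 4) ^+ (I - i)) (2 ^+ (I - i) : R) => r3 r2.
    move: p2; set p2' := 2 ^+ i => p2.
    by field; rewrite !gt_eqF//; lra.
  have sV : s ^+ 2 / 2 * V = 1 / 2.
    by rewrite /s /V; field; rewrite expf_neq0// gt_eqF.
  have es4 : expR s <= 4 by apply: le_trans expR1_le4; rewrite ler_expR.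
  have e16 : expR 2 <= 16 :> R.
    rewrite (_ : 2 = 1 + 1 :> R)// expRD; have := expR1_le4.
    by have := expR_ge0 (1 : R); nra.
  apply: le_trans (_ : expR 2 * expR (- z) * expR (- (z / 2)) ^+ (I - i) <= _).
    rewrite -expRM_natl -!expRD ler_expR sx sV.
    by have := ler_wpM2l (ltW z0) (bernoulli_inequality (I - i)); lra.
  by rewrite /c !ler_wpM2r ?exprn_ge0 ?expR_ge0.
apply: outer_prob_le_trans (_ : outer_prob_le _ _
    (\sum_(i < I.+1) \sum_(l < 4 ^ (I - i)) c i)) _; last first.
  have r01 : 0 <= 4 * expR (- (z / 2)) <= 1 / 2.
    by rewrite zr andbT mulr_ge0// expR_ge0.
  have := geometric_sum_le I r01.
  rewrite -(ler_pM2l (_ : 0 < 16 * expR (- z))) ?mulr_gt0 ?expR_gt0//.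
  rewrite mulr_sumr => /(le_trans _) h; apply: le_trans (h _ _) _; last by lra.
  apply: ler_sum => i _; rewrite sumr_const card_ord -[c i *+ _]mulr_natr natrX /c.
  by rewrite exprMn; lra.
have Sb i : (i < I.+1)%N -> outer_prob_le P
    (\bigcup_(l in [set l | (l < 4 ^ (I - i))%N]) S i l)
    (\sum_(l < 4 ^ (I - i)) c i).
  move=> iI; apply: (@outer_prob_le_bigcup _ _ _ _ (S i) (fun=> c i)) => l _.
  by apply: Sc; rewrite -ltnS.
apply: sub_outer_prob_le (outer_prob_le_bigcup Sb).
move=> w [fin [k kI]]; apply: contraPP => nS; apply/negP; rewrite -leNgt.
pose u m := fine (ecount R (E m) w) - count_mean P (E m).
have step i l : (l.+1 * 4 ^ i <= 4 ^ I)%N ->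
    u (l.+1 * 4 ^ i)%N <= u (l * 4 ^ i)%N + x i.
  move=> il.
  have iI : (i <= I)%N.
    rewrite -(@leq_exp2l 4)//; apply: leq_trans il; exact: leq_pmull.
  have lI : (l < 4 ^ (I - i))%N.
    by rewrite -(ltn_pmul2r (_ : 0 < 4 ^ i)%N) ?expn_gt0// -expnD subnK//;
      apply: leq_trans il; rewrite ltn_pmul2r ?expn_gt0.
  have ll : (l * 4 ^ i <= l.+1 * 4 ^ i)%N by rewrite leq_mul2r leqnSn orbT.
  rewrite leNgt; apply/negP => ux; apply: nS; exists i => //; exists l => //=.
  by apply: ecount_increment_gt => //; exact: ux.
have := @quaternary_chaining _ u x (4 ^ I)%N x0 step I 0%N k.
rewrite mul0n mul1n leq0n kI => /(_ isT isT) /le_trans; apply.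
rewrite /u lerD2l.
rewrite (eq_bigr (fun i : 'I_I => z * B * 2 ^+ I * (3 / 4) ^+ (I - i)))//.
rewrite -mulr_sumr {1}/x subn0.
have : 0 <= z * B * 2 ^+ I by rewrite !mulr_ge0 ?exprn_ge0// ltW.
by have := chaining_weights_le I; nra.
Qed.

End nested.
End maximal_inequality.

(** * Growth of slowly varying functions *)

Section slow_variation.
Context {R : realType}.
Local Notation mu := (@lebesgue_measure R).

Lemma lebesgue_measure_shift (c : R) (A : set R) : measurable A ->
  mu ((fun x => x + c) @^-1` A) = mu A.
Proof.
move=> mA.
have mf : measurable_fun setT (fun x : R => x + c).
  by apply: measurable_funD => //; exact: measurable_id.
have mf' : measurable_fun setT (fun x : measurableTypeR R => (x + c : measurableTypeR R)).
  exact: mf.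
pose f : {mfun measurableTypeR R >-> measurableTypeR R} :=
  HB.pack (fun x : measurableTypeR R => (x + c : measurableTypeR R))
    (isMeasurableFun.Build _ _ _ _ _ mf').
change (pushforward mu f A = mu A).
apply/esym/lebesgue_measure_unique => //= _ [[a b]] _ <-.
rewrite /pushforward/=.
have -> : (fun x => x + c) @^-1` `]a, b]%classic = `]a - c, b - c]%classic.
  by apply/seteqP; split=> x /=; rewrite !in_itv/=; lra.
rewrite !lebesgue_measure_itv/= !lte_fin ltrD2r; case: ifP => // _.
by rewrite -!EFinD; congr EFin; lra.
Qed.

(** Two subsets of [[0, 2]] filling more than three quarters of it meet after a
    translation by at most [1], as both then lie in [[0, 3]]. *)
Lemma translate_meets (A B : set R) (c : R) : measurable A -> measurable B ->
  A `<=` `[0, 2]%classic -> B `<=` `[0, 2]%classic ->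
  ((3 / 2)%:E < mu A)%E -> ((3 / 2)%:E < mu B)%E -> 0 <= c <= 1 ->
  exists v, B v /\ A (c + v).
Proof.
move=> mA mB A2 B2 muA muB /andP[c0 c1]; apply: contrapT => h.
pose B' := (fun x => x + (- c)) @^-1` B.
have mB' : measurable B'.
  rewrite /B' -[X in measurable X]setTI.
  have mf : measurable_fun setT (fun x : R => x + (- c)).
    by apply: measurable_funD => //; exact: measurable_id.
  exact: mf.
have AB' : A `&` B' = set0.
  apply/seteqP; split=> x //= [Ax B'x]; apply: h; exists (x - c); split=> //.
  by rewrite addrC subrK.
have AB3 : A `|` B' `<=` `[0, 3]%classic.
  move=> x /= [/A2|/B2]; rewrite /= !in_itv/=; lra.
have : (mu (A `|` B') <= mu `[0%R, 3%R]%classic)%E.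
  by apply: le_measure => //; rewrite inE//; exact: measurableU.
rewrite measureU//; rewrite lebesgue_measure_itv/= lte_fin ifT; last by lra.
apply/negP; rewrite -ltNge (_ : (3%R%:E - 0%R%:E)%E = ((3 / 2)%:E + (3 / 2)%:E)%E :> \bar R).
  by apply: lteD => //; rewrite /B' lebesgue_measure_shift.
by rewrite -!EFinD; congr EFin; lra.
Qed.

Variable L : R -> R.
Hypothesis svL : slowly_varying L.

Lemma slowly_varying_gt0 : exists M, forall x, M < x -> 0 < L x.
Proof. by case: svL => -[M [_ M0]] _; exists M => t /M0. Qed.

(** Along any sequence going to infinity the convergence defining slow variation
    is eventually controlled on a set of shifts of large measure. *)
Lemma large_controlled_set (y : nat -> R) : (y n @[n --> \oo] --> +oo) ->
  exists N (A : set R), [/\ measurable A, A `<=` `[0, 2]%classic,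
    ((3 / 2)%:E < mu A)%E &
    forall n u, (N <= n)%N -> A u ->
      L (expR (y n)) / 2 <= L (expR (y n + u)) <= 3 / 2 * L (expR (y n))].
Proof.
move=> yoo; case: svL => -[M [mL L0]] Llim.
have [N0 N0P] : exists N0, forall n, (N0 <= n)%N -> M < expR (y n).
  move/cvgryPgt : yoo => /(_ M)[N0 _ h]; exists N0 => n /h /= Mn.
  by apply: lt_le_trans Mn _; have := expR_ge1Dx (y n); lra.
pose D n := [set u : R | 0 <= u <= 2 /\
  L (expR (y n)) / 2 <= L (expR (y n + u)) <= 3 / 2 * L (expR (y n))].
have mD n : (N0 <= n)%N -> measurable (D n).
  move=> nN.
  have -> : D n = (`[0, 2]%classic : set R) `&` (fun u => L (expR (y n + u))) @^-1`
      `[L (expR (y n)) / 2, 3 / 2 * L (expR (y n))]%classic.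
    by apply/seteqP; split=> u /=; rewrite !in_itv/=.
  have mf : measurable_fun (`[0, 2]%classic : set R) (fun u : R => L (expR (y n + u))).
    apply: (measurable_comp (F := `]M, +oo[%classic)) => //.
    - move=> _ [u + <-]; rewrite /= !in_itv/= andbT => /andP[u0 _].
      by apply: lt_le_trans (N0P _ nN) _; rewrite ler_expR lerDl.
    - apply: measurableT_comp; first exact: measurable_expR.
      by apply: measurable_funD => //; exact: measurable_id.
  exact: mf.
pose F m := \bigcap_(n in [set n | (N0 + m <= n)%N]) D n.
have mF m : measurable (F m).
  apply: bigcap_measurable; first by exists (N0 + m)%N => /=.
  by move=> n /= mn; apply: mD; lia.
have UF : \bigcup_m F m = `[0, 2]%classic.
  apply/seteqP; split=> [u [m _ /(_ (N0 + m)%N)]|u].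
    by move=> /(_ (leqnn _))[u02 _]; rewrite /= in_itv.
  rewrite /= in_itv/= => u02.
  move/cvgrPdist_lt : (Llim (expR u) (expR_gt0 u)) => /(_ (1 / 2)).
  rewrite divr_gt0// => /(_ isT) [K [_ hK]].
  move/cvgryPgt : yoo => /(_ K)[m _ mK].
  exists m => // n /= mn; split=> //.
  have Mn := N0P n; have Ln : 0 < L (expR (y n)) by apply/L0/Mn; lia.
  have Kn : K < expR (y n).
    have : K < y n by apply: mK => /=; lia.
    by have := expR_ge1Dx (y n); lra.
  have := hK _ Kn; rewrite -expRD (addrC u) ltr_norml => /andP[h1 h2].
  have r1 : L (expR (y n + u)) / L (expR (y n)) <= 3 / 2 by lra.
  have r2 : 1 / 2 <= L (expR (y n + u)) / L (expR (y n)) by lra.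
  by move: r1 r2; rewrite ler_pdivrMr// ler_pdivlMr//; lra.
have ndF : {homo F : n m / (n <= m)%N >-> (n <= m)%O}.
  by move=> n m nm; apply/subsetPset => u Fu k /= mk; apply: Fu => /=; lia.
have mU : measurable (\bigcup_m F m) by exact: bigcup_measurable.
have Fcvg := nondecreasing_cvg_mu mF mU ndF (mu := mu).
have [m muF] : exists m, ((3 / 2)%:E < mu (F m))%E.
  apply: contrapT => hm.
  have : (limn (mu \o F) <= (3 / 2)%:E)%E.
    apply: lime_le; first by apply/cvg_ex; exists (mu (\bigcup_m F m)).
    by apply: nearW => m /=; rewrite leNgt; apply/negP => mF'; apply: hm; exists m.
  have mu02 : mu (\bigcup_m F m) = 2%:E.
    rewrite UF lebesgue_measure_itv/= lte_fin ifT; last by lra.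
    by rewrite -EFinD; congr EFin; lra.
  rewrite (cvg_lim _ Fcvg)// [X in (X <= _)%E](_ : _ = 2%:E); last exact: mu02.
  by rewrite lee_fin; lra.
exists (N0 + m)%N, (F m); split=> //.
- by rewrite -UF; exact: bigcup_sup.
- by move=> n u /= Nn /(_ n Nn)[].
Qed.

(** If the bound failed at [x] tending to infinity with shifts [u], the controlled
    sets along [x] and along [x + u] would contain [u + v] and [v] for some [v];
    comparing [L] at [x] and [x + u] with its value at [x + u + v] bounds the
    ratio by [(3 / 2) / (1 / 2)] after all. *)
Lemma slowly_varying_locally_bounded : exists x0, forall x u,
  x0 <= x -> 0 <= u <= 1 -> L (expR (x + u)) <= 3 * L (expR x).
Proof.
apply: contrapT => h.
have [xu xuP] : {xu : nat -> R * R | forall n, [/\ n%:R <= (xu n).1,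
    0 <= (xu n).2 <= 1 & 3 * L (expR (xu n).1) < L (expR ((xu n).1 + (xu n).2))]}.
  have hn n : {xu : R * R | [/\ n%:R <= xu.1,
    0 <= xu.2 <= 1 & 3 * L (expR xu.1) < L (expR (xu.1 + xu.2))]}.
    apply: cid; apply: contrapT => hn; apply: h; exists n%:R => x u nx u01.
    by rewrite leNgt; apply/negP => Lx; apply: hn; exists (x, u).
  by exists (fun n => projT1 (hn n)) => n; case: (hn n).
have noo K : \forall n \near \oo, K <= (n%:R : R).
  by move/cvgryPge : (@cvgr_idn R); exact.
have xoo : ((xu n).1 @[n --> \oo] --> +oo).
  apply/cvgryPge => K; apply: filterS (noo K) => n Kn.
  by case: (xuP n) => nx _ _; exact: le_trans nx.
have xuoo : ((xu n).1 + (xu n).2 @[n --> \oo] --> +oo).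
  apply/cvgryPge => K; apply: filterS (noo K) => n Kn.
  by case: (xuP n) => nx /andP[u0 _] _; lra.
have [N [A [mA A2 muA NA]]] := large_controlled_set xoo.
have [N' [A' [mA' A'2 muA' NA']]] := large_controlled_set xuoo.
have [_ u01 Lbig] := xuP (maxn N N').
have [v [A'v Av]] := translate_meets mA mA' A2 A'2 muA muA' u01.
have /andP[_] := NA _ _ (leq_maxl N N') Av.
have /andP[+ _] := NA' _ _ (leq_maxr N N') A'v.
by rewrite addrA; lra.
Qed.

(** On the logarithmic scale a unit step eventually multiplies [L] by at most
    [expR rho], and the previous bound covers the fractional part. *)
Lemma slowly_varying_le_powR (rho : R) : 0 < rho ->
  exists C x0, forall x, x0 <= x -> L x <= C * x `^ rho.
Proof.
move=> rho0; have [x0 lb] := slowly_varying_locally_bounded.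
case: svL => -[M [_ L0]] Llim.
have e1 : 0 < expR rho - 1 by rewrite subr_gt0 -[ltLHS]expR0 ltr_expR.
move/cvgrPdist_lt : (Llim (expR 1) (expR_gt0 1)) => /(_ _ e1) [K [_ hK]].
pose x1 := Num.max x0 (Num.max K M).
have x01 : x0 <= x1 by rewrite le_max lexx.
have Kx1 : K <= x1 by rewrite !le_max lexx orbT.
have Mx1 : M <= x1 by rewrite !le_max lexx !orbT.
have stepk x k : x1 <= x -> L (expR (x + k%:R)) <= expR (rho * k%:R) * L (expR x).
  move=> x1x; elim: k => [|k IH]; first by rewrite addr0 mulr0 expR0 mul1r.
  have k0 : 0 <= k%:R :> R by [].
  have le1 := expR_ge1Dx (x + k%:R).
  have Lk : 0 < L (expR (x + k%:R)) by apply: L0; lra.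
  have Kk : K < expR (x + k%:R) by lra.
  have := hK _ Kk; rewrite ltr_norml => /andP[h1 _].
  have : L (expR 1 * expR (x + k%:R)) / L (expR (x + k%:R)) <= expR rho by lra.
  have -> : x + k.+1%:R = 1 + (x + k%:R) by rewrite -natr1; ring.
  have -> : rho * k.+1%:R = rho + rho * k%:R by rewrite -natr1; ring.
  rewrite ler_pdivrMr// -expRD => /le_trans; apply.
  by rewrite (expRD rho) -mulrA ler_wpM2l ?expR_ge0.
exists (3 * L (expR x1) * expR (- (rho * x1))), (expR x1) => x x1x.
have xgt0 : 0 < x by apply: lt_le_trans x1x; exact: expR_gt0.
pose y := ln x; have xE : x = expR y by rewrite lnK.
have x1y : x1 <= y by rewrite -ler_expR -xE.
pose k := Num.truncn (y - x1); pose u := y - x1 - k%:R.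
have y0 : 0 <= y - x1 by lra.
have /andP[ky yk] := truncn_itv y0.
have u01 : 0 <= u <= 1 by rewrite /u /k; move: yk; rewrite -natr1; lra.
have -> : L x = L (expR (x1 + u + k%:R)).
  by rewrite xE; congr (L (expR _)); rewrite /u; ring.
apply: le_trans (stepk _ _ _) _; first by lra.
have Lx1 : 0 < L (expR x1) by apply: L0; have := expR_ge1Dx x1; lra.
apply: le_trans (_ : expR (rho * k%:R) * (3 * L (expR x1)) <= _).
  by rewrite ler_wpM2l ?expR_ge0// lb.
rewrite mulrC -mulrA ler_wpM2l//; first by rewrite mulr_ge0// ltW.
rewrite /powR gt_eqF// -expRD ler_expR.
have : rho * k%:R <= rho * (y - x1) by rewrite ler_pM2l.
by rewrite /y; lra.
Qed.

End slow_variation.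

(** * Families of events indexed by time *)

Section event_transformations.
Context d (T : measurableType d) (R : realType) (P : probability T R).
Implicit Types (E : nat -> set T) (I J : seq nat).

Lemma eq_all_of E E' I : {in I, E =1 E'} -> all_of E I = all_of E' I.
Proof.
by move=> EE; apply/seteqP; split=> w h k /= kI; move: (h k kI); rewrite EE.
Qed.

Lemma independent_eventsP E : (forall k, measurable (E k)) ->
  (forall I, uniq I -> prob P (all_of E I) = \prod_(k <- I) prob P (E k)) ->
  independent_events P E.
Proof.
move=> mE h; split=> // I uI; rewrite -/(all_of E I).
have mI : measurable (all_of E I).
  elim: I {uI} => [|k I IH]; first by rewrite all_of_nil.
  by rewrite all_of_cons; exact: measurableI.
rewrite prob_fin// h//; elim: I {uI mI} => [|k I IH]; first by rewrite !big_nil.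
by rewrite !big_cons EFinM IH prob_fin.
Qed.

(** Multiplicativity is affine in each event, so it passes to differences. *)
Lemma independent_events_setD E E' : (forall k, E' k `<=` E k) ->
  (forall f : nat -> bool, independent_events P (fun k => if f k then E k else E' k)) ->
  independent_events P (fun k => E k `\` E' k).
Proof.
move=> EE ind.
have mE k : measurable (E k) by case: (ind xpredT).
have mE' k : measurable (E' k) by case: (ind xpred0).
pose D k := E k `\` E' k; pose M (f : nat -> bool) k := if f k then E k else E' k.
have mD k : measurable (D k) by exact: measurableD.
have mDI I : measurable (all_of D I).
  elim: I => [|k I IH]; first by rewrite all_of_nil.
  by rewrite all_of_cons; exact: measurableI.
apply: independent_eventsP => // I uI.
suff key : forall I J f, uniq (I ++ J) ->
    prob P (all_of D I `&` all_of (M f) J) =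
    (\prod_(k <- I) prob P (D k)) * \prod_(k <- J) prob P (M f k).
  have := key I [::] xpredT; rewrite cats0 big_nil mulr1 all_of_nil setIT.
  by apply.
move=> {uI}I; elim: I => [|k I IH] J f.
  by move=> uJ; rewrite all_of_nil setTI big_nil mul1r; exact: (prob_all_of (ind f)) uJ.
rewrite cat_cons cons_uniq mem_cat negb_or => /andP[/andP[kI kJ] uIJ].
pose g (c : bool) := fun j => if j == k then c else f j.
have MJ c : all_of (M (g c)) J = all_of (M f) J.
  apply: eq_all_of => j jJ; rewrite /M /g.
  by case: eqP => // jk; move: kJ; rewrite -jk jJ.
have PJ c : \prod_(j <- J) prob P (M (g c) j) = \prod_(j <- J) prob P (M f j).
  apply: eq_big_seq => j jJ; rewrite /M /g.
  by case: eqP => // jk; move: kJ; rewrite -jk jJ.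
set W := all_of D I `&` all_of (M f) J.
have step c : prob P ((if c then E k else E' k) `&` W) =
    (\prod_(j <- I) prob P (D j)) *
    (prob P (if c then E k else E' k) * \prod_(j <- J) prob P (M f j)).
  have <- : M (g c) k = if c then E k else E' k by rewrite /M /g eqxx.
  rewrite /W setICA.
  rewrite -(MJ c) -(PJ c) -all_of_cons IH ?big_cons//.
  by rewrite -cat1s uniq_catCA cat1s cons_uniq mem_cat negb_or kI kJ.
have mMJ : measurable (all_of (M f) J) by exact: measurable_all_of (ind f) J.
have mW : measurable W by exact: measurableI.
have /= := step true; have /= h1 := step false.
have -> : E k `&` W = (D k `&` W) `|` (E' k `&` W).
  apply/seteqP; split=> w /=.
    by move=> [Ek Ww]; have [E'w|E'w] := pselect (E' k w); [right|left].
  by move=> [[[]]|[/EE]].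
rewrite probU; last 3 first.
- exact: measurableI.
- exact: measurableI.
- by apply/seteqP; split=> w //= [[[? nE] _] [E'w _]]; exact: nE.
rewrite all_of_cons -setIA -/W big_cons.
have -> : prob P (D k) = prob P (E k) - prob P (E' k).
  rewrite probDI//; congr (_ - prob P _); apply/setIidPr; exact: EE.
by move=> h2; lra.
Qed.

Lemma independent_events_restrict E (S : set nat) : independent_events P E ->
  independent_events P (fun k => if k \in S then E k else set0).
Proof.
move=> indE; have mE k : measurable (E k) by case: indE.
apply: independent_eventsP; first by move=> k; case: ifP.
move=> I uI; have [IS|] := boolP (all (fun k => k \in S) I).
  have EE k : k \in I -> (if k \in S then E k else set0) = E k.
    by move=> kI; rewrite (allP IS).
  rewrite (eq_all_of EE) (prob_all_of indE)//.
  by apply: eq_big_seq => k kI; rewrite EE.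
move=> /allPn[k kI kS]; rewrite (big_rem k)//= (negPf kS).
rewrite [X in prob P X](_ : _ = set0) ?/prob ?measure0 ?mul0r//.
by apply/seteqP; split=> w //= /(_ k kI); rewrite (negPf kS).
Qed.

Lemma summable_events_sub E E' : (forall k, measurable (E' k)) ->
  (forall k, E' k `<=` E k) -> summable_events P E -> summable_events P E'.
Proof.
move=> mE' EE [mE sE]; split=> //; apply: le_lt_trans sE.
by apply: lee_nneseries => // k _; apply: le_measure; rewrite ?inE.
Qed.

Lemma nneseries_remove (F : nat -> R) J : (forall k, 0 <= F k) -> uniq J ->
  (\sum_(k <oo) (F k)%:E = (\sum_(k <- J) F k)%:E +
     \sum_(k <oo) (if k \in J then 0 else F k)%:E)%E.
Proof.
move=> F0; elim: J => [|j J IH] /=; first by rewrite big_nil add0e.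
move=> /andP[jJ uJ]; rewrite IH// big_cons EFinD [RHS]addeAC addeC; congr (_ + _)%E.
rewrite (nneseriesD1 (n := j))//; last by move=> k _; case: ifP; rewrite lee_fin.
rewrite (negPf jJ); congr (_ + _)%E; rewrite eseries_mkcond.
apply: eq_eseriesr => k _; rewrite inE.
by case: eqP => //= _; case: ifP.
Qed.

End event_transformations.


Lemma indic_le (T : Type) (R : realType) (B C : set T) (w : T) : B `<=` C ->
  \1_B w <= \1_C w :> R.
Proof.
move=> BC; rewrite !indicE; have [/BC Cw|Bw] := pselect (B w).
  by rewrite [w \in C]mem_set// ler_nat leq_b1.
by rewrite [w \in B]memNset.
Qed.

Section model.
Context d (T : measurableType d) (R : realType) (P : probability T R).
Variable A : nat -> R -> set T.
Hypothesis mA : forall (k : nat) (t : R), 0 <= t -> measurable (A k t).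
Hypothesis indepA : independent_families P A.
Hypothesis X_fin :
  forall t : R, 0 <= t -> {ae P, forall w, (ecount_events A t w < +oo)%E}.
Hypothesis EX_fin : forall t : R, 0 <= t -> ('E_P[count_events A t] < +oo)%E.

Definition events_at (t : R) (k : nat) : set T := A k t.

(** Each family may be sampled at its own time: this is what lets blocks taken at
    different times live in one independent sequence. *)
Lemma independent_choice (f : nat -> R) : (forall k, 0 <= f k) ->
  independent_events P (fun k => A k (f k)).
Proof.
move=> f0; split=> [k|I uI]; first exact: mA.
by apply: indepA => // k _; exists (f k) => //=; rewrite in_itv/= andbT.
Qed.

Lemma independent_events_at t : 0 <= t -> independent_events P (events_at t).
Proof. by move=> t0; exact: (independent_choice (f := fun=> t)). Qed.

Lemma summable_events_at t : 0 <= t -> summable_events P (events_at t).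
Proof.
move=> t0; have mE k : measurable (events_at t k) by exact: mA.
split=> //; rewrite -(@expectation_count _ _ _ _ (events_at t))//.
- exact: EX_fin.
- exact: X_fin.
Qed.

Lemma mean_countE t : 0 <= t -> mean_count P A t = count_mean P (events_at t).
Proof.
move=> t0; rewrite /count_mean -(@expectation_count _ _ _ _ (events_at t))//.
- by move=> k; exact: mA.
- exact: X_fin.
Qed.

Lemma var_countE t : 0 <= t -> var_count P A t = total_var P (events_at t).
Proof.
move=> t0; rewrite -[RHS]/(fine (total_var P (events_at t))%:E) -variance_count//.
- exact: summable_events_at.
- exact: independent_events_at.
Qed.

Lemma summable_events_restrict t (S : set nat) : 0 <= t ->
  summable_events P (fun k => if k \in S then A k t else set0).
Proof.
move=> t0; apply: summable_events_sub (summable_events_at t0).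
- by move=> k; case: ifP => // _; exact: mA.
- by move=> k w; case: ifP => // _ [].
Qed.

Lemma var_count_inE S t : 0 <= t ->
  var_count_in P A S t = total_var P (fun k => if k \in S then A k t else set0).
Proof.
move=> t0; rewrite -[RHS]/(fine (total_var P _)%:E) -variance_count.
- rewrite /var_count_in; congr (fine 'V_P[_]%E); apply/funext => w.
  rewrite /count_events_in; congr fine; rewrite eseries_mkcond.
  by apply: eq_eseriesr => k _; case: ifP => // _; rewrite indic0.
- exact: summable_events_restrict.
- by apply: independent_events_restrict; exact: independent_events_at.
Qed.

Lemma var_le_mean t : 0 <= t -> var_count P A t <= mean_count P A t.
Proof.
move=> t0; rewrite var_countE// mean_countE//.
exact: total_var_le_mean (summable_events_at t0).
Qed.

Hypothesis incA :
  forall (k : nat) (s t : R), 0 < s -> s < t -> A k s `<=` A k t.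

Lemma events_at_le s t k : 0 < s -> s <= t -> events_at s k `<=` events_at t k.
Proof. by move=> s0; rewrite le_eqVlt => /predU1P[->//|]; exact: incA. Qed.

Lemma independent_increments s t : 0 < s -> s <= t ->
  independent_events P (fun k => events_at t k `\` events_at s k).
Proof.
move=> s0 st; apply: independent_events_setD => [k|f]; first exact: events_at_le.
rewrite (_ : (fun k => _) = (fun k => A k (if f k then t else s))); last first.
  by apply/funext => k; case: (f k).
by apply: independent_choice => k; case: ifP; lra.
Qed.

Lemma mean_count_le s t : 0 < s -> s <= t -> mean_count P A s <= mean_count P A t.
Proof.
move=> s0 st; have t0 : 0 <= t by lra.
rewrite !mean_countE//; last exact: ltW.
rewrite -lee_fin -!count_meanE; last 2 first.
- exact: summable_events_at.
- by apply: summable_events_at; exact: ltW.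
apply: lee_nneseries => k _ *.
  by rewrite lee_fin; have /andP[] := prob_bounds P (mA k (ltW s0)).
rewrite lee_fin; apply: le_prob.
- by apply: mA; exact: ltW.
- exact: mA.
- exact: events_at_le.
Qed.

(** Almost surely the count is finite at all positive times at once, since it is
    finite at all integer times. *)
Lemma ae_count_fin :
  {ae P, forall w, forall t, 0 < t -> (ecount R (events_at t) w < +oo)%E}.
Proof.
have : {ae P, forall w, forall n : nat, (ecount R (events_at n%:R) w < +oo)%E}.
  by apply/ae_foralln => n; exact: X_fin.
apply: filterS => w wfin t t0.
pose n := Num.truncn t; have tn : t <= n.+1%:R.
  by have /andP[_ /ltW] := truncn_itv (ltW t0).
apply: le_lt_trans (wfin n.+1); apply: lee_nneseries => k _ *.
  by rewrite lee_fin.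
by rewrite lee_fin; apply: indic_le; exact: events_at_le.
Qed.

Lemma count_le s t w : 0 < s -> s <= t ->
  (forall t, 0 < t -> (ecount R (events_at t) w < +oo)%E) ->
  count_events A s w <= count_events A t w.
Proof.
move=> s0 st wfin; rewrite -lee_fin.
have E t' : 0 < t' -> (count_events A t' w)%:E = ecount R (events_at t') w.
  by move=> t'0; rewrite fineK// ge0_fin_numE ?wfin// ecount_ge0.
rewrite !E//; last by lra.
apply: lee_nneseries => k _ *; rewrite lee_fin//.
by apply: indic_le; exact: events_at_le.
Qed.

End model.

(** * The upper bound *)

Section asymptotics.
Context {R : realType}.

Lemma near_infty_ln (K : R) : \forall n \near \oo, K <= ln (n%:R : R).
Proof.
have := @cvgr_idn R; move/cvgryPge => /(_ (expR K)).
apply: filterS => n Kn; rewrite -[K]expRK ler_ln// posrE ?expR_gt0//.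
by apply: lt_le_trans Kn; exact: expR_gt0.
Qed.

Lemma near_infty_ln_le_expR (K1 K2 c kap : R) : 0 < c -> 0 < kap ->
  \forall n \near \oo, K1 * ln (n%:R : R) + K2 <= c * expR (kap * ln (n%:R : R)).
Proof.
move=> c0 k0; pose K := `|K1| + `|K2|.
have ck0 : 0 < c * kap ^+ 2 by rewrite mulr_gt0 ?exprn_gt0.
apply: filterS2 (near_infty_ln 1) (near_infty_ln (2 * K / (c * kap ^+ 2))) => n.
set l := ln n%:R => l1; rewrite ler_pdivrMr// => lK.
have kl0 : 0 <= kap * l by rewrite mulr_ge0; lra.
apply: le_trans (_ : K * l <= _).
  have : K1 <= `|K1| by exact: ler_norm.
  have : K2 <= `|K2| by exact: ler_norm.
  by have := normr_ge0 K2; rewrite /K; nra.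
have := expR_ge1Dxn 1 kl0; rewrite (_ : (2`!)%:R = 2 :> R)// => h.
apply: le_trans (_ : c * ((kap * l) ^+ 2 / 2) <= _).
  by rewrite exprMn; nra.
by rewrite ler_pM2l//; lra.
Qed.

Lemma exists_power4 j : (0 < j)%N -> exists I, (j <= 4 ^ I <= 4 * j)%N.
Proof.
move=> j0; have ex : exists I, (j <= 4 ^ I)%N.
  by exists j; apply: ltnW; exact: ltn_expl.
case: (ex_minnP ex) => [[|I] jI minI].
  by exists 0%N; rewrite jI/= expn0; lia.
exists I.+1; rewrite jI/= expnS leq_mul2l/= leqNgt; apply/negP => /ltnW jI'.
by have := minI _ jI'; rewrite ltnn.
Qed.


Lemma between_consecutive (x : nat -> R) N M t : (N < M)%N ->
  x N <= t -> t <= x M -> exists n, (N <= n < M)%N /\ x n <= t <= x n.+1.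
Proof.
move=> NM xN; rewrite -(subnK (ltnW NM)); have : (0 < M - N)%N by lia.
elim: (M - N)%N => // -[|m] IH _ xM; first by exists N; rewrite xN xM leqnn/= ltnSn.
have [tm|mt] := leP t (x (m.+1 + N)%N).
  by have [//|n [/andP[Nn nm] nt]] := IH _ tm; exists n; rewrite Nn/= addSn; split => //; lia.
by exists (m.+1 + N)%N; rewrite leq_addl (ltW mt) xM; split=> //; lia.
Qed.

Lemma partition_le (b : R -> R) (B x y : R) j (s : nat -> R) k l :
  partition_with_increments b B x y j s -> (k <= l <= j)%N -> s k <= s l.
Proof.
move=> [_ _ _ sinc _] /andP[kl lj]; elim: l kl lj => [|l IH].
  by rewrite leqn0 => /eqP ->.
rewrite leq_eqVlt => /predU1P[->//|kl] lj.
by apply: le_trans (IH _ (ltnW lj)) (ltW (sinc _ lj)); rewrite -ltnS.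
Qed.

Lemma partition_increments (b : R -> R) (B x y : R) j (s : nat -> R) k :
  partition_with_increments b B x y j s -> (k <= j)%N ->
  k%:R <= b (s k) - b x <= k%:R * B.
Proof.
move=> [_ s0 _ _ binc]; elim: k => [|k IH] kj; first by rewrite s0 subrr mul0r lexx.
have /andP[h1 h2] := IH (ltnW kj); have /andP[h3 h4] := binc _ kj.
by rewrite -natr1; apply/andP; split; lra.
Qed.

(** With [th = x / a] the Chernoff exponent at [x = (1 + del) * sqrt (2 * y * a)]
    is almost [- (1 + del) ^+ 2 * y] as long as [th] is small. *)
Lemma chernoff_exponent_le (a y del l x th : R) : 0 < a -> 0 <= y ->
    0 < del <= 1 -> 0 <= l -> (1 - del / 4) * l <= y ->
    x ^+ 2 = (1 + del) ^+ 2 * (2 * y * a) -> th = x / a ->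
    expR th <= 1 + del / 4 ->
  - (th * x) + th ^+ 2 / 2 * a * expR th <= - ((1 + del / 4) * l).
Proof.
move=> a0 y0 /andP[d0 d1] l0 ly x2 -> eth.
have x2a : x ^+ 2 / a = (1 + del) ^+ 2 * (2 * y).
  by rewrite x2; field; rewrite gt_eqF.
have -> : (x / a) * x = (1 + del) ^+ 2 * (2 * y).
  by rewrite -x2a; field; rewrite gt_eqF.
have -> : (x / a) ^+ 2 / 2 * a = (1 + del) ^+ 2 * y.
  rewrite (_ : _ * a = x ^+ 2 / a / 2); last by field; rewrite gt_eqF.
  by rewrite x2a; field.
have dy : 0 <= (1 + del) ^+ 2 * y by rewrite mulr_ge0 ?sqr_ge0.
apply: le_trans (_ : - ((1 + del) ^+ 2 * (1 - del / 4) * y) <= _).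
  have := ler_wpM2l dy eth; lra.
rewrite lerN2; apply: le_trans (_ : (1 + del) ^+ 2 * (1 - del / 4) * ((1 - del / 4) * l) <= _).
  rewrite mulrA ler_wpM2r//.
  have : 0 <= del * (1 - del) by rewrite mulr_ge0; lra.
  have : 0 <= del ^+ 2 by rewrite sqr_ge0.
  have : 0 <= del ^+ 3 * (1 - del) by rewrite mulr_ge0 ?exprn_ge0; lra.
  by nra.
by rewrite ler_wpM2l// mulr_ge0 ?sqr_ge0//; lra.
Qed.

End asymptotics.


Section upper_bound.
Context d (T : measurableType d) (R : realType) (P : probability T R).
Variable A : nat -> R -> set T.
Hypothesis mA : forall (k : nat) (t : R), 0 <= t -> measurable (A k t).
Hypothesis indepA : independent_families P A.
Hypothesis X_fin :
  forall t : R, 0 <= t -> {ae P, forall w, (ecount_events A t w < +oo)%E}.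
Hypothesis EX_fin : forall t : R, 0 <= t -> ('E_P[count_events A t] < +oo)%E.
Hypothesis incA :
  forall (k : nat) (s t : R), 0 < s -> s < t -> A k s `<=` A k t.

Let X := count_events A.
Let b := mean_count P A.
Let a := var_count P A.

(** On a partition of [x, y] into steps of mean at most [B], the centred count
    moves by at most [12 * z * B * 2 ^+ I] with overwhelming probability; between
    partition points monotonicity loses at most [B]. *)
Lemma count_oscillation (B x y : R) j (s : nat -> R) I (z : R) : 1 <= B -> 0 < x ->
  partition_with_increments b B x y j s -> (j <= 4 ^ I)%N ->
  4 * expR (- (z / 2)) <= 1 / 2 ->
  outer_prob_le P
    [set w | (forall t, 0 < t -> (ecount R (events_at A t) w < +oo)%E) /\
       exists2 t, x <= t <= y &
         X x w - b x + 12 * (z * B * 2 ^+ I) + B < X t w - b t]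
    (32 * expR (- z)).
Proof.
move=> B1 x0 ps jI zr.
pose s' m := s (minn m j).
have s'le m n : (m <= n)%N -> s' m <= s' n.
  by move=> mn; apply: partition_le ps _; rewrite /s'; lia.
have s'0 : s' 0%N = x by case: ps => _ <- _ _ _; rewrite /s' min0n.
have s'gt m : 0 < s' m.
  by apply: lt_le_trans x0 _; rewrite -s'0; exact: s'le.
have s'ge m : 0 <= s' m by exact: ltW.
have bE t : 0 <= t -> b t = count_mean P (events_at A t) by exact: mean_countE.
apply: sub_outer_prob_le (maximal_inequality (E := fun m => events_at A (s' m))
  (B := B) _ _ _ _ _ I zr) => //; last first.
- move=> m; rewrite -!bE//; have [mj|jm] := ltnP m j.
    have [_ _ _ _ /(_ m mj) /andP[_]] := ps.
    by rewrite /s' (minn_idPl mj) (minn_idPl (ltnW mj)).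
  by rewrite /s' (minn_idPr jm) (minn_idPr (leqW jm)) subrr; lra.
- by move=> m n mn; apply: independent_increments => //; exact: s'le.
- by move=> m n k mn; apply: events_at_le => //; exact: s'le.
- by move=> m; exact: summable_events_at.
move=> w /= [wfin [t /andP[xt ty] Xt]]; split; first by move=> m; exact: wfin.
have [j0 sx sy _ binc] := ps.
have [k [/andP[_ kj] /andP[kt tk]]] : exists k, (0 <= k < j)%N /\ s k <= t <= s k.+1.
  by apply: between_consecutive => //; rewrite ?sx ?sy.
exists k.+1; first exact: leq_trans jI.
have sk : s' k.+1 = s k.+1 by rewrite /s' (minn_idPl kj).
have sk' : s' k = s k by rewrite /s' (minn_idPl (ltnW kj)).
have sk0 : 0 < s k by rewrite -sk'.
have h1 : X t w <= X (s k.+1) w by apply: count_le => //; lra.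
have h2 : b (s k) <= b t by exact: mean_count_le.
have /andP[_ h3] := binc _ kj.
rewrite s'0 sk -!bE//; last 2 first.
- by rewrite -sk.
- exact: ltW.
by move: Xt h1; rewrite /X /count_events; lra.
Qed.

Variables (c : R) (H : R -> R).
Hypothesis c_gt0 : 0 < c.
Hypothesis a_infty : a t @[t --> +oo] --> +oo.
Hypothesis H_infty : H t @[t --> +oo] --> +oo.
Hypothesis H_small : forall eta, 0 < eta -> \forall t \near +oo, H t <= eta * a t.

Definition ae_eventually_below (e : R) : Prop :=
  {ae P, forall w, \forall t \near +oo,
    X t w - b t <= (1 + e) * Num.sqrt (2 * c * a t * H t)}.

(** At the points [tn n] the Chernoff bound is summable because [c * H (tn n)]
    almost reaches [ln n]. Over the next interval the mean of the increments is at
    most [a (tn n) * n `^ (- kap)], so the oscillation exceeds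
    [del * sqrt (a (tn n))] only with probability [expR (- n `^ (kap / 2))] up to
    constants. The scale itself hardly decreases along the interval. *)
Lemma ae_eventually_below_of_partition (e del B kap : R) (tn : nat -> R) (N : nat)
    (j : nat -> nat) (s : nat -> nat -> R) :
  0 < e <= 1 -> del = e / 12 -> 1 < B -> 0 < kap ->
  (forall n, (N <= n)%N ->
    partition_with_increments b B (tn n) (tn n.+1) (j n) (s n)) ->
  tn n @[n --> \oo] --> +oo ->
  (exists T0, forall s t, T0 <= s -> s <= t ->
     (1 - del) ^+ 2 * (a s * H s) <= a t * H t) ->
  (\forall n \near \oo, (1 - del / 4) * ln n%:R <= c * H (tn n)) ->
  (\forall n \near \oo,
     (b (tn n.+1) - b (tn n)) * expR (kap * ln n%:R) <= a (tn n)) ->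
  ae_eventually_below e.
Proof.
move=> /andP[e0 e1] delE B1 kap0 part tnoo [T0 mono] lnH incr.
have c0 := c_gt0; have d0 : 0 < del by rewrite delE; lra.
have d1 : del <= 1 / 12 by rewrite delE; lra.
have at_tn (Q : R -> Prop) : (\forall t \near +oo, Q t) ->
    \forall n \near \oo, Q (tn n) by move=> hQ; exact: (tnoo _ hQ).
have [I IP] : {I : nat -> nat | forall n, (0 < j n)%N -> (j n <= 4 ^ I n <= 4 * j n)%N}.
  have hI n : {I | (0 < j n)%N -> (j n <= 4 ^ I <= 4 * j n)%N}.
    apply: cid; have [j0|j0] := boolP (0 < j n)%N; last by exists 0%N.
    by have [I hI] := exists_power4 j0; exists I.
  by exists (fun n => projT1 (hI n)) => n; exact: (projT2 (hI n)).
pose r t := Num.sqrt (2 * c * a t * H t).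
pose z n := del / (24 * B) * expR (kap / 2 * ln (n%:R : R)).
(* the Chernoff parameter stays below [eta0], the threshold of
   [chernoff_exponent_le] *)
pose eta0 := ln (1 + del / 4).
have eta0_gt0 : 0 < eta0 by rewrite ln_gt0; lra.
pose eta1 := eta0 ^+ 2 / (8 * c).
have eta1_gt0 : 0 < eta1 by rewrite divr_gt0 ?exprn_gt0 ?mulr_gt0.
have tn_gt0 : \forall n \near \oo, 0 < tn n by move/cvgryPgt : tnoo; exact.
have a_big K : \forall n \near \oo, K <= a (tn n).
  by apply: (at_tn (fun t => K <= a t)); move/cvgryPge : a_infty; exact.
have H_big K : \forall n \near \oo, K <= H (tn n).
  by apply: (at_tn (fun t => K <= H t)); move/cvgryPge : H_infty; exact.
have H_le : \forall n \near \oo, H (tn n) <= eta1 * a (tn n).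
  by apply: (at_tn (fun t => H t <= eta1 * a t)); exact: H_small.
have z_big : \forall n \near \oo, 2 * ln (n%:R : R) + 32 <= z n.
  by apply: near_infty_ln_le_expR; rewrite divr_gt0// mulr_gt0//; lra.
pose S1 n := [set w | ((count_mean P (events_at A (tn n)) + (1 + del) * r (tn n))%:E
  < ecount R (events_at A (tn n)) w)%E].
have S1_bound : \forall n \near \oo,
    outer_prob_le P (S1 n) (expR (- ((1 + del / 4) * ln n%:R))).
  near=> n.
  have tn0 : 0 < tn n by near: n.
  have an1 : 1 <= a (tn n) by near: n; exact: a_big.
  have Hn0 : 0 <= H (tn n) by near: n; exact: H_big.
  have Hn_le : H (tn n) <= eta1 * a (tn n) by near: n.
  have l0 : 0 <= ln (n%:R : R) by near: n; exact: near_infty_ln.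
  have lnHn : (1 - del / 4) * ln n%:R <= c * H (tn n) by near: n.
  set an := a (tn n) in an1 Hn_le *; set Hn := H (tn n) in Hn0 Hn_le lnHn *.
  have an0 : 0 < an by lra.
  pose x := (1 + del) * r (tn n); pose th := x / an.
  have x0 : 0 <= x by rewrite mulr_ge0 ?sqrtr_ge0//; lra.
  have th0 : 0 <= th by rewrite divr_ge0// ltW.
  have x2 : x ^+ 2 = (1 + del) ^+ 2 * (2 * (c * Hn) * an).
    rewrite exprMn sqr_sqrtr; first by rewrite -/an -/Hn; ring.
    by rewrite -/an -/Hn !mulr_ge0// ltW.
  have th_le : th <= eta0.
    rewrite -(@ler_pXn2r _ 2) ?nnegrE ?(ltW eta0_gt0)//.
    rewrite /th expr_div_n x2 ler_pdivrMr ?exprn_gt0//.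
    apply: le_trans (_ : 4 * (2 * (c * Hn) * an) <= _).
      by rewrite ler_wpM2r ?mulr_ge0 ?(ltW c0) ?(ltW an0)//; nra.
    have -> : eta0 ^+ 2 * an ^+ 2 = 4 * (2 * (c * (eta1 * an)) * an).
      by rewrite /eta1; field; rewrite gt_eqF.
    by rewrite ler_pM2l// ler_pM2r// ler_pM2l// ler_pM2l.
  have eth : expR th <= 1 + del / 4.
    by rewrite -[leRHS]lnK ?ler_expR// posrE; lra.
  have tn0' := ltW tn0.
  have VE : total_var P (events_at A (tn n)) <= an.
    by rewrite -(var_countE mA indepA X_fin EX_fin tn0').
  apply: outer_prob_le_trans (count_upper_tail _ _ x th0 VE) _.
  - exact: independent_events_at.
  - exact: summable_events_at.
  rewrite ler_expR; apply: (@chernoff_exponent_le _ an (c * Hn) del) => //.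
  - by rewrite mulr_ge0// ltW.
  - by lra.
pose S2 n := [set w | (forall t, 0 < t -> (ecount R (events_at A t) w < +oo)%E) /\
  exists2 t, tn n <= t <= tn n.+1 &
    X (tn n) w - b (tn n) + 12 * (z n * B * 2 ^+ I n) + B < X t w - b t].
have S2_bound : \forall n \near \oo,
    outer_prob_le P (S2 n) (expR (- ((1 + 1) * ln n%:R))).
  near=> n.
  have Nn : (N <= n)%N by near: n; exact: nbhs_infty_ge.
  have tn0 : 0 < tn n by near: n.
  have zn : 2 * ln (n%:R : R) + 32 <= z n by near: n.
  have l0 : 0 <= ln (n%:R : R) by near: n; exact: near_infty_ln.
  have pn := part n Nn; have [j0 _ _ _ _] := pn.
  have /andP[jI _] := IP n j0.
  have e16 : expR (- (z n / 2)) <= 17^-1.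
    rewrite expRN lef_pV2 ?posrE ?expR_gt0//.
    by have := expR_ge1Dx (z n / 2); lra.
  apply: outer_prob_le_trans (count_oscillation (ltW B1) tn0 pn jI _) _; first by lra.
  apply: le_trans (_ : 32 * (expR (- (2 * ln n%:R)) * expR (- 32)) <= _).
    by rewrite ler_pM2l// -expRD ler_expR; lra.
  have e32 : expR (- 32) <= 32^-1 :> R.
    rewrite expRN lef_pV2 ?posrE ?expR_gt0//.
    by have := expR_ge1Dx (32 : R); lra.
  rewrite (_ : 1 + 1 = 2 :> R)//.
  by have := expR_gt0 (- (2 * ln (n%:R : R))); nra.
have d4 : 0 < del / 4 by lra.
have S1ae := ae_eventually_not d4 S1_bound.
have S2ae := ae_eventually_not (ltr01 : 0 < 1 :> R) S2_bound.
have good : \forall n \near \oo, [/\ 0 < tn n, (N <= n)%N, T0 <= tn n,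
    (B / del) ^+ 2 <= a (tn n) & (2 * c)^-1 <= H (tn n)] /\
    (b (tn n.+1) - b (tn n)) * expR (kap * ln n%:R) <= a (tn n).
  near=> n; split; last by near: n.
  split; near: n => //.
  - exact: nbhs_infty_ge.
  - by move/cvgryPge : tnoo; exact.
have finae := ae_count_fin X_fin incA.
move: S1ae S2ae finae; apply: filterS3 => w [M1 _ nS1] [M2 _ nS2] wfin.
case: good => M3 _ gM; pose M := maxn M1 (maxn M2 M3).
exists (tn M); split; first exact: num_real.
move=> t /= Mt.
have [m [Mm tm]] : exists m, (M < m)%N /\ t <= tn m.
  move/cvgryPge : tnoo => /(_ t) [M4 _ hM4]; exists (maxn M.+1 M4).
  by split; [exact: leq_maxl|apply: hM4; exact: leq_maxr].
have [n [/andP[Mn nm] /andP[nt tn1]]] := between_consecutive Mm (ltW Mt) tm.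
move: Mn; rewrite /M !geq_max => /and3P[M1n M2n M3n].
have {}nS1 := nS1 n M1n; have {}nS2 := nS2 n M2n.
have [[tn0 Nn T0n aB H1] bn] := gM n M3n.
have t0 : 0 < t by lra.
have [j0 _ sy _ _] := part n Nn.
have /andP[jI Ij] := IP n j0.
set an := a (tn n) in aB bn *; set rn := r (tn n).
have an0 : 0 <= an by apply: le_trans aB; exact: sqr_ge0.
have B0 : 0 < B by lra.
(* the partition has at most [a (tn n) * n `^ (- kap)] points, since each step
   has mean at least [1] *)
have pow : 2 ^+ I n * expR (kap / 2 * ln (n%:R : R)) <= 2 * Num.sqrt an.
  rewrite -(@ler_pXn2r _ 2) ?nnegrE ?mulr_ge0 ?exprn_ge0 ?expR_ge0 ?sqrtr_ge0//.
  rewrite !exprMn sqr_sqrtr// -expRM_natl -exprM mulnC exprM.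
  rewrite (_ : 2%:R * (kap / 2 * ln n%:R) = kap * ln n%:R); last by field.
  apply: le_trans (_ : 4 * (j n)%:R * expR (kap * ln n%:R) <= _).
    by rewrite ler_wpM2r ?expR_ge0// (_ : 2 ^+ 2 = 4%:R :> R) -?natrX -?natrM ?ler_nat.
  have := partition_increments (part n Nn) (leqnn (j n)); rewrite sy => /andP[jb _].
  have := ler_wpM2r (expR_ge0 (kap * ln n%:R)) jb.
  by rewrite -/an; lra.
have osc : 12 * (z n * B * 2 ^+ I n) <= del * Num.sqrt an.
  have -> : 12 * (z n * B * 2 ^+ I n) =
      del / 2 * (2 ^+ I n * expR (kap / 2 * ln (n%:R : R))).
    by rewrite /z; field; rewrite gt_eqF.
  by have := ler_wpM2l (ltW d0) pow; lra.
have Yn : X (tn n) w - b (tn n) <= (1 + del) * rn.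
  move/negP : nS1; rewrite -leNgt -(mean_countE mA X_fin (ltW tn0)).
  have wf : (X (tn n) w)%:E = ecount R (events_at A (tn n)) w.
    by rewrite fineK// ge0_fin_numE ?wfin// ecount_ge0.
  by rewrite -wf lee_fin -/b -/rn; lra.
have Yt : X t w - b t <= X (tn n) w - b (tn n) + 12 * (z n * B * 2 ^+ I n) + B.
  rewrite leNgt; apply/negP => Yt; apply: nS2; split=> //.
  by exists t => //; rewrite nt tn1.
have sq_rn : Num.sqrt an <= rn.
  rewrite /rn /r -/an ler_wsqrtr//.
  rewrite -[leLHS]mulr1 (_ : 2 * c * an * H (tn n) = an * (2 * c * H (tn n))); last by ring.
  by rewrite ler_wpM2l// -ler_pdivrMl ?mulr1// mulr_gt0.
have B_rn : B <= del * rn.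
  rewrite -ler_pdivrMl// mulrC; apply: le_trans sq_rn.
  have Bd : 0 <= B / del by rewrite divr_ge0 ?ltW.
  by rewrite -(ger0_norm Bd) -sqrtr_sqr ler_wsqrtr.
have r_le : (1 - del) * rn <= r t.
  have d1' : 0 <= 1 - del by lra.
  have -> : (1 - del) * rn = Num.sqrt ((1 - del) ^+ 2 * (2 * c * an * H (tn n))).
    by rewrite sqrtrM ?sqr_ge0// sqrtr_sqr ger0_norm.
  rewrite ler_wsqrtr//.
  have c20 : 0 <= 2 * c by rewrite mulr_ge0// ltW.
  have := ler_wpM2l c20 (mono _ _ T0n nt); rewrite -/an.
  by congr (_ <= _); ring.
have rn0 : 0 <= rn by exact: sqrtr_ge0.
have dsq := ler_wpM2l (ltW d0) sq_rn.
apply: le_trans (_ : (1 + 3 * del) * rn <= _); first by lra.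
have : (1 + e) * ((1 - del) * rn) <= (1 + e) * r t by rewrite ler_wpM2l//; lra.
apply: le_trans; rewrite mulrA ler_wpM2r//.
by rewrite delE; nra.
Unshelve. all: by end_near.
Qed.

End upper_bound.

(** * The lower bound *)

Section removal.
Context d (T : measurableType d) (R : realType) (P : probability T R).
Implicit Types (E : nat -> set T) (J : seq nat).

Definition remove_events E J (k : nat) : set T := if k \in J then set0 else E k.

Lemma prob_set0 : prob P set0 = 0.
Proof. by rewrite /prob measure0. Qed.

Lemma independent_remove_events E J : independent_events P E ->
  independent_events P (remove_events E J).
Proof.
move=> indE; have := independent_events_restrict [set k | k \notin J] indE.
congr (independent_events P _); apply/funext => k; rewrite /remove_events.
by case: (boolP (k \in J)) => kJ; [rewrite memNset//=; exact/negP/negPn|rewrite mem_set].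
Qed.

Lemma summable_remove_events E J : summable_events P E ->
  summable_events P (remove_events E J).
Proof.
move=> sE; have [mE _] := sE; apply: summable_events_sub sE.
- by move=> k; rewrite /remove_events; case: ifP.
- by move=> k w; rewrite /remove_events; case: ifP.
Qed.

Lemma total_var_remove E J : summable_events P E -> uniq J ->
  total_var P E = count_var P E J + total_var P (remove_events E J).
Proof.
move=> sE uJ; have [mE _] := sE; have sR := summable_remove_events J sE.
apply: EFin_inj; rewrite EFinD -!total_varE// (nneseries_remove _ uJ); last first.
  by move=> k; have /andP[p0 p1] := prob_bounds P (mE k); rewrite mulr_ge0// subr_ge0.
congr (_ + _)%E; apply: eq_eseriesr => k _; rewrite /remove_events.
by case: ifP => // _; rewrite prob_set0 mul0r.
Qed.

Lemma count_mean_remove E J : summable_events P E -> uniq J ->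
  count_mean P E = \sum_(k <- J) prob P (E k) + count_mean P (remove_events E J).
Proof.
move=> sE uJ; have [mE _] := sE; have sR := summable_remove_events J sE.
apply: EFin_inj; rewrite EFinD -!count_meanE// (nneseries_remove _ uJ); last first.
  by move=> k; have /andP[p0 p1] := prob_bounds P (mE k).
congr (_ + _)%E; apply: eq_eseriesr => k _; rewrite /remove_events.
by case: ifP => // _; rewrite prob_set0.
Qed.

Lemma ecount_remove E J w : uniq J ->
  ecount R E w =
  ((\sum_(k <- J) \1_(E k) w)%:E + ecount R (remove_events E J) w)%E.
Proof.
move=> uJ; rewrite /ecount (nneseries_remove _ uJ); last by move=> k; rewrite indicE.
congr (_ + _)%E; apply: eq_eseriesr => k _; rewrite /remove_events.
by case: ifP => // _; rewrite indic0.
Qed.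

Lemma count_var_le_total E J : summable_events P E -> uniq J ->
  count_var P E J <= total_var P E.
Proof.
move=> sE uJ; rewrite (total_var_remove sE uJ) lerDl.
exact: total_var_ge0 (summable_remove_events J sE).
Qed.

(** A selection of events is replaced by finitely many of them at an arbitrarily
    small cost in variance, so that blocks become finite. *)
Lemma finite_selection E (S : set nat) (x : R) : summable_events P E ->
  x < total_var P (fun k => if k \in S then E k else set0) ->
  exists J, [/\ uniq J, {in J, forall k, k \in S} & x < count_var P E J].
Proof.
move=> sE; have [mE _] := sE.
have sS : summable_events P (fun k => if k \in S then E k else set0).
  apply: summable_events_sub sE; first by move=> k; case: ifP.
  by move=> k w; case: ifP.
move=> /(partial_var_gt sS)[n xn].
exists [seq k <- index_iota 0 n | k \in S]; split.
- by rewrite filter_uniq// iota_uniq.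
- by move=> k; rewrite mem_filter => /andP[].
- apply: lt_le_trans xn _; rewrite /count_var /bernoulli_var big_filter.
  rewrite [leRHS]big_mkcond/=; apply: ler_sum => k _; case: ifP => // kS.
  by rewrite prob_set0 mul0r.
Qed.

End removal.

Section lower_bound.
Context d (T : measurableType d) (R : realType) (P : probability T R).
Variable A : nat -> R -> set T.
Hypothesis mA : forall (k : nat) (t : R), 0 <= t -> measurable (A k t).
Hypothesis indepA : independent_families P A.
Hypothesis X_fin :
  forall t : R, 0 <= t -> {ae P, forall w, (ecount_events A t w < +oo)%E}.
Hypothesis EX_fin : forall t : R, 0 <= t -> ('E_P[count_events A t] < +oo)%E.
Hypothesis incA :
  forall (k : nat) (s t : R), 0 < s -> s < t -> A k s `<=` A k t.

Let X := count_events A.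
Let b := mean_count P A.
Let a := var_count P A.

Variables (c : R) (H : R -> R).
Hypothesis c_gt0 : 0 < c.
Hypothesis a_infty : a t @[t --> +oo] --> +oo.
Hypothesis H_infty : H t @[t --> +oo] --> +oo.
Hypothesis H_small : forall eta, 0 < eta -> \forall t \near +oo, H t <= eta * a t.

Definition ae_frequently_above (e : R) : Prop :=
  {ae P, forall w, forall t0, exists2 t, t0 <= t &
    (1 - e) * Num.sqrt (2 * c * a t * H t) <= X t w - b t}.

(** The selected sets carry the proportion [1 - (e / 32) ^+ 2] of the variance and
    are disjoint, so their finite parts give independent events of probability
    at least [1 / n], which occur infinitely often. The discarded events have
    such a small variance that their centred count is eventually above
    [- e / 8] times the scale. *)
Lemma ae_frequently_above_of_blocks (e : R) (tn : nat -> R) (S : nat -> set nat) (N : nat) :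
  0 < e <= 1 / 2 ->
  (forall n, (N <= n)%N -> 0 < tn n) ->
  trivIset [set n | (N <= n)%N] S ->
  tn n @[n --> \oo] --> +oo ->
  (\forall n \near \oo,
     (1 - (e / 32) ^+ 2) * a (tn n) <= var_count_in P A (S n) (tn n)) ->
  (\forall n \near \oo, c * H (tn n) <= (1 + e / 40) * ln n%:R) ->
  (\forall n \near \oo, ln n%:R / 2 <= c * H (tn n)) ->
  ae_frequently_above e.
Proof.
move=> /andP[e0 e1] tn_gt0 dS tnoo S_big H_le H_ge.
pose sig := (e / 32) ^+ 2; pose eps := e / 40.
have sig0 : 0 < sig by rewrite exprn_gt0 ?divr_gt0.
have eps0 : 0 < eps by rewrite divr_gt0.
have sig1 : sig <= 1 / 64 by rewrite /sig; nra.
have at_tn (Q : R -> Prop) : (\forall t \near +oo, Q t) ->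
    \forall n \near \oo, Q (tn n) by move=> hQ; exact: (tnoo _ hQ).
have a_big K : \forall n \near \oo, K <= a (tn n).
  by apply: (at_tn (fun t => K <= a t)); move/cvgryPge : a_infty; exact.
have H_big K : \forall n \near \oo, K <= H (tn n).
  by apply: (at_tn (fun t => K <= H t)); move/cvgryPge : H_infty; exact.
have H_le_a eta : 0 < eta -> \forall n \near \oo, H (tn n) <= eta * a (tn n).
  by move=> eta0; apply: (at_tn (fun t => H t <= eta * a t)); exact: H_small.
pose r n := Num.sqrt (2 * c * a (tn n) * H (tn n)).
have r0 n : 0 <= r n by exact: sqrtr_ge0.
have sE n : (N <= n)%N -> summable_events P (events_at A (tn n)).
  by move=> Nn; apply: summable_events_at => //; apply/ltW/tn_gt0.
have aE n : (N <= n)%N -> a (tn n) = total_var P (events_at A (tn n)).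
  by move=> Nn; apply: var_countE => //; apply/ltW/tn_gt0.
(* a finite part [J n] of the selected set keeps almost all of its variance;
   it is empty where the selection is not controlled *)
have [J JP] : {J : nat -> seq nat | forall n, [/\ uniq (J n),
    {in J n, forall k, (N <= n)%N /\ k \in S n} &
    (N <= n)%N -> 0 < a (tn n) ->
    (1 - sig) * a (tn n) <= var_count_in P A (S n) (tn n) ->
    (1 - 2 * sig) * a (tn n) <= count_var P (events_at A (tn n)) (J n)]}.
  have hJ n : {J : seq nat | [/\ uniq J,
    {in J, forall k, (N <= n)%N /\ k \in S n} &
    (N <= n)%N -> 0 < a (tn n) ->
    (1 - sig) * a (tn n) <= var_count_in P A (S n) (tn n) ->
    (1 - 2 * sig) * a (tn n) <= count_var P (events_at A (tn n)) J]}.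
    apply: cid.
    have [[Nn an0 big]|h] := pselect [/\ (N <= n)%N, 0 < a (tn n) &
        (1 - sig) * a (tn n) <= var_count_in P A (S n) (tn n)]; last first.
      by exists [::]; split=> // Nn an0 big; exfalso; apply: h.
    have [|J [uJ JS Jx]] := @finite_selection _ _ _ P (events_at A (tn n)) (S n)
        ((1 - 2 * sig) * a (tn n)) (sE n Nn).
      have tn0 := ltW (tn_gt0 n Nn).
      rewrite -[X in _ < X](var_count_inE mA indepA X_fin EX_fin (S n) tn0).
      by apply: lt_le_trans big; rewrite ltr_pM2r//; lra.
    by exists J; split=> // [k kJ|_ _ _]; [split=> //; exact: JS|exact: ltW].
  by exists (fun n => projT1 (hJ n)) => n; exact: (projT2 (hJ n)).
have uJ n : uniq (J n) by case: (JP n).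
have dJ n n' k : (0 <= n < n')%N -> k \in J n -> k \notin J n'.
  move=> nn' kJ; apply/negP => kJ'.
  have [_ /(_ k kJ)[Nn kS] _] := JP n; have [_ /(_ k kJ')[Nn' kS'] _] := JP n'.
  have : n = n'.
    apply: dS => //; exists k; split; [exact: set_mem kS|exact: set_mem kS'].
  by move=> nE; move: nn'; rewrite nE ltnn andbF.
have [f fP] : {f : nat -> R | forall k, 0 <= f k /\ forall n, k \in J n -> f k = tn n}.
  have hf k : {t : R | 0 <= t /\ forall n, k \in J n -> t = tn n}.
    apply: cid; have [[n kn]|h] := pselect (exists n, k \in J n); last first.
      by exists 0; split=> // n kn; exfalso; apply: h; exists n.
    exists (tn n); split.
      by have [_ /(_ k kn)[Nn _] _] := JP n; exact/ltW/tn_gt0.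
    move=> n' kn'; have [nn'|nn'|->//] := ltngtP n n'.
      by have := dJ n n' k nn' kn; rewrite kn'.
    by have := dJ n' n k nn' kn'; rewrite kn.
  by exists (fun k => projT1 (hf k)) => k; exact: (projT2 (hf k)).
(* each event belongs to at most one block, and is sampled at the time of it *)
pose E k := A k (f k).
have indE : independent_events P E.
  by apply: independent_choice => // k; case: (fP k).
have EE n k : k \in J n -> E k = events_at A (tn n) k.
  by move=> kJ; rewrite /E; case: (fP k) => _ /(_ n kJ) ->.
have ccE n w : centred_count P E (J n) w = centred_count P (events_at A (tn n)) (J n) w.
  by apply: eq_big_seq => k kJ; rewrite (EE n).
have cvE n : count_var P E (J n) = count_var P (events_at A (tn n)) (J n).
  by apply: eq_big_seq => k kJ; rewrite (EE n).
pose v n := count_var P (events_at A (tn n)) (J n).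
have v_le n : (N <= n)%N -> v n <= a (tn n).
  by move=> Nn; rewrite aE//; apply: count_var_le_total => //; exact: sE.
have v_ge : \forall n \near \oo, (1 - 2 * sig) * a (tn n) <= v n.
  near=> n; have [_ _] := JP n; apply.
  - by near: n; exact: nbhs_infty_ge.
  - by apply: lt_le_trans ltr01 _; near: n; exact: a_big.
  - by near: n.
have r_sq n : 0 <= a (tn n) -> 0 <= H (tn n) ->
    r n ^+ 2 = 2 * c * a (tn n) * H (tn n).
  by move=> an0 Hn0; rewrite sqr_sqrtr// !mulr_ge0// ltW.
have r_small eta : 0 < eta -> \forall n \near \oo, r n <= eta * a (tn n).
  move=> eta0; have c20 : 0 < 2 * c by rewrite mulr_gt0.
  have eta1 : 0 < eta ^+ 2 / (2 * c) by rewrite divr_gt0 ?exprn_gt0.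
  apply: filterS3 (a_big 0) (H_big 0) (H_le_a _ eta1) => n an0 Hn0 Hn.
  rewrite -(@ler_pXn2r _ 2) ?nnegrE ?r0 ?mulr_ge0 ?(ltW eta0)// r_sq//.
  have := ler_wpM2l (mulr_ge0 (ltW c20) an0) Hn.
  have -> : 2 * c * a (tn n) * (eta ^+ 2 / (2 * c) * a (tn n)) = (eta * a (tn n)) ^+ 2.
    by field; rewrite gt_eqF.
  by [].
pose u n := (1 - e / 2) * r n.
pose B n := [set z | (1 - eps) * u n < z].
have blocks : \forall n \near \oo,
    n%:R^-1 <= prob P (centred_count P E (J n) @^-1` B n).
  near=> n.
  have Nn : (N <= n)%N by near: n; exact: nbhs_infty_ge.
  have n1 : (1 <= n)%N by near: n; exact: nbhs_infty_ge.
  have an1 : 1 <= a (tn n) by near: n; exact: a_big.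
  have vn : (1 - 2 * sig) * a (tn n) <= v n by near: n.
  have Hn_le : c * H (tn n) <= (1 + e / 40) * ln n%:R by near: n.
  have Hn_big : 8 / eps ^+ 2 / c <= H (tn n) by near: n; exact: H_big.
  have rn : r n <= eps ^+ 2 / 80 * a (tn n).
    by near: n; apply: r_small; rewrite divr_gt0 ?exprn_gt0 ?ltr0n.
  have c0 := c_gt0; have vn' := v_le n Nn; have rn0 := r0 n.
  have Hn0 : 0 < H (tn n).
    by apply: lt_le_trans Hn_big; rewrite divr_gt0// divr_gt0 ?exprn_gt0.
  have cH8 : 8 / eps ^+ 2 <= c * H (tn n) by rewrite [leRHS]mulrC -ler_pdivrMr.
  have an0 : 0 < a (tn n) by lra.
  have v_half : a (tn n) / 2 <= v n by nra.
  have v0 : 0 < v n by lra.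
  have r2 := r_sq n (ltW an0) (ltW Hn0).
  have rn_gt0 : 0 < r n.
    by rewrite lt_neqAle rn0 andbT eq_sym -sqrf_eq0 r2 !mulf_neq0// gt_eqF.
  have u0 : 0 < u n by rewrite mulr_gt0//; lra.
  have u_le : u n <= r n by rewrite /u ler_piMl//; lra.
  have u2 : u n ^+ 2 = (1 - e / 2) ^+ 2 * (2 * a (tn n) * (c * H (tn n))).
    by rewrite exprMn r2; ring.
  have eps01 : 0 < eps <= 1 by rewrite /eps; lra.
  have hv : 0 < count_var P E (J n) by rewrite cvE.
  apply: le_trans (centred_count_tail_ge indE (uJ n) eps01 hv u0 _ _).
  - rewrite cvE -/(v n).
    have -> : n%:R^-1 = expR (- ln n%:R) :> R by rewrite expRN lnK// posrE ltr0n.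
    rewrite ler_expR lerN2.
    have uv : u n ^+ 2 / v n <= (1 - e / 2) ^+ 2 * (2 * (c * H (tn n))) / (1 - 2 * sig).
      rewrite ler_pdivrMr// u2 [leRHS]mulrAC ler_pdivlMr; last by lra.
      set w2 := (1 - e / 2) ^+ 2; set h := c * H (tn n).
      have : 0 <= w2 * (2 * h) by rewrite mulr_ge0 ?sqr_ge0// mulr_ge0// mulr_ge0// ltW.
      by move=> /ler_wpM2l/(_ _ _ vn); lra.
    apply: le_trans (ler_wpM2l _ uv) _; first by lra.
    rewrite [leLHS]mulrA ler_pdivrMr; last by lra.
    have ee : (1 + e / 10) * (1 + e / 40) * (1 - e / 2) ^+ 2 <= 1 - 2 * sig.
      by rewrite /sig; nra.
    have l0 : 0 <= ln (n%:R : R) by rewrite ln_ge0// ler1n.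
    have := ler_wpM2l l0 ee.
    have w0 : 0 <= (1 + e / 10) * (1 - e / 2) ^+ 2.
      by rewrite mulr_ge0 ?sqr_ge0//; lra.
    have := ler_wpM2l w0 Hn_le.
    by rewrite /eps; lra.
  - rewrite cvE -/(v n) ler_pdivrMr//.
    have : eps ^+ 2 / 40 * (a (tn n) / 2) <= eps ^+ 2 / 40 * v n.
      by rewrite ler_wpM2l// divr_ge0 ?sqr_ge0.
    by lra.
  - rewrite cvE -/(v n) ler_pdivlMr// u2.
    have w1 : 1 / 2 <= (1 - e / 2) ^+ 2 by nra.
    apply: le_trans (_ : c * H (tn n) * a (tn n) <= _).
      apply: ler_pM => //; first by rewrite divr_ge0 ?sqr_ge0.
      exact: ltW.
    have : 0 <= c * H (tn n) * a (tn n) by rewrite !mulr_ge0// ltW.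
    by move=> h0; have := ler_wpM2l h0 w1; lra.
have io := ae_infinitely_often indE uJ dJ blocks.
pose S3 n := [set w | (ecount R (remove_events (events_at A (tn n)) (J n)) w <
  (count_mean P (remove_events (events_at A (tn n)) (J n)) - e / 8 * r n - 1)%:E)%E].
have S3_bound : \forall n \near \oo,
    outer_prob_le P (S3 n) (expR (- ((1 + 1) * ln n%:R))).
  near=> n.
  have Nn : (N <= n)%N by near: n; exact: nbhs_infty_ge.
  have an1 : 1 <= a (tn n) by near: n; exact: a_big.
  have vn : (1 - 2 * sig) * a (tn n) <= v n by near: n.
  have Hn_ge : ln n%:R / 2 <= c * H (tn n) by near: n.
  have Hn0 : 0 <= H (tn n) by near: n; exact: H_big.
  have rn : r n <= 16 * sig / (3 * e) * a (tn n).
    by near: n; apply: r_small; apply: divr_gt0; apply: mulr_gt0.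
  have an0 : 0 < a (tn n) by lra.
  have sER := summable_remove_events (J n) (sE n Nn).
  have tn0 := ltW (tn_gt0 n Nn).
  have indER := independent_remove_events (J n) (independent_events_at mA indepA tn0).
  pose V := 2 * sig * a (tn n); have V0 : 0 < V by apply: mulr_gt0 => //; apply: mulr_gt0.
  have VE : total_var P (remove_events (events_at A (tn n)) (J n)) <= V.
    have := total_var_remove (sE n Nn) (uJ n); rewrite -aE// -/(v n) /V; lra.
  pose y := e / 8 * r n; pose th := y / V.
  have e8 : 0 <= e / 8 by lra.
  have th0 : 0 <= th by rewrite divr_ge0 ?(ltW V0)// mulr_ge0.
  have th1 : th <= 1 / 3.
    rewrite ler_pdivrMr// /y /V.
    have := ler_wpM2l e8 rn; congr (_ <= _); field.
    by rewrite gt_eqF.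
  have eth : expR th <= 3 / 2.
    have : 2 / 3 <= expR (- th) by apply: le_trans (onem_le_expRN _); lra.
    by rewrite expRN -[2 / 3]invf_div lef_pV2// posrE ?expR_gt0.
  apply: outer_prob_le_trans (count_lower_tail indER sER y th0 VE) _.
  have thy : th * y = 16 * (c * H (tn n)).
    rewrite /th (_ : y / V * y = y ^+ 2 / V); last by field; rewrite gt_eqF.
    rewrite /y exprMn r_sq ?(ltW an0)// /V /sig; field.
    by rewrite !gt_eqF.
  have thV : th ^+ 2 / 2 * V = 8 * (c * H (tn n)).
    rewrite (_ : _ * V = th * y / 2); last by rewrite /th; field; rewrite gt_eqF.
    by rewrite thy; field.
  rewrite ler_expR thy thV.
  have cH0 : 0 <= 8 * (c * H (tn n)) by rewrite mulr_ge0// mulr_ge0// ltW.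
  by have := ler_wpM2l cH0 eth; lra.
have S3ae := ae_eventually_not (ltr01 : 0 < 1 :> R) S3_bound.
have finae := ae_count_fin X_fin incA.
have r_big : \forall n \near \oo, 3 / e <= r n.
  have c20 : 0 < 2 * c by rewrite mulr_gt0.
  apply: filterS2 (a_big 1) (H_big ((3 / e) ^+ 2 / (2 * c))) => n an1.
  rewrite ler_pdivrMr// => Hn.
  have e3 : 0 <= 3 / e by rewrite divr_ge0// ltW.
  have Hn0 : 0 <= H (tn n) * (2 * c) by apply: le_trans Hn; exact: sqr_ge0.
  rewrite -(ger0_norm e3) -sqrtr_sqr ler_wsqrtr//; apply: le_trans Hn _.
  by have := ler_wpM2l Hn0 an1; lra.
move: io S3ae finae; apply: filterS3 => w io [M1 _ nS3] wfin t0.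
have [M2 _ hM2] : \forall n \near \oo, [/\ (N <= n)%N, t0 <= tn n & 3 / e <= r n].
  near=> n; split; near: n => //; first exact: nbhs_infty_ge.
  by move/cvgryPge : tnoo; exact.
have [n Mn Bn] := io (maxn M1 M2); exists (tn n).
  by have [] := hM2 n (leq_trans (leq_maxr _ _) Mn).
have [Nn _ rn] := hM2 n (leq_trans (leq_maxr _ _) Mn).
have {}nS3 := nS3 n (leq_trans (leq_maxl _ _) Mn).
have tn0 := tn_gt0 n Nn.
rewrite -/(r n).
have bE : b (tn n) = count_mean P (events_at A (tn n)).
  by apply: mean_countE => //; exact: ltW.
have := wfin _ tn0; move: nS3 Bn; rewrite /S3 /B/= ccE bE.
rewrite (count_mean_remove (sE n Nn) (uJ n)) /X /count_events.
rewrite (_ : ecount_events A (tn n) w = ecount R (events_at A (tn n)) w)//.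
rewrite (ecount_remove _ (events_at A (tn n)) w (uJ n)).
have := ecount_ge0 R (remove_events (events_at A (tn n)) (J n)) w.
rewrite /centred_count big_split/= sumrN.
case: (ecount R (remove_events _ _) w) => [z| |]//= _ /negP.
rewrite -leNgt lee_fin => zy Bz _.
have re : 3 <= e * r n by rewrite [leRHS]mulrC -ler_pdivrMr.
have : 0 <= e * r n by lra.
have : 0 <= e ^+ 2 * r n by rewrite mulr_ge0 ?sqr_ge0.
by move: Bz; rewrite /u /eps; lra.
Unshelve. all: by end_near.
Qed.

End lower_bound.

(** * Asymptotic monotonicity and the limit superior *)

Section limit_superior.
Context {R : realType}.

Lemma limf_esup_eq1 (g r : R -> R) :
  (\forall t \near +oo, 0 < r t) ->
  (forall e, 0 < e <= 1 -> \forall t \near +oo, g t <= (1 + e) * r t) ->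
  (forall e, 0 < e <= 1 / 2 -> forall t0, exists2 t, t0 <= t & (1 - e) * r t <= g t) ->
  limf_esup (fun t => (g t / r t)%:E) +oo_R = 1%E.
Proof.
move=> r0 up low; apply/eqP; rewrite eq_le; apply/andP; split.
  apply/lee_addgt0Pr => e e0; pose e' := Num.min e 1.
  have e'01 : 0 < e' <= 1 by rewrite lt_min e0 ltr01 ge_min lexx orbT.
  have e'e : e' <= e by rewrite ge_min lexx.
  pose V := [set t | g t / r t <= 1 + e'].
  have VF : +oo_R V.
    apply: filterS2 r0 (up _ e'01) => t rt gt.
    by rewrite /V/= ler_pdivrMr.
  apply: le_trans (_ : (1 + e')%:E <= _)%E; last by rewrite -EFinD lee_fin lerD2l.
  apply: ge_ereal_inf; exists (ereal_sup [set (g t / r t)%:E | t in V]).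
    by exists V.
  by apply: ge_ereal_sup => _ [t Vt <-]; rewrite lee_fin.
apply: le_ereal_inf_tmp => _ [V VF <-].
apply/lee_addgt0Pr => e e0; pose e' := Num.min e (1 / 2).
have e'01 : 0 < e' <= 1 / 2 by rewrite lt_min e0 ge_min lexx orbT andbT; lra.
have e'e : e' <= e by rewrite ge_min lexx.
have [M [_ VM]] : +oo_R (V `&` [set t | 0 < r t]) by apply: filterI.
have [t Mt gt] := low _ e'01 (M + 1).
have [|Vt rt] := VM t; first by lra.
apply: le_trans (_ : (g t / r t)%:E + e%:E <= _)%E; last first.
  by apply: leeD => //; apply: ereal_sup_ubound; exists t.
rewrite -EFinD lee_fin.
have : 1 - e' <= g t / r t by rewrite ler_pdivlMr.
by lra.
Qed.

End limit_superior.

Section asymptotic_monotonicity.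
Context {R : realType}.
Implicit Types (f g : R -> R).

(** What equivalence with a nondecreasing function leaves of monotonicity; in this
    form it passes to logarithms and products. *)
Definition almost_nondecreasing f : Prop :=
  forall e, 0 < e < 1 ->
    exists T0, forall s t, T0 <= s -> s <= t -> (1 - e) * f s <= f t.

Lemma near_pinfty_exists (Q : R -> Prop) : (\forall t \near +oo, Q t) ->
  exists M, forall t, M <= t -> Q t.
Proof.
by move=> [M [_ MQ]]; exists (M + 1) => t Mt; apply: MQ; lra.
Qed.

Lemma near_pinfty_exists2 (Q1 Q2 : R -> Prop) :
  (\forall t \near +oo, Q1 t) -> (\forall t \near +oo, Q2 t) ->
  exists M, forall t, M <= t -> Q1 t /\ Q2 t.
Proof.
by move=> h1 h2; apply: near_pinfty_exists; apply: filterS2 h1 h2 => t; split.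
Qed.

Lemma almost_nondecreasing_equiv f f0 : f t @[t --> +oo] --> +oo ->
  {in `[0, +oo[ &, {homo f0 : s t / s <= t}} ->
  f t / f0 t @[t --> +oo] --> (1 : R) -> almost_nondecreasing f.
Proof.
move=> foo f0m fe e /andP[e0 e1].
have e3 : 0 < e / 3 by lra.
have [M MP] : exists M, forall t, M <= t ->
    0 < f t /\ `|1 - f t / f0 t| < e / 3.
  apply: near_pinfty_exists2.
  - by move/cvgryPgt : foo; exact.
  - by move/cvgrPdist_lt : fe; apply.
have bd t : M <= t -> 0 < f0 t /\ (1 - e / 3) * f0 t <= f t <= (1 + e / 3) * f0 t.
  move=> /MP[ft]; rewrite ltr_norml => /andP[h1 h2].
  have f0t : 0 < f0 t.
    rewrite -invr_gt0 -(pmulr_rgt0 _ ft); lra.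
  split=> //; apply/andP; split.
    by rewrite -ler_pdivlMr//; lra.
  by rewrite -ler_pdivrMr//; lra.
exists (Num.max M 0) => s t; rewrite ge_max => /andP[Ms s0] st.
have [f0s /andP[_ fs]] := bd s Ms.
have [f0t /andP[ft _]] := bd t (le_trans Ms st).
have f0st : f0 s <= f0 t by apply: f0m; rewrite ?in_itv/= ?andbT//; lra.
have h1 : 0 <= 1 - e by lra.
have := ler_wpM2l h1 fs.
have h2 : 0 <= 1 - e / 3 by lra.
have := ler_wpM2l h2 f0st.
by nra.
Qed.

Lemma cvgr_ln_pinfty f : f t @[t --> +oo] --> +oo -> ln (f t) @[t --> +oo] --> +oo.
Proof.
move=> foo; apply/cvgryPge => K; move/cvgryPge : foo => /(_ (expR K)).
apply: filterS => t Kt; rewrite -[K]expRK ler_ln// posrE ?expR_gt0//.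
by apply: lt_le_trans Kt; exact: expR_gt0.
Qed.

Lemma almost_nondecreasing_ln f : f t @[t --> +oo] --> +oo ->
  almost_nondecreasing f -> almost_nondecreasing (fun t => ln (f t)).
Proof.
move=> foo fm e /andP[e0 e1].
have [|T0 T0P] := fm (1 / 2); first by lra.
have [M MP] : exists M, forall t, M <= t -> 0 < f t /\ ln 2 / e <= ln (f t).
  apply: near_pinfty_exists2.
  - by move/cvgryPgt : foo; exact.
  - by move/cvgryPge : (cvgr_ln_pinfty foo); exact.
exists (Num.max M T0) => s t; rewrite ge_max => /andP[Ms Ts] st.
have [fs lns] := MP s Ms; have [ft _] := MP t (le_trans Ms st).
have fst := T0P s t Ts st.
apply: le_trans (_ : ln (f s / 2) <= _); last first.
  by rewrite ler_ln ?posrE ?divr_gt0//; lra.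
rewrite ln_div ?posrE//.
by move: lns; rewrite ler_pdivrMr//; lra.
Qed.

Lemma almost_nondecreasingM f g (del : R) : 0 < del < 1 ->
  f t @[t --> +oo] --> +oo -> g t @[t --> +oo] --> +oo ->
  almost_nondecreasing f -> almost_nondecreasing g ->
  exists T0, forall s t, T0 <= s -> s <= t ->
     (1 - del) ^+ 2 * (f s * g s) <= f t * g t.
Proof.
move=> d01 foo goo fm gm; have [T1 T1P] := fm _ d01; have [T2 T2P] := gm _ d01.
have [M MP] : exists M, forall t, M <= t -> 0 <= f t /\ 0 <= g t.
  apply: near_pinfty_exists2.
  - by move/cvgryPge : foo; exact.
  - by move/cvgryPge : goo; exact.
exists (Num.max M (Num.max T1 T2)) => s t; rewrite !ge_max => /and3P[Ms T1s T2s] st.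
have [fs gs] := MP s Ms.
have -> : (1 - del) ^+ 2 * (f s * g s) = ((1 - del) * f s) * ((1 - del) * g s) by ring.
have d0 : 0 <= 1 - del by move/andP : d01 => [_ /ltW]; rewrite subr_ge0.
by apply: ler_pM; rewrite ?mulr_ge0 ?T1P ?T2P.
Qed.

Lemma near_pinfty_ln_le (eta : R) : 0 < eta ->
  \forall x \near +oo, ln x <= eta * x.
Proof.
move=> eta0; near=> x.
have x0 : 0 < x by near: x; exact: nbhs_pinfty_gt.
pose y := ln x; have xE : x = expR y by rewrite lnK.
have [y0|y0] := leP y 0; first by apply: le_trans y0 _; rewrite mulr_ge0// ltW.
have : expR (2 / eta) <= x by near: x; apply: nbhs_pinfty_ge; exact: num_real.
rewrite xE ler_expR ler_pdivrMr// => y2.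
rewrite -xE -/y xE; have := expR_ge1Dxn 1 (ltW y0).
rewrite (_ : (2`!)%:R = 2 :> R)// => h.
apply: le_trans (_ : eta * (y ^+ 2 / 2) <= _); first by nra.
by rewrite ler_pM2l//; lra.
Unshelve. all: by end_near. Qed.

End asymptotic_monotonicity.

(** * First passage times *)

Section first_passage.
Context {R : realType}.
Implicit Types (f b a : R -> R) (v : R).

Definition first_passage f v : R := inf [set t | 0 < t /\ v < f t].

Section basics.
Variable f : R -> R.
Hypothesis f_infty : f t @[t --> +oo] --> +oo.

Let has_inf_passage v : has_inf [set t | 0 < t /\ v < f t].
Proof.
split; last by exists 0 => t [/ltW].
move/cvgryPgt : f_infty => /(_ v) [M [_ hM]].
exists (Num.max M 0 + 1); split.
  by rewrite ltr_pwDr// le_max lexx orbT.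
by apply: hM; rewrite ltr_pwDr// le_max lexx.
Qed.

Lemma before_first_passage v t : 0 < t -> t < first_passage f v -> f t <= v.
Proof.
move=> t0; rewrite leNgt; apply: contraTN => vt; rewrite -leNgt.
by apply: ge_inf => //; case: (has_inf_passage v).
Qed.

Lemma near_first_passage v e : 0 < e ->
  exists t, [/\ first_passage f v <= t, t < first_passage f v + e, 0 < t & v < f t].
Proof.
move=> e0; have [t [t0 vt] te] := inf_adherent e0 (has_inf_passage v).
exists t; split=> //.
by apply: ge_inf => //; case: (has_inf_passage v).
Qed.

Lemma first_passage_infty (v : nat -> R) :
  (forall K, exists C, forall t, 0 < t <= K -> f t <= C) ->
  v n @[n --> \oo] --> +oo -> first_passage f (v n) @[n --> \oo] --> +oo.
Proof.
move=> fK voo; apply/cvgryPge => K; have [C hC] := fK (K + 1).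
move/cvgryPgt : voo => /(_ C); apply: filterS => n Cn.
rewrite leNgt; apply/negP => tK.
have [t [_ te t0 vt]] := near_first_passage (v n) (ltr01 : 0 < 1 :> R).
have : f t <= C by apply: hC; rewrite t0/=; lra.
by lra.
Qed.

End basics.

(** Steps of a partition bounded by [B] rule out jumps of [b] larger than [B] at
    the endpoints of the partition. *)
Lemma partition_passage (b : R -> R) (B : R) (v : nat -> R) (j : nat -> nat)
    (s : nat -> nat -> R) N :
  b t @[t --> +oo] --> +oo ->
  (forall s t, 0 < s -> s <= t -> b s <= b t) ->
  (forall n, (N <= n)%N -> 0 < first_passage b (v n)) ->
  (forall n, (N <= n)%N ->
    partition_with_increments b B (first_passage b (v n))
      (first_passage b (v n.+1)) (j n) (s n)) ->
  forall n, (N < n)%N -> v n - B <= b (first_passage b (v n)) <= v n + B.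
Proof.
move=> boo bm tpos part n Nn; apply/andP; split.
  have [j0 s0 _ sinc binc] := part n (ltnW Nn).
  have /andP[_ b1] := binc _ j0; rewrite s0 in b1.
  have t1 := sinc _ j0; rewrite s0 in t1.
  have [|t [_ te t0 vt]] := near_first_passage boo (v n)
      (e := s n 1%N - first_passage b (v n)); first by rewrite subr_gt0.
  have : b t <= b (s n 1%N) by apply: bm => //; lra.
  by lra.
case: n Nn => // n; rewrite ltnS => Nn.
have [j0 s0 sj sinc binc] := part n Nn.
have jj : (j n).-1.+1 = j n by rewrite prednK.
have jlt : ((j n).-1 < j n)%N by rewrite jj.
have /andP[_ b1] := binc _ jlt; rewrite jj sj in b1.
have t1 := sinc _ jlt; rewrite jj sj in t1.
have s_gt0 : 0 < s n (j n).-1.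
  apply: lt_le_trans (tpos n Nn) _.
  by rewrite -{1}s0; apply: partition_le (part n Nn) _; rewrite leq_pred.
have := before_first_passage boo s_gt0 t1.
by lra.
Qed.

(** At the first passage of [w] the logarithm of [a] is close to that of [w],
    either by continuity or because [ln \o a] hardly varies over unit times. *)
Lemma ln_first_passage (a : R -> R) (w : nat -> R) (eta : R) :
  a t @[t --> +oo] --> +oo -> almost_nondecreasing (fun t => ln (a t)) ->
  (forall K, exists C, forall t, 0 < t <= K -> a t <= C) ->
  (eventually_continuous a \/
   forall e, 0 < e -> \forall t \near +oo, ln (a t) <= (1 + e) * ln (a (t - 1))) ->
  w n @[n --> \oo] --> +oo -> 0 < eta < 1 ->
  \forall n \near \oo, (1 - eta) * ln (w n) <= ln (a (first_passage a (w n)))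
     <= (1 + eta) * ln (w n).
Proof.
move=> aoo lnm aK reg woo /andP[eta0 eta1].
have tauoo := first_passage_infty aoo aK woo.
case: reg => [[T0 T0_ge0 acont]|reg].
  pose K := expR (ln 2 / eta) + 2.
  have near1 : \forall n \near \oo, K <= w n by move/cvgryPge : woo; exact.
  have near2 : \forall n \near \oo, T0 + 1 <= first_passage a (w n).
    by move/cvgryPge : tauoo; exact.
  apply: filterS2 near1 near2 => n Kw Tt; set tau := first_passage a (w n).
  have e0 := expR_gt0 (ln 2 / eta); have w2 : 2 <= w n by rewrite /K in Kw; lra.
  have ca : {for tau, continuous a}.
    have tauT : tau \in (`]T0, +oo[ : interval R) by rewrite in_itv/= andbT /tau; lra.
    by have /continuous_within_itvcyP[+ _] := acont; exact.
  have [e e_gt0 he] : exists2 e, 0 < e & forall t, `|tau - t| < e -> `|a tau - a t| < 1.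
    move/cvgrPdist_lt : ca => /(_ 1 ltr01)[e e_gt0 he].
    by exists e => // t te; exact: he.
  have [t [t1 t2 t3 wt]] := near_first_passage aoo (w n) e_gt0.
  have at1 : w n - 1 <= a tau.
    have : `|a tau - a t| < 1 by apply: he; rewrite ltr_norml; rewrite -/tau in t1 t2; lra.
    by rewrite ltr_norml; lra.
  have at2 : a tau <= w n + 1.
    pose t' := tau - Num.min e 1 / 2.
    have m0 : 0 < Num.min e 1 by rewrite lt_min e_gt0 ltr01.
    have m1 : Num.min e 1 <= 1 by rewrite ge_min lexx orbT.
    have me : Num.min e 1 <= e by rewrite ge_min lexx.
    have : a t' <= w n by apply: before_first_passage => //; rewrite /t'; rewrite -/tau in Tt; lra.
    have : `|a tau - a t'| < 1 by apply: he; rewrite ltr_norml /t'; lra.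
    by rewrite ltr_norml; lra.
  have lw : ln 2 <= eta * ln (w n).
    rewrite mulrC -ler_pdivrMr// -[leLHS]expRK ler_ln ?posrE//; last by lra.
    by rewrite /K in Kw; lra.
  have h1 : ln (w n / 2) <= ln (a tau) by rewrite ler_ln ?posrE; lra.
  have h2 : ln (a tau) <= ln (w n * 2) by rewrite ler_ln ?posrE; lra.
  rewrite ln_div ?posrE// in h1; last by lra.
  rewrite lnM ?posrE// in h2; last by lra.
  by lra.
have eta2 : 0 < eta / 4 < 1 by lra.
have [T1 T1P] := lnm _ eta2.
have [|T2 T2P] := near_pinfty_exists (reg (eta / 4) _); first by lra.
have [T3 T3P] : exists M, forall t, M <= t -> 0 <= ln (a t) /\ 0 < a t.
  apply: near_pinfty_exists2; last by move/cvgryPgt : aoo; exact.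
  by move/cvgryPge : (cvgr_ln_pinfty aoo); exact.
pose T4 := Num.max T1 (Num.max T2 (Num.max T3 0)) + 2.
have T14 : T1 + 2 <= T4 by rewrite /T4 lerD2r le_max lexx.
have T24 : T2 + 2 <= T4 by rewrite /T4 lerD2r !le_max lexx orbT.
have T34 : T3 + 2 <= T4 by rewrite /T4 lerD2r !le_max lexx !orbT.
have T44 : 2 <= T4 by rewrite /T4 lerDr !le_max lexx !orbT.
have near2 : \forall n \near \oo, T4 <= first_passage a (w n).
  by move/cvgryPge : tauoo; exact.
have near1 : \forall n \near \oo, 1 <= w n by move/cvgryPge : woo; exact.
apply: filterS2 near1 near2 => n w1; set tau := first_passage a (w n) => Tt.
have lw0 : 0 <= ln (w n) by exact: ln_ge0.
apply/andP; split.
  have [t [t1 t2 t3 wt]] := near_first_passage aoo (w n) (ltr01 : 0 < 1 :> R).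
  rewrite -/tau in t1 t2.
  have h1 : ln (w n) <= ln (a t) by rewrite ler_ln ?posrE; lra.
  have h2 : ln (a t) <= (1 + eta / 4) * ln (a (t - 1)) by apply: T2P; lra.
  have h3 : (1 - eta / 4) * ln (a (t - 1)) <= ln (a tau) by apply: T1P; lra.
  have [l0 _] : 0 <= ln (a (t - 1)) /\ 0 < a (t - 1) by apply: T3P; lra.
  have h4 : (1 - eta) * (1 + eta / 4) <= 1 - eta / 4 by nra.
  have := ler_wpM2r l0 h4.
  have eta1' : 0 <= 1 - eta by lra.
  by have := ler_wpM2l eta1' (le_trans h1 h2); lra.
have h1 : ln (a tau) <= (1 + eta / 4) * ln (a (tau - 1)) by apply: T2P; lra.
have [l0 a0] : 0 <= ln (a (tau - 1)) /\ 0 < a (tau - 1) by apply: T3P; lra.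
have h2 : a (tau - 1) <= w n by apply: before_first_passage => //; rewrite -/tau; lra.
have h3 : ln (a (tau - 1)) <= ln (w n) by rewrite ler_ln ?posrE; lra.
have e4 : 0 <= 1 + eta / 4 by lra.
have := ler_wpM2l e4 h3; have : 0 <= eta * ln (w n) by rewrite mulr_ge0// ltW.
by lra.
Qed.

End first_passage.

(** * Growth of the mean and variance along first passage times *)

Section growth_along_passages.
Context {R : realType}.

Lemma expR_sub1_le (x : R) : expR x <= 1 + x * expR x.
Proof.
have := ler_wpM2l (expR_ge0 x) (onem_le_expRN x).
by rewrite -expRD subrr expR0; lra.
Qed.

Lemma power_increment_le (al : R) (n : nat) : 0 < al -> (0 < n)%N ->
  expR (al * ln n.+1%:R) <=
  expR (al * ln n%:R) + al * expR al * expR ((al - 1) * ln n%:R).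
Proof.
move=> al0 n0; set m : R := n%:R; have m0 : 0 < m by rewrite ltr0n.
have m1 : 1 <= m by rewrite ler1n.
have -> : n.+1%:R = m * (1 + m^-1) by rewrite mulrDr mulr1 mulfV ?natr1// gt_eqF.
have mi0 : 0 < m^-1 by rewrite invr_gt0.
have mi1 : m^-1 <= 1 by rewrite invf_le1.
have lnD : ln (m * (1 + m^-1)) <= ln m + m^-1.
  rewrite lnM ?posrE ?addr_gt0// lerD2l; apply: le_ln1Dx.
  by apply: lt_trans mi0; rewrite ltrN10.
have im : expR ((al - 1) * ln m) = expR (al * ln m) * m^-1.
  by rewrite mulrBl mul1r expRD expRN lnK// posrE.
rewrite im; clearbody m.
apply: le_trans (_ : expR (al * ln m) * expR (al * m^-1) <= _).
  rewrite -expRD -mulrDr ler_expR.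
  by apply: ler_wpM2l => //; exact: ltW.
apply: le_trans (_ : expR (al * ln m) * (1 + al * m^-1 * expR al) <= _).
  rewrite ler_wpM2l ?expR_ge0//; apply: le_trans (expR_sub1_le _) _.
  rewrite lerD2l; apply: ler_wpM2l.
    by apply: mulr_ge0; exact: ltW.
  by rewrite ler_expR ler_piMr// ltW.
by move: (expR (al * ln m)) => z; lra.
Qed.

Lemma near_pinfty_log_factor_le (C sg : R) : 0 < C -> 0 <= sg ->
  \forall x \near +oo, C * expR (sg * ln (ln x)) <= x.
Proof.
move=> C0 sg0; pose eta := (2 * (sg + 1))^-1.
have eta0 : 0 < eta by rewrite invr_gt0; lra.
have lnoo : ln x @[x --> +oo] --> (+oo : set_system R).
  by apply: cvgr_ln_pinfty; exact: cvg_id.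
have near1 : \forall x \near +oo, ln (ln x) <= eta * ln x :> R.
  exact: (lnoo _ (near_pinfty_ln_le eta0)).
have near2 : \forall x \near +oo, 2 * ln C <= ln x :> R.
  by move/cvgryPge : lnoo; exact.
near=> x.
have x0 : 0 < x by near: x; exact: nbhs_pinfty_gt.
have l0 : 0 <= ln x by near: x; move/cvgryPge : lnoo; exact.
have h1 : ln (ln x) <= eta * ln x by near: x.
have h2 : 2 * ln C <= ln x by near: x.
have CE : expR (ln C) = C by rewrite lnK.
have xE : expR (ln x) = x by rewrite lnK.
rewrite -{1}CE -[leRHS]xE -expRD ler_expR.
have h3 : sg * eta <= 1 / 2 by rewrite /eta ler_pdivrMr; lra.
have := ler_wpM2l sg0 h1; have := ler_wpM2r l0 h3.
by rewrite mulrA; lra.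
Unshelve. all: by end_near. Qed.

Variables (a b : R -> R) (B : R) (tn : nat -> R).
Hypothesis B_gt0 : 0 < B.
Hypothesis a_infty : a t @[t --> +oo] --> +oo.
Hypothesis ab : forall t, 0 < t -> a t <= b t.
Hypothesis tn_infty : tn n @[n --> \oo] --> +oo.

Let at_tn (Q : R -> Prop) : (\forall t \near +oo, Q t) ->
  \forall n \near \oo, Q (tn n).
Proof. by move=> hQ; exact: (tn_infty hQ). Qed.

Let ln2 : 0 < ln 2 :> R /\ ln 2 <= 1 :> R.
Proof.
split; first by rewrite ln_gt0//; lra.
by have := @le_ln1Dx R 1; apply; lra.
Qed.

(** Mean and variance differ by a power of [ln (a t)], so [ln \o ln] has the same
    growth on both, and [al] is that growth relative to [ln n]. From [n] to
    [n.+1] the level [v] grows by a factor [1 + n `^ (al - 1)] up to constants,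
    while [v n] is at most [n `^ (al * sg)] times the variance; the relation
    between [al], [sg] and [kap] leaves the factor [n `^ (- kap)]. *)
Lemma growth_log (C sg al kap : R) (v : nat -> R) : 0 < C -> 0 <= sg -> 0 < al ->
  0 < kap -> al * (1 + sg) = 1 - kap ->
  (forall n, (0 < n)%N -> v n = expR (expR (al * ln n%:R))) ->
  (\forall t \near +oo, b t <= C * a t * expR (sg * ln (ln (a t)))) ->
  (\forall n \near \oo, v n - B <= b (tn n) <= v n + B) ->
  (exists K, \forall n \near \oo, al * ln n%:R - K <= ln (ln (a (tn n)))) /\
  \forall n \near \oo, (b (tn n.+1) - b (tn n)) * expR (kap / 2 * ln n%:R) <= a (tn n).
Proof.
move=> C0 sg0 al0 kap0 alsg vE bC bv.
have [ln2_gt0 ln2_le1] := ln2.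
have al1 : al <= 1 by nra.
have near_y K : \forall n \near \oo, K <= expR (al * ln (n%:R : R)).
  have := @near_infty_ln_le_expR R 0 K 1 al ltr01 al0.
  by apply: filterS => n; rewrite mul0r add0r mul1r.
have near_a K : \forall n \near \oo, K <= a (tn n).
  by apply: (at_tn (Q := fun t => K <= a t)); move/cvgryPge : a_infty; exact.
have near_bv : \forall n \near \oo, v n / 2 <= b (tn n) <= 2 * v n.
  near=> n; have n0 : (0 < n)%N by near: n; exact: nbhs_infty_gt.
  have /andP[h1 h2] : v n - B <= b (tn n) <= v n + B by near: n.
  have y0 : 2 * B <= expR (al * ln n%:R) by near: n; exact: near_y.
  have B0 := B_gt0; have := expR_ge1Dx (expR (al * ln n%:R)); rewrite -vE//.
  by move=> h; apply/andP; split; lra.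
have near_lnb : \forall n \near \oo, expR (al * ln n%:R) / 2 <= ln (b (tn n)) /\
    ln (b (tn n)) <= 2 * expR (al * ln n%:R).
  near=> n; have n0 : (0 < n)%N by near: n; exact: nbhs_infty_gt.
  have /andP[h1 h2] : v n / 2 <= b (tn n) <= 2 * v n by near: n.
  have y2 : 2 <= expR (al * ln n%:R) by near: n; exact: near_y.
  have v0 : 0 < v n by rewrite vE// expR_gt0.
  have lnv : ln (v n) = expR (al * ln n%:R) by rewrite vE// expRK.
  split.
    have : ln (v n / 2) <= ln (b (tn n)) by rewrite ler_ln ?posrE; lra.
    by rewrite ln_div ?posrE// lnv; lra.
  have : ln (b (tn n)) <= ln (2 * v n) by rewrite ler_ln ?posrE; lra.
  by rewrite lnM ?posrE// lnv; lra.
have near_sq : \forall n \near \oo, b (tn n) <= a (tn n) * a (tn n).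
  near=> n.
  have a0 : 0 <= a (tn n) by near: n; exact: near_a.
  have h1 : b (tn n) <= C * a (tn n) * expR (sg * ln (ln (a (tn n)))).
    by near: n; exact: (at_tn bC).
  have h2 : C * expR (sg * ln (ln (a (tn n)))) <= a (tn n).
    near: n; apply: (at_tn (Q := fun t => C * expR (sg * ln (ln (a t))) <= a t)).
    exact: (a_infty (near_pinfty_log_factor_le C0 sg0)).
  by have := ler_wpM2l a0 h2; lra.
split.
  exists (ln 4); near=> n.
  have [h1 _] : expR (al * ln n%:R) / 2 <= ln (b (tn n)) /\
    ln (b (tn n)) <= 2 * expR (al * ln n%:R) by near: n.
  have a1 : 1 <= a (tn n) by near: n; exact: near_a.
  have b1 : 1 <= b (tn n).
    have t0 : 0 < tn n by near: n; move/cvgryPgt : tn_infty; exact.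
    exact: le_trans a1 (ab t0).
  have h2 : b (tn n) <= a (tn n) * a (tn n) by near: n.
  have h3 : ln (b (tn n)) <= ln (a (tn n)) + ln (a (tn n)).
    by rewrite -lnM ?posrE ?ler_ln ?posrE ?mulr_gt0//; lra.
  have y0 := expR_gt0 (al * ln (n%:R : R)).
  have : ln (expR (al * ln n%:R) / 4) <= ln (ln (a (tn n))) by rewrite ler_ln ?posrE; lra.
  by rewrite ln_div ?posrE// expRK.
pose D1 := 2 * C * expR sg; pose D2 := al * expR al * expR (al * expR al) + 1.
have D10 : 0 < D1 by rewrite !mulr_gt0 ?expR_gt0.
have D20 : 0 < D2 by rewrite addr_gt0 ?mulr_gt0 ?expR_gt0.
have near_va : \forall n \near \oo,
    v n <= D1 * expR (sg * (al * ln n%:R)) * a (tn n).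
  near=> n.
  have /andP[h1 _] : v n / 2 <= b (tn n) <= 2 * v n by near: n.
  have [_ h2] : expR (al * ln n%:R) / 2 <= ln (b (tn n)) /\
    ln (b (tn n)) <= 2 * expR (al * ln n%:R) by near: n.
  have t0 : 0 < tn n by near: n; move/cvgryPgt : tn_infty; exact.
  have a1 : 3 <= a (tn n) by near: n; exact: near_a.
  have h3 : b (tn n) <= C * a (tn n) * expR (sg * ln (ln (a (tn n)))).
    by near: n; exact: (at_tn bC).
  have lna : 0 < ln (a (tn n)) by rewrite ln_gt0//; lra.
  have lnab : ln (a (tn n)) <= ln (b (tn n)).
    by rewrite ler_ln ?posrE ?ab//; have := ab t0; lra.
  have y0 := expR_gt0 (al * ln (n%:R : R)).
  have h4 : ln (ln (a (tn n))) <= 1 + al * ln n%:R.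
    have : ln (ln (a (tn n))) <= ln (2 * expR (al * ln n%:R)) by rewrite ler_ln ?posrE; lra.
    by rewrite lnM ?posrE// expRK; lra.
  have h5 : expR (sg * ln (ln (a (tn n)))) <= expR sg * expR (sg * (al * ln n%:R)).
    by rewrite -expRD ler_expR; have := ler_wpM2l sg0 h4; lra.
  have Ca : 0 <= C * a (tn n) by rewrite mulr_ge0//; lra.
  by have := ler_wpM2l Ca h5; rewrite /D1; lra.
have near_incr : \forall n \near \oo,
    b (tn n.+1) - b (tn n) <= D2 * (v n * expR ((al - 1) * ln n%:R)).
  have bvS : \forall n \near \oo, v n.+1 - B <= b (tn n.+1) <= v n.+1 + B.
    case: bv => M _ hM; exists M => // n /= Mn; apply: hM => /=; exact: leqW.
  near=> n; have n0 : (0 < n)%N by near: n; exact: nbhs_infty_gt.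
  have /andP[h1 _] : v n - B <= b (tn n) <= v n + B by near: n.
  have /andP[_ h2] : v n.+1 - B <= b (tn n.+1) <= v n.+1 + B by near: n.
  have l0 : 0 <= ln (n%:R : R) by rewrite ln_ge0// ler1n.
  have hy : 1 * ln (n%:R : R) + ln (2 * B) <= 1 * expR (al * ln n%:R).
    by near: n; exact: near_infty_ln_le_expR.
  have B0 := B_gt0.
  have h3 : 2 * B <= v n * expR ((al - 1) * ln n%:R).
    rewrite -[leLHS]lnK ?posrE ?mulr_gt0// vE// -expRD ler_expR.
    by have := mulr_ge0 (ltW al0) l0; lra.
  have := power_increment_le al0 n0.
  set y := expR (al * ln n%:R) in hy *; set d := al * expR al * _ => h4.
  have d0 : 0 <= d by rewrite !mulr_ge0 ?expR_ge0// ltW.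
  have d_le : d <= al * expR al.
    rewrite /d; apply: ler_piMr; first by rewrite mulr_ge0 ?expR_ge0// ltW.
    have al1' : 0 <= 1 - al by lra.
    by rewrite expR_le1; have := mulr_ge0 al1' l0; lra.
  have h5 : v n.+1 <= v n + v n * (d * expR (al * expR al)).
    have v0 : 0 <= v n by rewrite vE// expR_ge0.
    have : v n.+1 <= v n * expR d by rewrite !vE// -expRD ler_expR.
    have := expR_sub1_le d.
    have : d * expR d <= d * expR (al * expR al) by rewrite ler_wpM2l// ler_expR.
    move=> g1 g2 g3; apply: le_trans g3 _.
    by have := ler_wpM2l v0 (le_trans g2 (lerD (lexx 1) g1)); lra.
  by rewrite /D2; move: h5; rewrite /d; lra.
have near_D : \forall n \near \oo, 0 * ln (n%:R : R) + D2 * D1 <= 1 * expR (kap / 2 * ln n%:R).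
  by apply: near_infty_ln_le_expR => //; lra.
near=> n.
have h1 : v n <= D1 * expR (sg * (al * ln n%:R)) * a (tn n) by near: n.
have h2 : b (tn n.+1) - b (tn n) <= D2 * (v n * expR ((al - 1) * ln n%:R)) by near: n.
have h3 : 0 * ln (n%:R : R) + D2 * D1 <= 1 * expR (kap / 2 * ln n%:R) by near: n.
have a0 : 0 <= a (tn n) by near: n; exact: near_a.
apply: le_trans (ler_wpM2r (expR_ge0 _) h2) _.
have g1 : 0 <= D2 * expR ((al - 1) * ln n%:R) * expR (kap / 2 * ln n%:R).
  by rewrite !mulr_ge0 ?expR_ge0// ltW.
have := ler_wpM2l g1 h1.
have e1 : expR ((al - 1) * ln n%:R) * expR (kap / 2 * ln n%:R) *
    expR (sg * (al * ln n%:R)) = expR (- (kap / 2 * ln (n%:R : R))).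
  rewrite -!expRD; congr expR.
  rewrite -[RHS]addr0; have -> : kap = 1 - al * (1 + sg) by rewrite alsg; ring.
  by field.
have -> : D2 * expR ((al - 1) * ln n%:R) * expR (kap / 2 * ln n%:R) *
   (D1 * expR (sg * (al * ln n%:R)) * a (tn n)) =
   D2 * D1 * expR (- (kap / 2 * ln n%:R)) * a (tn n) by rewrite -e1; ring.
have e2 : D2 * D1 * expR (- (kap / 2 * ln n%:R)) <= 1.
  rewrite expRN ler_pdivrMr ?expR_gt0//; lra.
have := ler_wpM2r a0 e2.
by move=> g2 g3; lra.
Unshelve. all: by end_near. Qed.

(** The variance is at least the power [1 / m] of the mean, that is [n `^ th] up
    to constants, and the level [v] grows by [n `^ (be - 1)] from [n] to [n.+1]. *)
Lemma growth_power (C m th be kap : R) (v : nat -> R) : 0 < C -> 0 < m ->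
  0 < kap -> 1 <= be -> be = m * th -> be - 1 = th - kap ->
  (forall n, (0 < n)%N -> v n = expR (be * ln n%:R)) ->
  (\forall t \near +oo, b t <= C * expR (m * ln (a t))) ->
  (\forall n \near \oo, v n - B <= b (tn n) <= v n + B) ->
  (exists K, \forall n \near \oo, th * ln n%:R - K <= ln (a (tn n))) /\
  \forall n \near \oo, (b (tn n.+1) - b (tn n)) * expR (kap / 2 * ln n%:R) <= a (tn n).
Proof.
move=> C0 m0 kap0 be1 beE be1E vE bC bv.
have [ln2_gt0 ln2_le1] := ln2.
have be0 : 0 < be by lra.
have near_v K : \forall n \near \oo, K <= expR (be * ln (n%:R : R)).
  have := @near_infty_ln_le_expR R 0 K 1 be ltr01 be0.
  by apply: filterS => n; rewrite mul0r add0r mul1r.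
have near_a K : \forall n \near \oo, K <= a (tn n).
  by apply: (at_tn (Q := fun t => K <= a t)); move/cvgryPge : a_infty; exact.
pose K := (ln 2 + ln C) / m.
have lna : \forall n \near \oo, th * ln n%:R - K <= ln (a (tn n)).
  near=> n; have n0 : (0 < n)%N by near: n; exact: nbhs_infty_gt.
  have /andP[h1 _] : v n - B <= b (tn n) <= v n + B by near: n.
  have v2 : 2 * B <= expR (be * ln n%:R) by near: n; exact: near_v.
  have B0 := B_gt0; rewrite -vE// in v2.
  have h2 : b (tn n) <= C * expR (m * ln (a (tn n))) by near: n; exact: (at_tn bC).
  have v0 : 0 < v n by rewrite vE// expR_gt0.
  have h3 : v n / 2 <= C * expR (m * ln (a (tn n))) by lra.
  have : ln (v n / 2) <= ln (C * expR (m * ln (a (tn n)))).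
    by rewrite ler_ln ?posrE ?mulr_gt0 ?expR_gt0//; lra.
  rewrite ln_div ?posrE// lnM ?posrE ?expR_gt0// expRK vE// expRK beE => h4.
  have : m * (th * ln n%:R - K) <= m * ln (a (tn n)).
    rewrite mulrBr (_ : m * K = ln 2 + ln C); last by rewrite /K; field; rewrite gt_eqF.
    by lra.
  by rewrite ler_pM2l.
split; first by exists K.
pose D2 := be * expR be + 2 * B.
have near_incr : \forall n \near \oo,
    b (tn n.+1) - b (tn n) <= D2 * expR ((be - 1) * ln n%:R).
  have bvS : \forall n \near \oo, v n.+1 - B <= b (tn n.+1) <= v n.+1 + B.
    case: bv => M _ hM; exists M => // n /= Mn; apply: hM => /=; exact: leqW.
  near=> n; have n0 : (0 < n)%N by near: n; exact: nbhs_infty_gt.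
  have /andP[h1 _] : v n - B <= b (tn n) <= v n + B by near: n.
  have /andP[_ h2] : v n.+1 - B <= b (tn n.+1) <= v n.+1 + B by near: n.
  have l0 : 0 <= ln (n%:R : R) by rewrite ln_ge0// ler1n.
  have B0 := B_gt0.
  have be1' : 0 <= be - 1 by lra.
  have h3 : 2 * B * 1 <= 2 * B * expR ((be - 1) * ln n%:R).
    by rewrite ler_wpM2l ?mulr_ge0 ?(ltW B0)// ge0_expR_ge1// mulr_ge0.
  have := power_increment_le be0 n0; rewrite -!vE// /D2.
  by lra.
have near_D : \forall n \near \oo,
    0 * ln (n%:R : R) + D2 <= expR (- K) * expR (kap / 2 * ln n%:R).
  by apply: near_infty_ln_le_expR; rewrite ?expR_gt0//; lra.
near=> n.
have h1 : th * ln n%:R - K <= ln (a (tn n)) by near: n.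
have h2 : b (tn n.+1) - b (tn n) <= D2 * expR ((be - 1) * ln n%:R) by near: n.
have h3 : 0 * ln (n%:R : R) + D2 <= expR (- K) * expR (kap / 2 * ln n%:R) by near: n.
have a0 : 1 <= a (tn n) by near: n; exact: near_a.
apply: le_trans (ler_wpM2r (expR_ge0 _) h2) _.
have aE : expR (ln (a (tn n))) = a (tn n) by rewrite lnK// posrE; lra.
rewrite -aE; apply: le_trans (_ : expR (th * ln n%:R - K) <= _); last by rewrite ler_expR.
have h4 : D2 <= expR (- K) * expR (kap / 2 * ln n%:R) by lra.
rewrite -[leLHS]mulrA -expRD.
apply: le_trans (ler_wpM2r (expR_ge0 _) h4) _.
rewrite -!expRD ler_expR be1E.
by lra.
Unshelve. all: by end_near. Qed.

End growth_along_passages.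

(** * The two growth regimes *)

Section selections.
Context d (T : measurableType d) (R : realType) (P : probability T R).
Variable A : nat -> R -> set T.
Let a := var_count P A.

(** An exact selection is handled as an approximate one. In the approximate case
    the loss can be taken smaller than [sig], which turns the limit into an
    inequality. *)
Lemma selection_cases (mu q : R) : a t @[t --> +oo] --> +oo ->
  selection_approx P A mu q \/ selection_exact P A mu q ->
  forall sig, 0 < sig -> exists2 gamma0, 0 < gamma0 &
    forall gamma, 0 < gamma < gamma0 -> exists (S : R -> set nat) (n0 : nat),
    [/\ forall n, (n0 <= n)%N -> 0 < tau_seq a gamma mu q n,
        trivIset [set n | (n0 <= n)%N] (fun n => S (tau_seq a gamma mu q n)) &
        \forall t \near +oo, (1 - sig) * a t <= var_count_in P A (S t) t].
Proof.
move=> aoo sel sig sig0.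
have ratio (S : R -> set nat) (l : R) : 1 - sig < l ->
    var_count_in P A (S t) t / var_count P A t @[t --> +oo] --> l ->
    \forall t \near +oo, (1 - sig) * a t <= var_count_in P A (S t) t.
  move=> sl Sl; have lsig : 0 < l - (1 - sig) by lra.
  have near1 : \forall t \near +oo, 0 < a t by move/cvgryPgt : aoo; exact.
  move/cvgrPdist_lt : Sl => /(_ _ lsig); apply: filterS2 near1 => t at0.
  rewrite ltr_norml => /andP[_ h].
  by rewrite -ler_pdivlMr// /a; lra.
case: sel => [[s0 [sig1 [S [s00 sig10 [gamma0 gamma00 hdis] hlim]]]]|].
  pose sig' := Num.min sig sig1 / 2.
  have m0 : 0 < Num.min sig sig1 by rewrite lt_min sig0.
  have m1 : Num.min sig sig1 <= sig by rewrite ge_min lexx.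
  have m2 : Num.min sig sig1 <= sig1 by rewrite ge_min lexx orbT.
  have sig'0 : 0 < sig' < sig1 by rewrite /sig'; lra.
  exists gamma0 => // gamma hg; have [n0 [tau0 dis]] := hdis _ _ hg sig'0.
  exists (S sig'), n0; split=> //; first by move=> n /tau0; exact: lt_trans.
  by apply: (ratio _ (1 - sig')) (hlim _ sig'0); rewrite /sig'; lra.
case=> [s0 [S [s00 [gamma0 gamma00 hdis] hlim]]].
exists gamma0 => // gamma hg; have [n0 [tau0 dis]] := hdis _ hg.
exists S, n0; split=> //; first by move=> n /tau0; exact: lt_trans.
by apply: ratio hlim; lra.
Qed.

End selections.

Section lil.
Context d (T : measurableType d) (R : realType) (P : probability T R).
Variable A : nat -> R -> set T.
Hypothesis mA : forall (k : nat) (t : R), 0 <= t -> measurable (A k t).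
Hypothesis indepA : independent_families P A.
Hypothesis X_fin :
  forall t : R, 0 <= t -> {ae P, forall w, (ecount_events A t w < +oo)%E}.
Hypothesis EX_fin : forall t : R, 0 <= t -> ('E_P[count_events A t] < +oo)%E.
Hypothesis incA :
  forall (k : nat) (s t : R), 0 < s -> s < t -> A k s `<=` A k t.

Let X := count_events A.
Let b := mean_count P A.
Let a := var_count P A.

Lemma bigO_inftyP (f g : R -> R) : bigO_infty f g ->
  exists2 C, 0 < C & \forall t \near +oo, `|f t| <= C * `|g t|.
Proof.
rewrite /bigO_infty => /eqOP [M [_ hM]].
pose C := Num.max M 0 + 1.
have MC : M < C by rewrite ltr_pwDr// le_max lexx.
have C0 : 0 < C by rewrite ltr_pwDr// le_max lexx orbT.
by exists C => //; exact: (hM _ MC).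
Qed.

(** The infimum defining the growth index need not be attained, hence the strict
    inequality. *)
Lemma growth_index_bigO (m : R) : a t @[t --> +oo] --> +oo ->
  growth_exponents a b !=set0 -> growth_index a b < m ->
  exists2 C, 0 < C & \forall t \near +oo, b t <= C * expR (m * ln (a t)).
Proof.
move=> aoo exps mum.
have hinf : has_inf (growth_exponents a b).
  by split=> //; exists 1 => x [].
have m0 : 0 < m - growth_index a b by rewrite subr_gt0.
have [m' [m'1 m'O] m'm] := inf_adherent m0 hinf.
have {}m'm : m' < m by move: m'm; rewrite -/(growth_index a b); lra.
have [C C0 hC] := bigO_inftyP m'O; exists C => //.
have near1 : \forall t \near +oo, 1 <= a t by move/cvgryPge : aoo; exact.
apply: filterS2 near1 hC => t a1 bt; have a0 : 0 < a t by lra.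
apply: le_trans (ler_norm _) _; apply: le_trans bt _.
rewrite ger0_norm ?powR_ge0// /powR gt_eqF// ler_pM2l// ler_expR.
by rewrite ler_wpM2r ?ln_ge0// ltW.
Qed.

Lemma mean_count_infty : a t @[t --> +oo] --> +oo -> b t @[t --> +oo] --> +oo.
Proof.
move=> aoo; apply/cvgryPge => K; move/cvgryPge : aoo => /(_ K).
apply: filterS2 (nbhs_pinfty_ge (num_real 0)) => t t0 Kt.
by apply: le_trans Kt _; exact: var_le_mean.
Qed.

Lemma var_count_bounded K : exists C, forall t, 0 < t <= K -> a t <= C.
Proof.
exists (b (Num.max K 1)) => t /andP[t0 tK].
have t0' := ltW t0.
apply: le_trans (var_le_mean mA indepA X_fin EX_fin t0') _.
by apply: mean_count_le => //; rewrite le_max tK.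
Qed.

(** The levels [1 / k.+1] and [1 / k.+2] suffice, so that only countably many
    exceptional null sets are involved. *)
Lemma lil_of_bounds (c : R) (H : R -> R) : 0 < c ->
  a t @[t --> +oo] --> +oo -> H t @[t --> +oo] --> +oo ->
  (forall e, 0 < e <= 1 -> ae_eventually_below P A c H e) ->
  (forall e, 0 < e <= 1 / 2 -> ae_frequently_above P A c H e) ->
  {ae P, forall w, limf_esup (fun t : R =>
    ((X t w - b t) / Num.sqrt (2 * c * a t * H t))%:E) +oo_R = 1%E}.
Proof.
move=> c0 aoo Hoo up low.
have up' : {ae P, forall w, forall k : nat, \forall t \near +oo,
    X t w - b t <= (1 + k.+1%:R^-1) * Num.sqrt (2 * c * a t * H t)}.
  apply/ae_foralln => k; apply: up; rewrite invr_gt0 ltr0n/=.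
  by rewrite invf_le1 ?ltr0n// ler1n.
have low' : {ae P, forall w, forall k : nat, forall t0, exists2 t, t0 <= t &
    (1 - k.+2%:R^-1) * Num.sqrt (2 * c * a t * H t) <= X t w - b t}.
  apply/ae_foralln => k; apply: low; rewrite invr_gt0 ltr0n/= div1r.
  by rewrite lef_pV2 ?posrE ?ltr0n// ler_nat.
move: up' low'; apply: filterS2 => w up' low'; apply: limf_esup_eq1.
- have a0 : \forall t \near +oo, 0 < a t by move/cvgryPgt : aoo; exact.
  have H0 : \forall t \near +oo, 0 < H t by move/cvgryPgt : Hoo; exact.
  by apply: filterS2 a0 H0 => t at0 Ht0; rewrite sqrtr_gt0 !mulr_gt0.
- move=> e /andP[e0 _]; pose k := Num.truncn e^-1.
  apply: filterS (up' k) => t /le_trans; apply.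
  rewrite ler_wpM2r ?sqrtr_ge0// lerD2l -[leRHS]invrK lef_pV2 ?posrE ?invr_gt0 ?ltr0n//.
  have e1 : 0 <= e^-1 by rewrite invr_ge0 ltW.
  by have /andP[_ /ltW] := truncn_itv e1.
- move=> e /andP[e0 _] t0; pose k := Num.truncn e^-1.
  have [t t0t ht] := low' k t0; exists t => //; apply: le_trans ht.
  rewrite ler_wpM2r ?sqrtr_ge0// lerD2l lerN2 -[leRHS]invrK lef_pV2 ?posrE ?invr_gt0 ?ltr0n//.
  have e1 : 0 <= e^-1 by rewrite invr_ge0 ltW.
  have /andP[_ /ltW h] := truncn_itv e1.
  by apply: le_trans h _; rewrite ler_nat.
Qed.

Section scales.
Variables (c : R) (H : R -> R).
Hypothesis c_gt0 : 0 < c.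
Hypothesis a_infty : a t @[t --> +oo] --> +oo.
Hypothesis H_infty : H t @[t --> +oo] --> +oo.
Hypothesis H_small : forall eta, 0 < eta -> \forall t \near +oo, H t <= eta * a t.
Hypothesis a_mono : almost_nondecreasing a.
Hypothesis H_mono : almost_nondecreasing H.

(** The partition condition pins [b] at the passage times to the levels up to
    [B]; with this the growth of the variance there, assumed in implicational
    form, gives the bound. The constants are [e / 12 = del] and
    [e / 96 = del / 8]. *)
Lemma ae_eventually_below_of_growth (mu q e rho kap B th : R) N j s : 0 < e <= 1 ->
  1 < B -> 0 < kap ->
  (forall n, (N <= n)%N -> partition_with_increments b B
     (t_seq b rho kap mu q n) (t_seq b rho kap mu q n.+1) (j n) (s n)) ->
  v_seq rho kap mu q n @[n --> \oo] --> +oo ->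
  1 - e / 96 <= c * th ->
  ((\forall n \near \oo, v_seq rho kap mu q n - B <=
      b (t_seq b rho kap mu q n) <= v_seq rho kap mu q n + B) ->
   t_seq b rho kap mu q n @[n --> \oo] --> +oo ->
   (exists K, \forall n \near \oo,
      th * ln n%:R - K <= H (t_seq b rho kap mu q n)) /\
   \forall n \near \oo, (b (t_seq b rho kap mu q n.+1) -
     b (t_seq b rho kap mu q n)) * expR (kap / 2 * ln n%:R) <=
     a (t_seq b rho kap mu q n)) ->
  ae_eventually_below P A c H e.
Proof.
move=> e01 B1 kap0 part voo cth grow.
have [e0 e1] : 0 < e /\ e <= 1 by exact/andP.
set tn := t_seq b rho kap mu q in part grow; set v := v_seq rho kap mu q in voo grow.
have tnE n : tn n = first_passage b (v n) by [].
have boo := mean_count_infty a_infty.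
have bm s' t : 0 < s' -> s' <= t -> b s' <= b t by exact: mean_count_le.
have bK K : exists C, forall t, 0 < t <= K -> b t <= C.
  exists (b (Num.max K 1)) => t /andP[t0 tK].
  by apply: bm => //; rewrite le_max tK.
have tnoo : tn n @[n --> \oo] --> +oo.
  have := first_passage_infty boo bK voo; exact.
have [N' _ N'P] : \forall n \near \oo, 0 < tn n by move/cvgryPgt : tnoo; exact.
have bv : \forall n \near \oo, v n - B <= b (tn n) <= v n + B.
  exists (maxn N N').+1 => // n /= Nn.
  apply: (partition_passage (N := maxn N N') (j := j) (s := s) boo bm _ _ Nn).
  - by move=> m; rewrite geq_max => /andP[_ Nm]; exact: N'P.
  - by move=> m; rewrite geq_max => /andP[Nm _]; exact: part.
have [[K Hge] incr] := grow bv tnoo.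
pose del := e / 12.
have d01 : 0 < del < 1 by rewrite /del; lra.
have kap2 : 0 < kap / 2 by lra.
apply: (ae_eventually_below_of_partition mA indepA X_fin EX_fin incA c_gt0 a_infty H_infty H_small
  e01 (erefl del) B1 kap2 part tnoo _ _ incr).
- exact: almost_nondecreasingM.
- have near1 := near_infty_ln (c * K / (del / 8)).
  have near2 := near_infty_ln (0 : R).
  near=> n.
  have h1 : th * ln n%:R - K <= H (tn n) by near: n.
  have h2 : c * K / (del / 8) <= ln (n%:R : R) by near: n.
  have h3 : 0 <= ln (n%:R : R) by near: n.
  have d8 : 0 < del / 8 by rewrite /del; lra.
  rewrite ler_pdivrMr// in h2.
  have := ler_wpM2l (ltW c_gt0) h1; have := ler_wpM2r h3 cth.
  by rewrite /del in h2 *; lra.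
Unshelve. all: by end_near. Qed.

Lemma ae_frequently_above_of_selection (mu q e gamma th1 th2 K : R) (S : R -> set nat) n0
  (tn := tau_seq a gamma mu q) : 0 < e <= 1 / 2 ->
  (forall n, (n0 <= n)%N -> 0 < tn n) ->
  trivIset [set n | (n0 <= n)%N] (fun n => S (tn n)) ->
  (\forall t \near +oo, (1 - (e / 32) ^+ 2) * a t <= var_count_in P A (S t) t) ->
  tn n @[n --> \oo] --> +oo ->
  1 / 2 < th1 -> th2 < 1 + e / 40 ->
  (\forall n \near \oo, th1 * ln n%:R - K <= c * H (tn n) <= th2 * ln n%:R + K) ->
  ae_frequently_above P A c H e.
Proof.
move=> e01 tn0 dS S_big tnoo th1_gt th2_lt cH.
apply: (ae_frequently_above_of_blocks mA indepA X_fin EX_fin incA c_gt0 a_infty H_infty H_small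
  e01 tn0 dS tnoo).
- exact: (tnoo _ S_big).
- have d0 : 0 < 1 + e / 40 - th2 by lra.
  have near1 := near_infty_ln (K / (1 + e / 40 - th2)).
  apply: filterS2 cH near1 => n /andP[_ h1]; rewrite ler_pdivrMr//; lra.
- have d0 : 0 < th1 - 1 / 2 by lra.
  have near1 := near_infty_ln (K / (th1 - 1 / 2)).
  apply: filterS2 cH near1 => n /andP[h1 _]; rewrite ler_pdivrMr//; lra.
Qed.

End scales.

End lil.


Section regularity.
Context {R : realType} (a : R -> R).
Hypothesis a_infty : a t @[t --> +oo] --> +oo.

Lemma ln_ratio_regular : ln (a (t - 1)) / ln (a t) @[t --> +oo] --> (1 : R) ->
  forall e, 0 < e -> \forall t \near +oo, ln (a t) <= (1 + e) * ln (a (t - 1)).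
Proof.
move=> reg e e0; have e1 : 0 < e / (1 + e) by rewrite divr_gt0//; lra.
have near1 : \forall t \near +oo, 0 < ln (a t).
  by move/cvgryPgt : (cvgr_ln_pinfty a_infty); exact.
move/cvgrPdist_lt : reg => /(_ _ e1); apply: filterS2 near1 => t lt.
rewrite ltr_norml => /andP[_ h].
have h1 : (1 + e)^-1 <= ln (a (t - 1)) / ln (a t).
  have -> : (1 + e)^-1 = 1 - e / (1 + e) by field; rewrite gt_eqF//; lra.
  by lra.
rewrite ler_pdivlMr// mulrC ler_pdivrMr in h1; last by lra.
by lra.
Qed.

Lemma ratio_regular : a (t - 1) / a t @[t --> +oo] --> (1 : R) ->
  forall e, 0 < e -> \forall t \near +oo, ln (a t) <= (1 + e) * ln (a (t - 1)).
Proof.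
move=> reg e e0; have e1 : 0 < 1 / 2 :> R by lra.
have near1 : \forall t \near +oo, 0 < a t by move/cvgryPgt : a_infty; exact.
have near2 : \forall t \near +oo, ln 2 + ln 2 / e <= ln (a t).
  by move/cvgryPge : (cvgr_ln_pinfty a_infty); exact.
move/cvgrPdist_lt : reg => /(_ _ e1); apply: filterS3 near1 near2 => t at0 lt.
rewrite ltr_norml => /andP[_ h].
have h1 : a t / 2 <= a (t - 1).
  have : 1 / 2 <= a (t - 1) / a t by lra.
  by rewrite ler_pdivlMr//; lra.
have : ln (a t / 2) <= ln (a (t - 1)) by rewrite ler_ln ?posrE; lra.
rewrite ln_div ?posrE// => h2.
have h3 : ln 2 / e <= ln (a (t - 1)) by lra.
by rewrite ler_pdivrMr// in h3; lra.
Qed.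

End regularity.

Section two_cases.
Context d (T : measurableType d) (R : realType) (P : probability T R).
Variable A : nat -> R -> set T.
Hypothesis mA : forall (k : nat) (t : R), 0 <= t -> measurable (A k t).
Hypothesis indepA : independent_families P A.
Hypothesis X_fin :
  forall t : R, 0 <= t -> {ae P, forall w, (ecount_events A t w < +oo)%E}.
Hypothesis EX_fin : forall t : R, 0 <= t -> ('E_P[count_events A t] < +oo)%E.
Hypothesis incA :
  forall (k : nat) (s t : R), 0 < s -> s < t -> A k s `<=` A k t.

Let X := count_events A.
Let b := mean_count P A.
Let a := var_count P A.

Hypothesis a_infty : a t @[t --> +oo] --> +oo.
Hypothesis a_mono : almost_nondecreasing a.

Let ab t : 0 < t -> a t <= b t.
Proof. by move=> t0; apply: var_le_mean => //; exact: ltW. Qed.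

Let a_bounded K : exists C, forall t, 0 < t <= K -> a t <= C.
Proof. exact: var_count_bounded. Qed.

Variable q : R.

(** Here the scale is [ln \o ln \o a] with constant [q + 1]; slow variation of [L]
    makes it smaller than any power of [ln a]. *)
Lemma lil_log (L : R -> R) : 0 <= q -> slowly_varying L ->
  bigO_infty (fun t => b t / a t) (fun t => log_gauge L q (a t)) ->
  partition_condition a b 1 q ->
  (eventually_continuous a \/
   forall e, 0 < e -> \forall t \near +oo, ln (a t) <= (1 + e) * ln (a (t - 1))) ->
  (selection_approx P A 1 q \/ selection_exact P A 1 q) ->
  {ae P, forall w, limf_esup (fun t : R => ((X t w - b t) /
     Num.sqrt (2 * (q + 1) * a t * ln (ln (a t))))%:E) +oo_R = 1%E}.
Proof.
move=> q0 svL bO part reg sel.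
have c0 : 0 < q + 1 by lra.
have lnoo := cvgr_ln_pinfty a_infty.
have Hoo := cvgr_ln_pinfty lnoo.
have lmono := almost_nondecreasing_ln a_infty a_mono.
have Hmono := almost_nondecreasing_ln lnoo lmono.
have Hsmall eta : 0 < eta -> \forall t \near +oo, ln (ln (a t)) <= eta * a t.
  move=> eta0.
  have near1 : \forall t \near +oo, ln (ln (a t)) <= 1 * ln (a t).
    exact: (lnoo _ (near_pinfty_ln_le ltr01)).
  have near2 : \forall t \near +oo, ln (a t) <= eta * a t.
    exact: (a_infty (near_pinfty_ln_le eta0)).
  by apply: filterS2 near1 near2 => t; lra.
apply: lil_of_bounds => //.
- move=> e e01; have [e0 e1] : 0 < e /\ e <= 1 by exact/andP.
  (* [rho] and [kap] are so small that [(q + 1) * al] is at least [1 - e / 96] *)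
  pose rho := e / 192.
  have rho01 : 0 < rho < 1 by rewrite /rho; lra.
  have [rho0 _] : 0 < rho /\ rho < 1 by exact/andP.
  have [kappa0 kappa00 hk] := part rho rho01.
  pose kap := Num.min kappa0 (e / 192) / 2.
  have m0 : 0 < Num.min kappa0 (e / 192) by rewrite lt_min kappa00; lra.
  have m1 : Num.min kappa0 (e / 192) <= kappa0 by rewrite ge_min lexx.
  have m2 : Num.min kappa0 (e / 192) <= e / 192 by rewrite ge_min lexx orbT.
  have kap0 : 0 < kap by rewrite /kap; lra.
  have kap1 : kap <= e / 384 by rewrite /kap; lra.
  have kapk : 0 < kap < kappa0 by rewrite /kap; lra.
  have [B B1 [N [j [s [hpart _]]]]] := hk kap kapk.
  pose al := (1 - kap) / ((q + rho) + 1).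
  have al0 : 0 < al by rewrite divr_gt0; lra.
  have vE n : (0 < n)%N -> v_seq rho kap 1 q n = expR (expR (al * ln n%:R)).
    by move=> n0; rewrite /v_seq eqxx /powR gt_eqF// ltr0n.
  have [C C0 bC] : exists2 C, 0 < C & \forall t \near +oo,
      b t <= C * a t * expR ((q + rho) * ln (ln (a t))).
    have [C C0 hC] := bigO_inftyP bO.
    have [C' [x0 LC]] := slowly_varying_le_powR svL rho0.
    have [M LM] := slowly_varying_gt0 svL.
    pose C1 := Num.max C' 1.
    have C10 : 0 < C1 by rewrite lt_max ltr01 orbT.
    exists (C * C1); first by rewrite mulr_gt0.
    have near1 : \forall t \near +oo, Num.max x0 (Num.max M 0) + 1 <= ln (a t).
      by move/cvgryPge : lnoo; exact.
    have near2 : \forall t \near +oo, 0 < a t by move/cvgryPgt : a_infty; exact.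
    apply: filterS3 hC near1 near2 => t bt la at0.
    have la1 : x0 <= ln (a t).
      by apply: le_trans la; rewrite ler_wpDr// le_max lexx.
    have la2 : M < ln (a t).
      by apply: lt_le_trans la; rewrite ltr_pwDr// !le_max lexx orbT.
    have la3 : 0 < ln (a t).
      by apply: lt_le_trans la; rewrite ltr_pwDr// !le_max lexx !orbT.
    have Lpos : 0 < L (ln (a t)) by exact: LM.
    have Lle : L (ln (a t)) <= C1 * expR (rho * ln (ln (a t))).
      apply: le_trans (LC _ la1) _; rewrite /powR gt_eqF//.
      by rewrite ler_wpM2r ?expR_ge0// le_max lexx.
    have := le_trans (ler_norm _) bt; rewrite ler_pdivrMr// => /le_trans; apply.
    rewrite /log_gauge /powR gt_eqF// ger0_norm; last first.
      by rewrite mulr_ge0 ?expR_ge0// ltW.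
    have -> : C * C1 * a t * expR ((q + rho) * ln (ln (a t))) =
        C * (expR (q * ln (ln (a t))) * (C1 * expR (rho * ln (ln (a t))))) * a t.
      by rewrite mulrDl expRD; ring.
    rewrite ler_pM2r// ler_pM2l//; apply: ler_wpM2l => //; exact: expR_ge0.
  apply: (ae_eventually_below_of_growth mA indepA X_fin EX_fin incA c0 a_infty Hoo Hsmall
    a_mono Hmono e01 B1 kap0 hpart (th := al)).
  + apply/cvgryPge => K.
    have := @near_infty_ln_le_expR R 0 K 1 al ltr01 al0.
    move=> near1; near=> n.
    have n0 : (0 < n)%N by near: n; exact: nbhs_infty_gt.
    have h : 0 * ln n%:R + K <= 1 * expR (al * ln (n%:R : R)) by near: n.
    by rewrite vE//; have := expR_ge1Dx (expR (al * ln (n%:R : R))); lra.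
  + rewrite /al mulrA ler_pdivlMr; last by lra.
    by rewrite /rho; nra.
  + move=> bv tnoo; have B0 : 0 < B by lra.
    have sg0 : 0 <= q + rho by lra.
    apply: (growth_log B0 a_infty ab tnoo C0 sg0 al0 kap0 _ vE bC bv).
    by rewrite /al; field; rewrite gt_eqF//; lra.
- move=> e e01; have [e0 e1] : 0 < e /\ e <= 1 / 2 by exact/andP.
  have sig0 : 0 < (e / 32) ^+ 2 by rewrite exprn_gt0 ?divr_gt0.
  have [gamma0 gamma00 hg] := selection_cases a_infty sel sig0.
  pose gamma := Num.min gamma0 (e / 80) / 2.
  have m0 : 0 < Num.min gamma0 (e / 80) by rewrite lt_min gamma00; lra.
  have m1 : Num.min gamma0 (e / 80) <= gamma0 by rewrite ge_min lexx.
  have m2 : Num.min gamma0 (e / 80) <= e / 80 by rewrite ge_min lexx orbT.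
  have g0 : 0 < gamma by rewrite /gamma; lra.
  have g1 : gamma <= e / 160 by rewrite /gamma; lra.
  have hgk : 0 < gamma < gamma0 by rewrite /gamma; lra.
  have [S [n0 [tau0 dS S_big]]] := hg gamma hgk.
  pose al := (1 + gamma) / (q + 1).
  have al0 : 0 < al by rewrite divr_gt0; lra.
  have wE n : (0 < n)%N -> w_seq gamma 1 q n = expR (expR (al * ln n%:R)).
    by move=> np; rewrite /w_seq eqxx /powR gt_eqF// ltr0n.
  have woo : w_seq gamma 1 q n @[n --> \oo] --> +oo.
    apply/cvgryPge => K.
    have near1 := @near_infty_ln_le_expR R 0 K 1 al ltr01 al0.
    near=> n.
    have np : (0 < n)%N by near: n; exact: nbhs_infty_gt.
    have h : 0 * ln n%:R + K <= 1 * expR (al * ln (n%:R : R)) by near: n.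
    by rewrite wE//; have := expR_ge1Dx (expR (al * ln (n%:R : R))); lra.
  have tauoo : tau_seq a gamma 1 q n @[n --> \oo] --> +oo.
    have := first_passage_infty a_infty a_bounded woo; exact.
  have half : 0 < (1 / 2 : R) < 1 by lra.
  have lna := ln_first_passage a_infty lmono a_bounded reg woo half.
  have [ln2_gt0 ln2_le1] : 0 < ln (2 : R) /\ ln (2 : R) <= 1.
    split; first by rewrite ln_gt0//; lra.
    by have := @le_ln1Dx R 1; apply; lra.
  apply: (ae_frequently_above_of_selection mA indepA X_fin EX_fin incA c0 a_infty Hoo Hsmall
    e01 tau0 dS S_big tauoo (th1 := 1) (th2 := 1 + gamma) (K := q + 1)).
  + by lra.
  + by lra.
  + near=> n.
    have np : (0 < n)%N by near: n; exact: nbhs_infty_gt.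
    have l0 : 0 <= ln (n%:R : R) by rewrite ln_ge0// ler1n.
    have : (1 - 1 / 2) * ln (w_seq gamma 1 q n) <= ln (a (tau_seq a gamma 1 q n))
      <= (1 + 1 / 2) * ln (w_seq gamma 1 q n) by near: n; exact: lna.
    rewrite wE// expRK; have := expR_gt0 (al * ln (n%:R : R)).
    set y := expR _; set x := ln (a _) => y0 /andP[h1 h2].
    have lny : ln y = al * ln n%:R by rewrite /y expRK.
    have h3 : ln (y / 2) <= ln x by rewrite ler_ln ?posrE; lra.
    have h4 : ln x <= ln (2 * y) by rewrite ler_ln ?posrE; lra.
    rewrite ln_div ?posrE// lny in h3; rewrite lnM ?posrE// lny in h4.
    have alq : (q + 1) * (al * ln n%:R) = (1 + gamma) * ln n%:R.
      by rewrite /al; field; rewrite gt_eqF.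
    have := ler_wpM2l (ltW c0) h3; have := ler_wpM2l (ltW c0) h4.
    have := ler_wpM2l (ltW c0) ln2_le1; have := mulr_ge0 (ltW g0) l0.
    rewrite mulrBr mulrDr alq => k1 k2 k3 k4.
    by apply/andP; split; lra.
Unshelve. all: by end_near. Qed.

Lemma lil_power (mu := growth_index a b) : 1 < mu ->
  growth_exponents a b !=set0 ->
  partition_condition a b mu q ->
  (eventually_continuous a \/
   forall e, 0 < e -> \forall t \near +oo, ln (a t) <= (1 + e) * ln (a (t - 1))) ->
  (selection_approx P A mu q \/ selection_exact P A mu q) ->
  {ae P, forall w, limf_esup (fun t : R => ((X t w - b t) /
     Num.sqrt (2 * (mu - 1) * a t * ln (a t)))%:E) +oo_R = 1%E}.
Proof.
move=> mu1 exps part reg sel.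
have muN1 : (mu == 1) = false by rewrite gt_eqF.
have c0 : 0 < mu - 1 by lra.
have lnoo := cvgr_ln_pinfty a_infty.
have lmono := almost_nondecreasing_ln a_infty a_mono.
have Hsmall eta : 0 < eta -> \forall t \near +oo, ln (a t) <= eta * a t.
  by move=> eta0; exact: (a_infty (near_pinfty_ln_le eta0)).
apply: lil_of_bounds => //.
- move=> e e01; have [e0 e1] : 0 < e /\ e <= 1 by exact/andP.
  (* [rho] and [kap] are so small that [(mu - 1) * th] is at least [1 - e / 96],
     and [kap * m <= 1] makes the levels grow at least linearly *)
  pose rho := Num.min (1 / 2) ((mu - 1) * (e / 192)).
  have ce0 : 0 < (mu - 1) * (e / 192) by rewrite mulr_gt0//; lra.
  have rho0 : 0 < rho by rewrite lt_min ce0 andbT; lra.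
  have rho1 : rho <= 1 / 2 by rewrite ge_min lexx.
  have rho2 : rho <= (mu - 1) * (e / 192) by rewrite ge_min lexx orbT.
  have rho01 : 0 < rho < 1 by lra.
  have [kappa0 kappa00 hk] := part rho rho01.
  pose m := mu + rho; have m0 : 0 < m by rewrite /m; lra.
  have m_gt1 : 1 < m by rewrite /m; lra.
  pose kap := Num.min kappa0 (Num.min (e / 192) m^-1) / 2.
  have k0 : 0 < Num.min kappa0 (Num.min (e / 192) m^-1).
    by rewrite !lt_min kappa00 invr_gt0 m0 andbT/=; lra.
  have k1 : Num.min kappa0 (Num.min (e / 192) m^-1) <= kappa0 by rewrite ge_min lexx.
  have k2 : Num.min kappa0 (Num.min (e / 192) m^-1) <= e / 192.
    by rewrite !ge_min lexx !orbT.
  have k3 : Num.min kappa0 (Num.min (e / 192) m^-1) <= m^-1.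
    by rewrite !ge_min lexx !orbT.
  have kap0 : 0 < kap by rewrite /kap; lra.
  have kap1 : kap <= e / 384 by rewrite /kap; lra.
  have kapk : 0 < kap < kappa0 by rewrite /kap; lra.
  have kapm : kap * m <= 1.
    rewrite -ler_pdivlMr// div1r /kap; have : 0 < m^-1 by rewrite invr_gt0.
    by lra.
  have [B B1 [N [j [s [hpart _]]]]] := hk kap kapk.
  pose th := (1 - kap) / (m - 1); pose be := m * th.
  have m10 : 0 < m - 1 by lra.
  have th0 : 0 < th by rewrite divr_gt0//; lra.
  have be1 : 1 <= be.
    by rewrite /be /th mulrA ler_pdivlMr//; lra.
  have vE n : (0 < n)%N -> v_seq rho kap mu q n = expR (be * ln n%:R).
    move=> n0; rewrite /v_seq muN1 /powR gt_eqF ?ltr0n//.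
    by rewrite /be /th /m mulrA.
  have mum : mu < m by rewrite /m; lra.
  have [C C0 bC] := growth_index_bigO a_infty exps mum.
  apply: (ae_eventually_below_of_growth mA indepA X_fin EX_fin incA c0 a_infty lnoo Hsmall
    a_mono lmono e01 B1 kap0 hpart (th := th)).
  + apply/cvgryPge => K.
    have near1 := @near_infty_ln_le_expR R 0 K 1 be ltr01 (lt_le_trans ltr01 be1).
    near=> n.
    have n0 : (0 < n)%N by near: n; exact: nbhs_infty_gt.
    have h : 0 * ln n%:R + K <= 1 * expR (be * ln (n%:R : R)) by near: n.
    by rewrite vE//; lra.
  + rewrite /th mulrA ler_pdivlMr// /m.
    by nra.
  + move=> bv tnoo; have B0 : 0 < B by lra.
    apply: (growth_power B0 a_infty tnoo C0 m0 kap0 be1 (erefl be) _ vE bC bv).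
    by rewrite /be /th; field; rewrite gt_eqF.
- move=> e e01; have [e0 e1] : 0 < e /\ e <= 1 / 2 by exact/andP.
  have sig0 : 0 < (e / 32) ^+ 2 by rewrite exprn_gt0 ?divr_gt0.
  have [gamma0 gamma00 hg] := selection_cases a_infty sel sig0.
  pose gamma := Num.min gamma0 (e / 80) / 2.
  have m0 : 0 < Num.min gamma0 (e / 80) by rewrite lt_min gamma00; lra.
  have m1 : Num.min gamma0 (e / 80) <= gamma0 by rewrite ge_min lexx.
  have m2 : Num.min gamma0 (e / 80) <= e / 80 by rewrite ge_min lexx orbT.
  have g0 : 0 < gamma by rewrite /gamma; lra.
  have g1 : gamma <= e / 160 by rewrite /gamma; lra.
  have hgk : 0 < gamma < gamma0 by rewrite /gamma; lra.
  have [S [n0 [tau0 dS S_big]]] := hg gamma hgk.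
  pose th := (1 + gamma) / (mu - 1).
  have th0 : 0 < th by rewrite divr_gt0; lra.
  have wE n : (0 < n)%N -> w_seq gamma mu q n = expR (th * ln n%:R).
    by move=> np; rewrite /w_seq muN1 /powR gt_eqF// ltr0n.
  have woo : w_seq gamma mu q n @[n --> \oo] --> +oo.
    apply/cvgryPge => K.
    have near1 := @near_infty_ln_le_expR R 0 K 1 th ltr01 th0.
    near=> n.
    have np : (0 < n)%N by near: n; exact: nbhs_infty_gt.
    have h : 0 * ln n%:R + K <= 1 * expR (th * ln (n%:R : R)) by near: n.
    by rewrite wE//; lra.
  have tauoo : tau_seq a gamma mu q n @[n --> \oo] --> +oo.
    have := first_passage_infty a_infty a_bounded woo; exact.
  have e100 : 0 < e / 100 < 1 by lra.
  have lna := ln_first_passage a_infty lmono a_bounded reg woo e100.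
  apply: (ae_frequently_above_of_selection mA indepA X_fin EX_fin incA c0 a_infty lnoo Hsmall
    e01 tau0 dS S_big tauoo (th1 := (1 - e / 100) * (1 + gamma))
    (th2 := (1 + e / 100) * (1 + gamma)) (K := 0)).
  + by nra.
  + by nra.
  + near=> n.
    have np : (0 < n)%N by near: n; exact: nbhs_infty_gt.
    have : (1 - e / 100) * ln (w_seq gamma mu q n) <= ln (a (tau_seq a gamma mu q n))
      <= (1 + e / 100) * ln (w_seq gamma mu q n) by near: n; exact: lna.
    rewrite wE// expRK => /andP[h1 h2].
    have alq : (mu - 1) * (th * ln n%:R) = (1 + gamma) * ln n%:R.
      by rewrite /th; field; rewrite gt_eqF.
    have := ler_wpM2l (ltW c0) h1; have := ler_wpM2l (ltW c0) h2.
    rewrite (mulrCA _ (1 + e / 100)) (mulrCA _ (1 - e / 100)) alq => k1 k2.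
    by rewrite subr0 addr0 -!mulrA k1 k2.
Unshelve. all: by end_near. Qed.

End two_cases.

Theorem theorem1p6 (d : measure_display) (T : measurableType d) (R : realType)
  (P : probability T R) (A : nat -> R -> set T) (q : R) (L : R -> R)
  (mA : forall (k : nat) (t : R), 0 <= t -> measurable (A k t))
  (indepA : independent_families P A)
  (X_fin : forall t : R, 0 <= t -> {ae P, forall w, (ecount_events A t w < +oo)%E})
  (EX_fin : forall t : R, 0 <= t -> ('E_P[count_events A t] < +oo)%E) :
  let X := count_events A in
  let b := mean_count P A in
  let a := var_count P A in
  let mu := growth_index a b in
  a t @[t --> +oo] --> +oo ->
  (exists2 a0 : R -> R,
     {in `[0, +oo[ &, {homo a0 : s t / s <= t}} &
     a t / a0 t @[t --> +oo] --> (1 : R)) ->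
  growth_exponents a b !=set0 ->
  (mu = 1 ->
     (eventually_continuous b \/
      (0 < limf_einf (fun t : R => (ln (b (t - 1)) / ln (b t))%:E)
             +oo_R)%E) /\
     [/\ 0 <= q, slowly_varying L,
         bigO_infty (fun t => b t / a t) (fun t => log_gauge L q (a t)) &
         0 < q -> forall s : R, 0 < s < q ->
           ~ bigO_infty (fun t => b t / a t) (fun t => log_gauge L s (a t))]) ->
  (forall (k : nat) (s t : R), 0 < s -> s < t -> A k s `<=` A k t) ->
  partition_condition a b mu q ->
  (eventually_continuous a \/
   ((mu = 1 -> ln (a (t - 1)) / ln (a t) @[t --> +oo] --> (1 : R)) /\
    (1 < mu -> a (t - 1) / a t @[t --> +oo] --> (1 : R)))) ->
  (selection_approx P A mu q \/ selection_exact P A mu q) ->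
  (mu = 1 ->
     {ae P, forall w,
       limf_esup (fun t : R => ((X t w - b t) /
           Num.sqrt (2 * (q + 1) * a t * ln (ln (a t))))%:E)
         +oo_R = 1%E}) /\
  (1 < mu ->
     {ae P, forall w,
       limf_esup (fun t : R => ((X t w - b t) /
           Num.sqrt (2 * (mu - 1) * a t * ln (a t)))%:E)
         +oo_R = 1%E}).
Proof.
move=> X b a mu a_infty [a0 a0_mono a_equiv] exps log_case incA part reg sel.
have a_mono := almost_nondecreasing_equiv a_infty a0_mono a_equiv.
split=> [mu1|mu1].
- have [_ [q0 svL bO _]] := log_case mu1.
  rewrite mu1 in part sel.
  apply: (lil_log mA indepA X_fin EX_fin incA a_infty a_mono q0 svL bO part _ sel).
  case: reg => [acont|[reg _]]; [by left|right].
  exact: ln_ratio_regular (reg mu1).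
- apply: (lil_power mA indepA X_fin EX_fin incA a_infty a_mono mu1 exps part _ sel).
  case: reg => [acont|[_ reg]]; [by left|right].
  exact: ratio_regular (reg mu1).
Qed.
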